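(* There exist bounded measurable sets $A \subset \mathbb{R}^3$ and $B \subset \mathbb{R}^3$ such that $A$ is not spectral in $\mathbb{R}^3$ but the Cartesian product $A \times B$ is spectral in $\mathbb{R}^6$.
   Context: Let $G$ be a locally compact abelian group endowed with Haar measure (for $G=\mathbb{R}^d$, Lebesgue measure). A bounded measurable set $S \subset G$ of non-zero measure is called spectral in $G$ if there exists a collection of (continuous, unitary) characters of $G$ whose restrictions to $S$ form an orthogonal basis of $L^2(S)$. For $G=\mathbb{R}^d$ the characters are the functions $x \mapsto e^{2\pi i \langle \lambda, x\rangle}$ with $\lambda \in \mathbb{R}^d$. The product $A\times B \subset \mathbb{R}^3\times\mathbb{R}^3$ is regarded as a subset of $\mathbb{R}^6$. *)

(* Defs.v *)
From HB Require Import structures.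
From mathcomp Require Import all_boot all_order all_algebra.
From mathcomp Require Import all_classical all_reals all_analysis.
From mathcomp Require Import complex.

Set Implicit Arguments.
Unset Strict Implicit.
Unset Printing Implicit Defensive.

Import Order.TTheory GRing.Theory Num.Theory.
Import numFieldNormedType.Exports.

Local Open Scope classical_set_scope.
Local Open Scope ring_scope.
Local Open Scope complex_scope.

(* R^n is [n.-tuple R], whose library sigma-algebra is the product one, i.e.
   the Borel sets: "measurable" means Borel measurable throughout.
   [lebesgue_Rn] below is the n-fold product of the Lebesgue measure on R. *)

Section lebesgue_cons.
Context (R : realType) (n : nat).
Variable m : {sigma_finite_measure set (n.-tuple R) -> \bar R}.

Definition cons_pair (p : R * n.-tuple R) : n.+1.-tuple R :=
  [tuple of p.1 :: p.2].

Lemma measurable_cons_pair : measurable_fun [set: R * n.-tuple R] cons_pair.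
Proof.
by apply: measurable_cons; [exact: measurable_fst|exact: measurable_snd].
Qed.

Definition lebesgue_cons : set (n.+1.-tuple R) -> \bar R :=
  pushforward (lebesgue_measure \x m)%E cons_pair.

Let lebesgue_cons0 : lebesgue_cons set0 = 0%E.
Proof. by rewrite /lebesgue_cons /pushforward preimage_set0 measure0. Qed.

Let lebesgue_cons_ge0 A : (0 <= lebesgue_cons A)%E.
Proof. by rewrite /lebesgue_cons /pushforward measure_ge0. Qed.

Let measurable_preimage_cons A : measurable A -> measurable (cons_pair @^-1` A).
Proof.
move=> mA; rewrite -[X in measurable X]setTI; exact: measurable_cons_pair.
Qed.

Let lebesgue_cons_sigma_additive : semi_sigma_additive lebesgue_cons.
Proof.
move=> F mF tF mUF; rewrite /lebesgue_cons /pushforward preimage_bigcup.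
apply: measure_semi_sigma_additive.
- by move=> k; exact: measurable_preimage_cons.
- apply/trivIsetP => i j _ _ ij; rewrite -preimage_setI.
  by move/trivIsetP : tF => /(_ _ _ _ _ ij) ->//; rewrite preimage_set0.
- by rewrite -preimage_bigcup; exact: measurable_preimage_cons.
Qed.

HB.instance Definition _ := isMeasure.Build _ _ _ lebesgue_cons
  lebesgue_cons0 lebesgue_cons_ge0 lebesgue_cons_sigma_additive.

Let lebesgue_cons_sigma_finite : sigma_finite setT lebesgue_cons.
Proof.
have [F1 TF1 F1oo] := sigma_finiteT (@lebesgue_measure R).
have [F2 TF2 F2oo] := sigma_finiteT m.
pose G (k : nat) : set (n.+1.-tuple R) :=
  if unpickle k is Some (i, j) then
    [set z | F1 i (thead z) /\ F2 j [tuple of behead z]] else set0.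
exists G.
  apply/seteqP; split=> // z _.
  have : setT (thead z) by [].
  rewrite TF1 => -[i _ Fi].
  have : setT [tuple of behead z] by [].
  rewrite TF2 => -[j _ Fj].
  by exists (pickle (i, j)) => //; rewrite /G pickleK.
move=> k; rewrite /G; case: (unpickle k) => [[i j]|]; last first.
  by split => //; rewrite lebesgue_cons0 ltry.
have [mF1 F1i] := F1oo i.
have [mF2 F2j] := F2oo j.
split.
  apply: measurableI.
    rewrite -[X in measurable X]setTI.
    exact: (measurable_tnth ord0).
  rewrite -[X in measurable X]setTI.
  exact: measurable_behead.
rewrite /lebesgue_cons /pushforward.
rewrite (_ : _ @^-1` _ = F1 i `*` F2 j); last first.
  apply/seteqP; split=> -[a b] /=; rewrite theadE.
    move=> [? Fb]; split => //.
    rewrite (_ : b = [tuple of behead (cons_pair (a, b))])//; exact/val_inj.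
  move=> [? Fb]; split => //; rewrite (_ : [tuple of _] = b)//; exact/val_inj.
by rewrite product_measure1E// lte_mul_pinfty// ge0_fin_numE.
Qed.

HB.instance Definition _ := Measure_isSigmaFinite.Build _ _ _ lebesgue_cons
  lebesgue_cons_sigma_finite.

End lebesgue_cons.

Fixpoint lebesgue_Rn (R : realType) (n : nat) :
    {sigma_finite_measure set (n.-tuple R) -> \bar R} :=
  match n with
  | 0 => \d_([tuple] : 0.-tuple R)
  | n'.+1 => lebesgue_cons (lebesgue_Rn R n')
  end.

Section spectral_sets.
Context (R : realType) (n : nat).
Local Notation Rn := (n.-tuple R).
Local Notation mu := (lebesgue_Rn R n).
Implicit Types (S : set Rn) (f g : Rn -> R[i]).

Definition bounded_Rn S : Prop :=
  exists M : R, forall x, S x -> forall i, `|tnth x i| <= M.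

Definition dot (x y : Rn) : R := \sum_(i < n) tnth x i * tnth y i.

(* [L2_sqnorm], [in_L2] and [L2_dot] only depend on the restriction of their
   function arguments to [S]. *)
Definition L2_sqnorm S f : \bar R :=
  (\int[mu]_(x in S) (Normc.normc (f x) ^+ 2)%R%:E)%E.

Definition in_L2 S f : Prop :=
  [/\ measurable_fun S (fun x => complex.Re (f x)),
      measurable_fun S (fun x => complex.Im (f x)) &
      (L2_sqnorm S f < +oo)%E].

(* The integrals are meaningful when [f] and [g] are in L^2(S). *)
Definition L2_dot S f g : R[i] :=
  (\int[mu]_(x in S) complex.Re (f x * (g x)^*)) +i*
  (\int[mu]_(x in S) complex.Im (f x * (g x)^*)).

(* The family [e] indexed by [L] is an orthogonal basis of the Hilbert space
   L^2(S): nonzero pairwise orthogonal vectors whose finite linear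
   combinations are dense. *)
Definition orthogonal_basis_L2 S (I : Type) (L : set I) (e : I -> Rn -> R[i]) :
    Prop :=
  [/\ forall i, L i -> in_L2 S (e i) /\ L2_dot S (e i) (e i) <> 0,
      forall i j, L i -> L j -> i <> j -> L2_dot S (e i) (e j) = 0 &
      forall f, in_L2 S f -> forall eps : R, 0 < eps ->
        exists (m : nat) (k : 'I_m -> I) (c : 'I_m -> R[i]),
          (forall t, L (k t)) /\
          (L2_sqnorm S (fun x => f x - \sum_(t < m) c t * e (k t) x)%R
             < (eps ^+ 2)%:E)%E].

(* x |-> exp(2 pi i <l, x>) *)
Definition character (l x : Rn) : R[i] :=
  cos (2 * pi * dot l x) +i* sin (2 * pi * dot l x).

Definition spectral S : Prop :=
  [/\ bounded_Rn S, measurable S, mu S <> 0%E &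
      exists L : set Rn, orthogonal_basis_L2 S L character].

End spectral_sets.

Definition prod_set (R : realType) (m n : nat) (A : set (m.-tuple R))
    (B : set (n.-tuple R)) : set ((m + n).-tuple R) :=
  [set cat_tuple x y | x in A & y in B].

(* Main.v *)
(** Both sets are unions of unit cells: A over a finite set T_A of integer points in
[0, M)^3, B over six integer points T_B. Every residue class of Z^3 modulo M is
uniquely a sum of T_A + T_B, and the characters (p, q) with M p in Z^3 and q - p in
Z^3 then form a spectrum of A x B.

T_A is designed so that its exponential sum does not vanish within distance 1/M of (l
- l') / 8, modulo Z^3, for l, l' in a certain six-element subset L of (Z/8)^3. If A
had a spectrum, an averaging argument based on Bessel's inequality would yield #T_A of
its points in a common translate of the unit cube. Sort these points according to the
position of M m modulo M / 8, after moving that cube to [0, 1)^3. Within one class the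
points m lie, up to an error less than 1/M, in a common translate of the grid Z^3 / 8,
and by orthogonality the translates of L by the corresponding elements of (Z/8)^3 are
disjoint. So a class contains at most 85 = floor(512 / 6) points, whence 6 #T_A <= 6 *
85 (M / 8)^3 < M^3, which contradicts the tiling. *)

(* A spectrum of A is arbitrary and need not meet any lattice. Hence the exponential sum of T_A must
   be controlled on neighbourhoods of the points (l - l') / 8, and not only at them. Here M = 264 K
   for the period 264 = 8 * 3 * 11 of the membership condition of T_A: over one period a
   perturbation of size 1/M changes little when K is large, and the sum over the K periods along
   each axis splits off as a geometric sum without zeros in that range. The three moduli have
   separate tasks. Modulo 11, the first coordinate cuts Z^3 into classes, at least one for each of
   the nine differences d of L up to sign. In a class of d, T_A keeps the z with d . z in {0, 1, 2,
   3} modulo 8, so the terms e(d . z / 8), with e(t) = exp(2 pi i t), get positive imaginary parts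
   after rotation by e(1/16); for every other nonzero d the imaginary parts in that class cancel. A
   linear condition modulo 3 then keeps a third of that half, so that six translates can fill Z^3.
   The argument rests on six not dividing 8^3: rounding 512/6 down to 85 is the only source of the
   contradiction. *)
Require Import Defs.
From HB Require Import structures.
From mathcomp Require Import all_boot all_order all_algebra.
From mathcomp Require Import all_classical all_reals all_analysis.
From mathcomp Require Import measurable_realfun complex.
From mathcomp Require Import ring lra zify.

Set Implicit Arguments.
Unset Strict Implicit.
Unset Printing Implicit Defensive.

Import Order.TTheory GRing.Theory Num.Theory.
Import numFieldNormedType.Exports.
Import HBNNSimple.

Local Open Scope classical_set_scope.
Local Open Scope ring_scope.
Local Open Scope complex_scope.

(** * Complex-valued integrals *)

Section complex_facts.
Context {R : realType}.
Implicit Types z w : R[i].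

Lemma complex_eqP z w :
  complex.Re z = complex.Re w -> complex.Im z = complex.Im w -> z = w.
Proof. by case: z w => [a b] [c d] /= -> ->. Qed.

Lemma cReD z w : complex.Re (z + w) = complex.Re z + complex.Re w.
Proof. by case: z w => [a b] [c d]. Qed.

Lemma cImD z w : complex.Im (z + w) = complex.Im z + complex.Im w.
Proof. by case: z w => [a b] [c d]. Qed.

Lemma cReM z w : complex.Re (z * w) =
  complex.Re z * complex.Re w - complex.Im z * complex.Im w.
Proof. by case: z w => [a b] [c d]. Qed.

Lemma cImM z w : complex.Im (z * w) =
  complex.Re z * complex.Im w + complex.Im z * complex.Re w.
Proof. by case: z w => [a b] [c d]. Qed.

Lemma cReN z : complex.Re (- z) = - complex.Re z. Proof. by case: z. Qed.
Lemma cImN z : complex.Im (- z) = - complex.Im z. Proof. by case: z. Qed.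
Lemma cReJ z : complex.Re (conjc z) = complex.Re z. Proof. by case: z. Qed.
Lemma cImJ z : complex.Im (conjc z) = - complex.Im z. Proof. by case: z. Qed.

Lemma cRe_sum (I : Type) (r : seq I) (P : pred I) (F : I -> R[i]) :
  complex.Re (\sum_(i <- r | P i) F i) = \sum_(i <- r | P i) complex.Re (F i).
Proof. exact: (big_morph _ cReD). Qed.

Lemma cIm_sum (I : Type) (r : seq I) (P : pred I) (F : I -> R[i]) :
  complex.Im (\sum_(i <- r | P i) F i) = \sum_(i <- r | P i) complex.Im (F i).
Proof. exact: (big_morph _ cImD). Qed.

Lemma conjE z : Num.conj z = conjc z. Proof. by []. Qed.

Lemma conjcD z w : conjc (z + w) = conjc z + conjc w. Proof. exact: rmorphD. Qed.
Lemma conjcM z w : conjc (z * w) = conjc z * conjc w. Proof. exact: rmorphM. Qed.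
Lemma conjcN z : conjc (- z) = - conjc z. Proof. exact: rmorphN. Qed.

Lemma conjc_sum (I : Type) (r : seq I) (P : pred I) (F : I -> R[i]) :
  conjc (\sum_(i <- r | P i) F i) = \sum_(i <- r | P i) conjc (F i).
Proof. exact: rmorph_sum. Qed.

Lemma real_complexD (a b : R) : (a + b)%:C = a%:C + b%:C :> R[i].
Proof. exact: rmorphD. Qed.

Lemma real_complexM (a b : R) : (a * b)%:C = a%:C * b%:C :> R[i].
Proof. exact: rmorphM. Qed.

Lemma real_complexN (a : R) : (- a)%:C = - a%:C :> R[i].
Proof. exact: rmorphN. Qed.

Lemma real_complex_nat (k : nat) : (k%:R : R)%:C = k%:R :> R[i].
Proof. exact: rmorph_nat. Qed.

Lemma sqr_normcE z :
  Normc.normc z ^+ 2 = complex.Re z ^+ 2 + complex.Im z ^+ 2.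
Proof.
by case: z => a b /=; rewrite sqr_sqrtr// addr_ge0// sqr_ge0.
Qed.

Lemma mul_conjcE z : z * z^* = (Normc.normc z ^+ 2)%:C.
Proof.
rewrite sqr_normcE; case: z => a b; apply: complex_eqP => /=; ring.
Qed.

Lemma normc_ge0 z : 0 <= Normc.normc z.
Proof. by case: z => a b; exact: sqrtr_ge0. Qed.

Lemma normcJ z : Normc.normc (conjc z) = Normc.normc z.
Proof. by case: z => a b /=; rewrite sqrrN. Qed.

Lemma normc_Re z : `|complex.Re z| <= Normc.normc z.
Proof.
case: z => a b /=; rewrite -sqrtr_sqr; apply: ler_wsqrtr.
by rewrite lerDl sqr_ge0.
Qed.

Lemma normc_Im z : `|complex.Im z| <= Normc.normc z.
Proof.
case: z => a b /=; rewrite -sqrtr_sqr; apply: ler_wsqrtr.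
by rewrite lerDr sqr_ge0.
Qed.

Lemma normc_le_ReIm z : Normc.normc z <= `|complex.Re z| + `|complex.Im z|.
Proof.
rewrite -(@ler_pXn2r _ 2) ?nnegrE ?normc_ge0 ?addr_ge0//.
rewrite sqr_normcE sqrrD !real_normK ?num_real//.
by rewrite lerD2r lerDl mulrn_wge0// mulr_ge0// normr_ge0.
Qed.

Lemma normc_real (a : R) : Normc.normc a%:C = `|a|.
Proof. by rewrite /= expr0n /= addr0 sqrtr_sqr. Qed.

Lemma normc_sum (I : Type) (r : seq I) (P : pred I) (F : I -> R[i]) :
  Normc.normc (\sum_(i <- r | P i) F i) <= \sum_(i <- r | P i) Normc.normc (F i).
Proof.
apply: (big_ind2 (fun z a => Normc.normc z <= a)) => //.
  by rewrite /= expr0n /= addr0 sqrtr0.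
by move=> x a y b xa yb; rewrite (le_trans (le_normcD _ _))// lerD.
Qed.

Lemma normc_prod (I : Type) (r : seq I) (P : pred I) (F : I -> R[i]) :
  Normc.normc (\prod_(i <- r | P i) F i) = \prod_(i <- r | P i) Normc.normc (F i).
Proof. exact: (big_morph _ (@Normc.normcM _) (Normc.normc1 _)). Qed.

Lemma sqr_normcD_le z w :
  Normc.normc (z + w) ^+ 2 <= 2 * Normc.normc z ^+ 2 + 2 * Normc.normc w ^+ 2.
Proof.
rewrite !sqr_normcE cReD cImD.
have h (a b : R) : (a + b) ^+ 2 <= 2 * a ^+ 2 + 2 * b ^+ 2.
  by rewrite -subr_ge0 [X in 0 <= X](_ : _ = (a - b) ^+ 2); [exact: sqr_ge0|ring].
have := h (complex.Re z) (complex.Re w).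
have := h (complex.Im z) (complex.Im w); lra.
Qed.

End complex_facts.

Section complex_integral.
Context d (T : measurableType d) (R : realType).
Variable mu : {measure set T -> \bar R}.
Implicit Types (D : set T) (f g : T -> R[i]).

Definition cint D f : R[i] :=
  (\int[mu]_(x in D) complex.Re (f x)) +i* (\int[mu]_(x in D) complex.Im (f x)).

Lemma Re_cint D f :
  complex.Re (cint D f) = \int[mu]_(x in D) complex.Re (f x).
Proof. by []. Qed.

Lemma Im_cint D f :
  complex.Im (cint D f) = \int[mu]_(x in D) complex.Im (f x).
Proof. by []. Qed.

(** These functions form an algebra stable under conjugation and are integrable on every measurable
    set of finite measure, so [cint] is linear on them without integrability side conditions.
    Measurability on the whole space lets one hypothesis serve every domain. *)
Definition bmfun f : Prop :=
  [/\ measurable_fun setT (fun x => complex.Re (f x)),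
      measurable_fun setT (fun x => complex.Im (f x)) &
      exists M : R, forall x, Normc.normc (f x) <= M].

Lemma eq_cint D f g : (forall x, D x -> f x = g x) -> cint D f = cint D g.
Proof.
by move=> fg; congr (_ +i* _); apply: eq_Rintegral => x /set_mem Dx; rewrite fg.
Qed.

Lemma bmfun_cst c : bmfun (fun=> c).
Proof. by split; [exact: measurable_cst..|exists (Normc.normc c)]. Qed.

Lemma bmfunD f g : bmfun f -> bmfun g -> bmfun (fun x => f x + g x).
Proof.
move=> [f1 f2 [Mf f3]] [g1 g2 [Mg g3]]; split.
- by under eq_fun do rewrite cReD; exact: measurable_funD.
- by under eq_fun do rewrite cImD; exact: measurable_funD.
- by exists (Mf + Mg) => x; rewrite (le_trans (le_normcD _ _))// lerD.
Qed.

Lemma bmfunM f g : bmfun f -> bmfun g -> bmfun (fun x => f x * g x).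
Proof.
move=> [f1 f2 [Mf f3]] [g1 g2 [Mg g3]]; split.
- by under eq_fun do rewrite cReM; apply: measurable_funB; exact: measurable_funM.
- by under eq_fun do rewrite cImM; apply: measurable_funD; exact: measurable_funM.
- by exists (Mf * Mg) => x; rewrite Normc.normcM ler_pM// normc_ge0.
Qed.

Lemma bmfunZ c f : bmfun f -> bmfun (fun x => c * f x).
Proof. by move=> bf; apply: bmfunM => //; exact: bmfun_cst. Qed.

Lemma bmfunJ f : bmfun f -> bmfun (fun x => (f x)^*).
Proof.
move=> [f1 f2 [M f3]]; split.
- by under eq_fun do rewrite cReJ.
- by under eq_fun do rewrite cImJ; exact: measurableT_comp.
- by exists M => x; rewrite normcJ.
Qed.

Lemma bmfunN f : bmfun f -> bmfun (fun x => - f x).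
Proof.
move=> bf; rewrite (_ : (fun x => - f x) = (fun x => -1 * f x)).
  exact: bmfunZ.
by apply/funext => x; rewrite mulNr mul1r.
Qed.

Lemma bmfunB f g : bmfun f -> bmfun g -> bmfun (fun x => f x - g x).
Proof. by move=> bf bg; exact: bmfunD bf (bmfunN bg). Qed.

Lemma bmfun_sum (I : Type) (r : seq I) (P : pred I) (F : I -> T -> R[i]) :
  (forall i, P i -> bmfun (F i)) -> bmfun (fun x => \sum_(i <- r | P i) F i x).
Proof.
move=> bF; elim: r => [|i r ih].
  rewrite (_ : (fun x => _) = fun=> 0); first exact: bmfun_cst.
  by apply/funext => x; rewrite big_nil.
rewrite (_ : (fun x => _) = if P i then fun x => F i x + \sum_(i <- r | P i) F i x
  else fun x => \sum_(i <- r | P i) F i x); last first.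
  by apply/funext => x; rewrite big_cons; case: ifP.
by case: ifPn => // Pi; apply: bmfunD => //; exact: bF.
Qed.

Lemma bounded_integrable D (u : T -> R) (M : R) : measurable D ->
  (mu D < +oo)%E -> measurable_fun D u -> (forall x, D x -> `|u x| <= M) ->
  mu.-integrable D (EFin \o u).
Proof.
move=> mD fD mu_ uM; apply: measurable_bounded_integrable => //.
exists M; split; first exact: num_real.
by move=> N MN x Dx; apply: (le_trans (uM _ Dx)); exact: ltW.
Qed.

Section finite_domain.
Variable D : set T.
Hypotheses (mD : measurable D) (fD : (mu D < +oo)%E).

Lemma bmfun_integrable_Re f : bmfun f ->
  mu.-integrable D (EFin \o (fun x => complex.Re (f x))).
Proof.
move=> [f1 _ [M fM]]; apply: (@bounded_integrable _ _ M) => //.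
  exact: measurable_funTS.
by move=> x _; rewrite (le_trans (normc_Re _)).
Qed.

Lemma bmfun_integrable_Im f : bmfun f ->
  mu.-integrable D (EFin \o (fun x => complex.Im (f x))).
Proof.
move=> [_ f1 [M fM]]; apply: (@bounded_integrable _ _ M) => //.
  exact: measurable_funTS.
by move=> x _; rewrite (le_trans (normc_Im _)).
Qed.

Lemma cintD f g : bmfun f -> bmfun g ->
  cint D (fun x => f x + g x) = cint D f + cint D g.
Proof.
move=> bf bg; apply: complex_eqP => /=.
- under eq_Rintegral do rewrite cReD.
  by rewrite RintegralD//; exact: bmfun_integrable_Re.
- under eq_Rintegral do rewrite cImD.
  by rewrite RintegralD//; exact: bmfun_integrable_Im.
Qed.

Lemma cintZ c f : bmfun f -> cint D (fun x => c * f x) = c * cint D f.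
Proof.
move=> bf; have ir := bmfun_integrable_Re bf; have ii := bmfun_integrable_Im bf.
have Z (u : T -> R) (a : R) : mu.-integrable D (EFin \o u) ->
    mu.-integrable D (EFin \o (fun x => a * u x)).
  move=> iu; rewrite (_ : _ \o _ = (fun x => a%:E * (EFin \o u) x)%E).
    exact: integrableZl.
  by apply/funext => x /=; rewrite EFinM.
apply: complex_eqP; rewrite ?cReM ?cImM /=.
- under eq_Rintegral do rewrite cReM.
  by rewrite RintegralB ?RintegralZl//; exact: Z.
- under eq_Rintegral do rewrite cImM.
  by rewrite RintegralD ?RintegralZl//; exact: Z.
Qed.

Lemma cint0 : cint D (fun=> 0) = 0.
Proof.
by apply: complex_eqP; rewrite /= Rintegral_cst// mul0r.
Qed.

Lemma cint_sum (I : Type) (r : seq I) (P : pred I) (F : I -> T -> R[i]) :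
  (forall i, P i -> bmfun (F i)) ->
  cint D (fun x => \sum_(i <- r | P i) F i x) = \sum_(i <- r | P i) cint D (F i).
Proof.
move=> bF; elim: r => [|i r ih].
  by rewrite big_nil -[RHS]cint0; apply: eq_cint => x _; rewrite big_nil.
rewrite big_cons; case: ifPn => Pi.
  rewrite -ih -cintD//; [|exact: bF|exact: bmfun_sum].
  by apply: eq_cint => x _; rewrite big_cons Pi.
by rewrite -ih; apply: eq_cint => x _; rewrite big_cons (negbTE Pi).
Qed.

Lemma cintJ f : bmfun f -> cint D (fun x => (f x)^*) = (cint D f)^*.
Proof.
move=> bf; apply: complex_eqP => /=.
  by apply: eq_Rintegral => x _; rewrite cReJ.
under eq_Rintegral do rewrite cImJ -mulN1r.
by rewrite RintegralZl ?mulN1r//; exact: bmfun_integrable_Im.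
Qed.

Lemma integral_sqr_normc f : bmfun f ->
  (\int[mu]_(x in D) ((Normc.normc (f x)) ^+ 2)%:E)%E =
  (complex.Re (cint D (fun x => f x * (f x)^*)))%:E.
Proof.
move=> bf; have := bmfun_integrable_Re (bmfunM bf (bmfunJ bf)).
rewrite /cint /= (_ : (fun x => complex.Re (f x * (f x)^*)) =
  (fun x => Normc.normc (f x) ^+ 2)); last first.
  by apply/funext => x; rewrite mul_conjcE.
by move=> h; rewrite /Rintegral fineK//; exact: integrable_fin_num.
Qed.

Lemma integral_sqr_normc_fin f : bmfun f ->
  (\int[mu]_(x in D) ((Normc.normc (f x)) ^+ 2)%:E < +oo)%E.
Proof. by move=> bf; rewrite integral_sqr_normc// ltry. Qed.

End finite_domain.

Lemma cint_bigsetU (I : finType) (F : I -> set T) f :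
  (forall i, measurable (F i)) -> (forall i, (mu (F i) < +oo)%E) ->
  trivIset setT F -> bmfun f ->
  cint (\bigcup_i F i) f = \sum_i cint (F i) f.
Proof.
move=> mF fF tF bf.
have E : \bigcup_i F i = \big[setU/set0]_(i <- enum I) F i.
  rewrite -bigcup_seq (_ : [set` enum I] = setT)//.
  by rewrite -subTset => i _ /=; rewrite mem_enum.
have tF' : trivIset [set` enum I] F by exact: sub_trivIset (@subsetT _ _) tF.
have fin (u : T -> R) i : measurable_fun setT u -> (exists M : R, forall x, `|u x| <= M) ->
    (\int[mu]_(x in F i) (u x)%:E)%E \is a fin_num.
  move=> mu_ [M uM]; apply: integrable_fin_num => //.
  by apply: (@bounded_integrable _ _ M) => //; exact: measurable_funTS.
have S (u : T -> R) : measurable_fun setT u -> (exists M : R, forall x, `|u x| <= M) ->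
    \int[mu]_(x in \bigcup_i F i) u x = \sum_i \int[mu]_(x in F i) u x.
  move=> mu_ uM; rewrite /Rintegral E integral_bigsetU_EFin ?enum_uniq//.
    by rewrite -sum_fine ?big_enum// => i _; exact: fin.
  by apply: measurable_funTS; exact/measurable_EFinP.
have [f1 f2 [M fM]] := bf.
apply: complex_eqP; rewrite ?cRe_sum ?cIm_sum /=; apply: S => //; exists M => x.
  exact: le_trans (normc_Re _) _.
exact: le_trans (normc_Im _) _.
Qed.

End complex_integral.

Section product_integral.
Context d1 d2 (T1 : measurableType d1) (T2 : measurableType d2) (R : realType).
Variables (m1 : {sigma_finite_measure set T1 -> \bar R})
          (m2 : {sigma_finite_measure set T2 -> \bar R}).
Variables (A : set T1) (B : set T2).
Hypotheses (mA : measurable A) (mB : measurable B).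
Hypotheses (fA : (m1 A < +oo)%E) (fB : (m2 B < +oo)%E).

Lemma setX_finite : ((m1 \x m2)%E (A `*` B) < +oo)%E.
Proof. by rewrite product_measure1E// lte_mul_pinfty// ge0_fin_numE. Qed.

Lemma Rintegral_setX (u : T1 -> R) (v : T2 -> R) (Mu Mv : R) :
  measurable_fun setT u -> (forall x, `|u x| <= Mu) ->
  measurable_fun setT v -> (forall x, `|v x| <= Mv) ->
  Rintegral (m1 \x m2)%E (A `*` B) (fun z => u z.1 * v z.2) =
  Rintegral m1 A u * Rintegral m2 B v.
Proof.
move=> mu_ uM mv vM.
have mAB : measurable (A `*` B) by exact: measurableX.
have iu : m1.-integrable A (EFin \o u).
  by apply: (@bounded_integrable _ _ _ _ _ _ Mu) => //; exact: measurable_funTS.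
have iv : m2.-integrable B (EFin \o v).
  by apply: (@bounded_integrable _ _ _ _ _ _ Mv) => //; exact: measurable_funTS.
pose w (z : T1 * T2) := (u z.1 * v z.2)%:E.
have iw : (m1 \x m2)%E.-integrable (A `*` B) w.
  apply: (@bounded_integrable _ _ _ _ _ _ (Mu * Mv)) => //.
  - exact: setX_finite.
  - apply: measurable_funTS; apply: measurable_funM.
      exact: measurableT_comp.
    exact: measurableT_comp.
  - by move=> x _; rewrite normrM ler_pM.
rewrite /Rintegral integral_mkcond -integral12_prod_meas1; last first.
  by rewrite -integrable_mkcond.
rewrite -fineM; [|exact: integrable_fin_num..].
have [c Ec] : exists c, (\int[m2]_(y in B) (v y)%:E = c%:E)%E.
  by exists (\int[m2]_(y in B) v y); rewrite fineK//; exact: (integrable_fin_num mB iv).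
congr fine; rewrite Ec -integralZr// [in RHS]integral_mkcond.
apply: eq_integral => x _; rewrite /fubini_F /patch.
have [xA|xA] := boolP (x \in A).
- rewrite muleC -Ec muleC -integralZl// [RHS]integral_mkcond; apply: eq_integral => y _.
  by rewrite /patch in_setX xA/= /w EFinM.
- by apply: integral0_eq => y _; rewrite in_setX (negbTE xA).
Qed.

Lemma cint_setX (u : T1 -> R[i]) (v : T2 -> R[i]) : bmfun u -> bmfun v ->
  cint (m1 \x m2)%E (A `*` B) (fun z => u z.1 * v z.2) =
  cint m1 A u * cint m2 B v.
Proof.
move=> bu bv; have [u1 u2 [Mu uM]] := bu; have [v1 v2 [Mv vM]] := bv.
have uR x : `|complex.Re (u x)| <= Mu by exact: le_trans (normc_Re _) (uM _).
have uI x : `|complex.Im (u x)| <= Mu by exact: le_trans (normc_Im _) (uM _).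
have vR x : `|complex.Re (v x)| <= Mv by exact: le_trans (normc_Re _) (vM _).
have vI x : `|complex.Im (v x)| <= Mv by exact: le_trans (normc_Im _) (vM _).
have mAB : measurable (A `*` B) by exact: measurableX.
have I (f : T1 -> R) (g : T2 -> R) : measurable_fun setT f ->
    (forall x, `|f x| <= Mu) -> measurable_fun setT g ->
    (forall x, `|g x| <= Mv) ->
    (m1 \x m2)%E.-integrable (A `*` B) (EFin \o (fun z => f z.1 * g z.2)).
  move=> mf fM mg gM.
  apply: (@bounded_integrable _ _ _ _ _ _ (Mu * Mv)) => //.
  - exact: setX_finite.
  - by apply: measurable_funTS; apply: measurable_funM; exact: measurableT_comp.
  - by move=> x _; rewrite normrM ler_pM.
pose ru x := complex.Re (u x); pose iu x := complex.Im (u x).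
pose rv x := complex.Re (v x); pose iv x := complex.Im (v x).
apply: complex_eqP; rewrite ?cReM ?cImM !Re_cint !Im_cint.
- under eq_Rintegral do rewrite cReM.
  rewrite RintegralB//; [|exact: (I ru rv)|exact: (I iu iv)].
  by rewrite (@Rintegral_setX ru rv Mu Mv)// (@Rintegral_setX iu iv Mu Mv).
- under eq_Rintegral do rewrite cImM.
  rewrite RintegralD//; [|exact: (I ru iv)|exact: (I iu rv)].
  by rewrite (@Rintegral_setX ru iv Mu Mv)// (@Rintegral_setX iu rv Mu Mv).
Qed.

End product_integral.

(** * Exponentials on unit cells *)

Section exponential.
Context {R : realType}.

Definition ee (t : R) : R[i] := cos (2 * pi * t) +i* sin (2 * pi * t).

Lemma eeD s t : ee (s + t) = ee s * ee t.
Proof.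
by rewrite /ee mulrDr cosD sinD; apply: complex_eqP; rewrite /= // addrC.
Qed.

Lemma ee0 : ee 0 = 1.
Proof. by rewrite /ee mulr0 cos0 sin0. Qed.

Lemma eeN t : ee (- t) = (ee t)^*.
Proof. by rewrite /ee mulrN cosN sinN. Qed.

Lemma normc_ee t : Normc.normc (ee t) = 1.
Proof. by rewrite /= cos2Dsin2 sqrtr1. Qed.

Lemma ee1 : ee 1 = 1.
Proof. by rewrite /ee mulr1 mulr_natl cos2pi sin2pi. Qed.

Lemma ee_nat (k : nat) : ee k%:R = 1.
Proof. by elim: k => [|k ih]; rewrite ?ee0// -natr1 eeD ih ee1 mulr1. Qed.

Lemma ee_int (z : int) : ee z%:~R = 1.
Proof.
by case: z => k; rewrite ?NegzE ?mulrNz ?eeN -?pmulrn ee_nat ?conjc1.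
Qed.

Lemma eeDint t (z : int) : ee (t + z%:~R) = ee t.
Proof. by rewrite eeD ee_int mulr1. Qed.

Lemma ee_sum (I : Type) (r : seq I) (P : pred I) (F : I -> R) :
  ee (\sum_(i <- r | P i) F i) = \prod_(i <- r | P i) ee (F i).
Proof. exact: (big_morph _ eeD ee0). Qed.

Lemma eeMn t (k : nat) : ee (t *+ k) = ee t ^+ k.
Proof. by elim: k => [|k ih]; rewrite ?mulr0n ?ee0// mulrS eeD ih exprS. Qed.

End exponential.

Section one_dimension.
Context {R : realType}.
Notation leb := (@lebesgue_measure R).

Lemma continuous_cosM (c : R) : continuous (fun t : R => cos (c * t)).
Proof.
move=> t; apply: (@continuous_comp _ _ _ (fun t => c * t) cos).
  exact: mulrl_continuous.
exact: continuous_cos.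
Qed.

Lemma continuous_sinM (c : R) : continuous (fun t : R => sin (c * t)).
Proof.
move=> t; apply: (@continuous_comp _ _ _ (fun t => c * t) sin).
  exact: mulrl_continuous.
exact: continuous_sin.
Qed.

Lemma Rintegral_FTC2 (f F : R -> R) (a b : R) : a < b -> continuous f ->
  (forall t : R, is_derive t 1 F (f t)) ->
  \int[leb]_(t in `[a, b[) f t = F b - F a.
Proof.
move=> ab cf dF.
have cF : continuous F.
  move=> t; apply: differentiable_continuous; apply/derivable1_diffP.
  by have [] := dF t.
rewrite Rintegral_itv_bndo_bndc; last first.
  apply: (@integrableS _ _ _ leb `[a, b]%classic) => //.
    by apply: subset_itvl; rewrite bnd_simp.
  apply: continuous_compact_integrable; first exact: segment_compact.
  exact: continuous_subspaceT.
rewrite /Rintegral (@continuous_FTC2 _ f F)//.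
- exact: continuous_subspaceT.
- split.
  + by move=> t _; have [] := dF t.
  + by apply: cvg_at_right_filter; exact: cF.
  + by apply: cvg_at_left_filter; exact: cF.
- by move=> t _; rewrite derive1E; exact: derive_val.
Qed.

Lemma Rintegral_cosM (c a b : R) : c != 0 -> a < b ->
  \int[leb]_(t in `[a, b[) cos (c * t) = (sin (c * b) - sin (c * a)) / c.
Proof.
move=> c0 ab.
have dF (t : R) : is_derive t 1 (fun t => c^-1 * sin (c * t)) (cos (c * t)).
  by apply: is_derive_eq; rewrite /GRing.scale /=; field.
by rewrite (Rintegral_FTC2 ab (@continuous_cosM _) dF) -mulrBr mulrC.
Qed.

Lemma Rintegral_sinM (c a b : R) : c != 0 -> a < b ->
  \int[leb]_(t in `[a, b[) sin (c * t) = (cos (c * a) - cos (c * b)) / c.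
Proof.
move=> c0 ab.
have dF (t : R) : is_derive t 1 (fun t => - c^-1 * cos (c * t)) (sin (c * t)).
  by apply: is_derive_eq; rewrite /GRing.scale /=; field.
by rewrite (Rintegral_FTC2 ab (@continuous_sinM _) dF) -mulrBr mulNr -mulrN opprB mulrC.
Qed.

End one_dimension.

Section integral_bound.
Context d (T : measurableType d) (R : realType).
Variables (mu : {measure set T -> \bar R}) (D : set T).
Hypotheses (mD : measurable D) (fD : (mu D < +oo)%E).

Lemma le_Rintegral_bound (u : T -> R) (M : R) : measurable_fun D u ->
  (forall x, D x -> `|u x| <= M) -> \int[mu]_(x in D) u x <= M * fine (mu D).
Proof.
move=> mu_ uM; rewrite -(Rintegral_cst mu mD); apply: le_Rintegral => //.
- exact: bounded_integrable uM.
- by apply: (@bounded_integrable _ _ _ _ _ _ `|M|).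
- by move=> x Dx; rewrite (le_trans (ler_norm _))// uM.
Qed.

(** With z the integral, the integral of conj(z) f is the real number |z|^2, while its integrand has
    real part at most |z| M. If z = 0, only [M * mu D >= 0] is left, and M can be negative only when
    D is empty. *)
Lemma normc_cint_le (f : T -> R[i]) (M : R) : bmfun f ->
  (forall x, D x -> Normc.normc (f x) <= M) ->
  Normc.normc (cint mu D f) <= M * fine (mu D).
Proof.
move=> bf fM; set z := cint mu D f.
have [z0|z0] := eqVneq (Normc.normc z) 0.
  rewrite z0; have [[x Dx]|D0] := pselect (exists x, D x).
    have M0 : 0 <= M by exact: le_trans (normc_ge0 _) (fM _ Dx).
    by rewrite mulr_ge0// fine_ge0.
  rewrite (_ : D = set0) ?measure0 ?mulr0//; apply/seteqP; split=> // x Dx.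
  by apply: D0; exists x.
have zgt0 : 0 < Normc.normc z by rewrite lt_neqAle eq_sym z0 normc_ge0.
have E : cint mu D (fun x => z^* * f x) = (Normc.normc z ^+ 2)%:C.
  by rewrite cintZ// mulrC mul_conjcE.
have : complex.Re (cint mu D (fun x => z^* * f x)) <=
    (Normc.normc z * M) * fine (mu D).
  rewrite Re_cint; apply: le_Rintegral_bound.
    by apply: measurable_funTS; have [] := bmfunZ z^* bf.
  move=> x Dx; rewrite (le_trans (normc_Re _))// Normc.normcM normcJ.
  by rewrite ler_wpM2l ?normc_ge0 ?fM.
by rewrite E /= expr2 -mulrA ler_pM2l.
Qed.

End integral_bound.

(** * Fourier transform of the unit interval *)

Section exponential_integral.
Context {R : realType}.
Notation leb := (@lebesgue_measure R).

(** The difference of sines is the integral of the cosine, bounded by 1, over the interval between b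
    and a. *)
Lemma sin_lip (a b : R) : `|sin a - sin b| <= `|a - b|.
Proof.
wlog ab : a b / b < a => [H|].
  have [/H//|ba|->] := ltgtP b a; last by rewrite !subrr.
  by rewrite distrC (distrC a); exact: H.
have := @Rintegral_cosM R 1 b a (oner_neq0 _) ab.
rewrite !mul1r divr1 => <-.
have mI : measurable (`[b, a[%classic : set R) by exact: measurable_itv.
have lI : leb `[b, a[%classic = (a - b)%:E.
  by rewrite lebesgue_measure_itv/= lte_fin ab EFinB.
have lf : (leb `[b, a[%classic < +oo)%E by rewrite lI ltry.
have ab0 : 0 <= a - b by rewrite subr_ge0 ltW.
rewrite (ger0_norm ab0).
have mc : measurable_fun setT (fun t : R => cos (1 * t)).
  by apply: continuous_measurable_fun; exact: continuous_cosM.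
apply: le_trans.
  apply: le_normr_Rintegral; first exact: mI.
  apply: (@bounded_integrable _ _ _ _ _ _ 1) => //.
  - exact: measurable_funTS.
  - by move=> x _; rewrite ler_norml cos_geN1 cos_le1.
rewrite -[leRHS]mul1r -[a - b]/(fine (a - b)%:E) -lI.
apply: le_Rintegral_bound => //.
- by apply: measurable_funTS; exact: measurableT_comp.
- by move=> x _; rewrite normr_id ler_norml cos_geN1 cos_le1.
Qed.

Lemma cos_lip (a b : R) : `|cos a - cos b| <= `|a - b|.
Proof.
rewrite -2!sinDpihalf (le_trans (sin_lip _ _))//.
by rewrite opprD addrACA subrr addr0.
Qed.

Lemma ee_lip (s t : R) : Normc.normc (ee s - ee t) <= 4 * pi * `|s - t|.
Proof.
rewrite (le_trans (normc_le_ReIm _))// cReD cImD cReN cImN.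
have := lerD (cos_lip (2 * pi * s) (2 * pi * t)) (sin_lip (2 * pi * s) (2 * pi * t)).
move=> /le_trans -> //; rewrite -mulrBr normrM ger0_norm ?mulr_ge0 ?pi_ge0//.
by rewrite (_ : _ + _ = 4 * pi * `|s - t|)//; ring.
Qed.

Lemma bmfun_ee d (T : measurableType d) (f : T -> R) : measurable_fun setT f ->
  bmfun (fun x => ee (f x)).
Proof.
move=> mf; split; last by exists 1 => x; rewrite normc_ee.
- have mc : measurable_fun setT (fun t : R => cos (2 * pi * t)).
    by apply: continuous_measurable_fun; exact: continuous_cosM.
  exact: measurableT_comp mc mf.
- have mc : measurable_fun setT (fun t : R => sin (2 * pi * t)).
    by apply: continuous_measurable_fun; exact: continuous_sinM.
  exact: measurableT_comp mc mf.
Qed.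

Lemma bmfun_eeM (s : R) : bmfun (fun t : R => ee (s * t)).
Proof. by apply: bmfun_ee; exact: mulrl_measurable. Qed.

(** The interval [a, a + 1[ is encoded as a fibre of the floor function, so that unit cells are
    fibres of the coordinatewise floor and their disjointness and product structure are
    immediate. *)
Definition floor_fiber (a : int) : set R := [set t | Num.floor t = a].

Lemma floor_fiberE a : floor_fiber a = `[a%:~R, (a + 1)%:~R[%classic.
Proof.
apply/seteqP; split=> t; rewrite /floor_fiber /= in_itv/= -floor_eq.
  by move=> ->.
by move/eqP.
Qed.

Lemma measurable_floor_fiber a : measurable (floor_fiber a).
Proof. by rewrite floor_fiberE; exact: measurable_itv. Qed.

Lemma lebesgue_floor_fiber a : leb (floor_fiber a) = 1%:E.
Proof.
rewrite floor_fiberE lebesgue_measure_itv/= lte_fin ltr_int ltzD1 lexx.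
by rewrite -EFinB -intrB addrC addKr.
Qed.

Lemma lebesgue_floor_fiber_lty a : (leb (floor_fiber a) < +oo)%E.
Proof. by rewrite lebesgue_floor_fiber ltry. Qed.

Lemma fine_lebesgue_floor_fiber a : fine (leb (floor_fiber a)) = 1.
Proof. by rewrite lebesgue_floor_fiber. Qed.

Lemma Rintegral_floor_fiber_cst a (r : R) :
  \int[leb]_(t in floor_fiber a) r = r.
Proof.
rewrite Rintegral_cst; last exact: measurable_floor_fiber.
by rewrite -[RHS]mulr1; congr (_ * _); exact: fine_lebesgue_floor_fiber.
Qed.

(* the Fourier transform (up to conjugation) of the indicator of [0, 1[ *)
Definition hh (s : R) : R[i] := cint leb (floor_fiber 0) (fun t => ee (s * t)).

Lemma cint_floor_fiberE (a : int) (s : R) : s != 0 ->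
  cint leb (floor_fiber a) (fun t => ee (s * t)) =
  ((sin (2 * pi * s * (a + 1)%:~R) - sin (2 * pi * s * a%:~R)) / (2 * pi * s)) +i*
  ((cos (2 * pi * s * a%:~R) - cos (2 * pi * s * (a + 1)%:~R)) / (2 * pi * s)).
Proof.
move=> s0; have c0 : 2 * pi * s != 0.
  by rewrite mulf_neq0// mulf_neq0// gt_eqF// pi_gt0.
have aa : a%:~R < (a + 1)%:~R :> R by rewrite ltr_int ltzD1.
rewrite floor_fiberE; apply: complex_eqP; rewrite ?Re_cint ?Im_cint /=.
- rewrite -Rintegral_cosM//; apply: eq_Rintegral => t _; congr cos; ring.
- rewrite -Rintegral_sinM//; apply: eq_Rintegral => t _; congr sin; ring.
Qed.

Lemma hh0 : hh 0 = 1.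
Proof.
apply: complex_eqP => /=.
- under eq_Rintegral do rewrite mul0r mulr0 cos0.
  exact: Rintegral_floor_fiber_cst.
- under eq_Rintegral do rewrite mul0r mulr0 sin0.
  exact: Rintegral_floor_fiber_cst.
Qed.

(** A translation by [a] multiplies a Fourier transform by a phase. Here both sides are compared
    through their closed forms; s = 0 is treated apart because these divide by s. *)
Lemma cint_floor_fiber (a : int) (s : R) :
  cint leb (floor_fiber a) (fun t => ee (s * t)) = ee (s * a%:~R) * hh s.
Proof.
have [->|s0] := eqVneq s 0.
  rewrite hh0 mul0r ee0 mulr1; apply: complex_eqP => /=.
  - under eq_Rintegral do rewrite mul0r mulr0 cos0.
    exact: Rintegral_floor_fiber_cst.
  - under eq_Rintegral do rewrite mul0r mulr0 sin0.
    exact: Rintegral_floor_fiber_cst.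
rewrite /hh !cint_floor_fiberE// intrD add0r mulrDr !mulr1 mulr0 sin0 cos0.
rewrite cosD sinD subr0 /ee mulrA.
have c0 : 2 * pi * s != 0 by rewrite mulf_neq0// mulf_neq0// gt_eqF// pi_gt0.
move: c0; set c := 2 * pi * s => c0.
by apply: complex_eqP; rewrite ?cReM ?cImM /=; ring.
Qed.

Lemma hhE (s : R) : s != 0 ->
  hh s = (sin (2 * pi * s) / (2 * pi * s)) +i* ((1 - cos (2 * pi * s)) / (2 * pi * s)).
Proof. by move=> s0; rewrite /hh cint_floor_fiberE// add0r mulr1 mulr0 sin0 cos0 subr0. Qed.

Lemma hh_int (z : int) : z != 0 -> hh z%:~R = 0.
Proof.
move=> z0; rewrite hhE ?intr_eq0//; have [-> ->] := ee_int (R := R) z.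
by rewrite subrr !mul0r.
Qed.

(** For s nonzero, a vanishing imaginary part means cos(2 pi s) = 1, hence sin(pi |s|) = 0, which 0
    < pi |s| < pi excludes. *)
Lemma hh_neq0 (s : R) : `|s| < 1 -> hh s != 0.
Proof.
move=> s1; have [->|s0] := eqVneq s 0; first by rewrite hh0 oner_neq0.
have c0 : 2 * pi * s != 0 by rewrite mulf_neq0// mulf_neq0// gt_eqF// pi_gt0.
rewrite hhE//; apply/eqP => -[_] /eqP.
rewrite mulf_eq0 invr_eq0 (negbTE c0) orbF subr_eq0 => /eqP c1.
have : cos (2 * pi * `|s|) = 1.
  by case: (ger0P s) => _; rewrite // mulrN cosN.
rewrite -mulrA mulr_natl cos_mulr2n => h.
have : sin (pi * `|s|) ^+ 2 = 0 by rewrite sin2cos2; lra.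
have : 0 < sin (pi * `|s|).
  apply: sin_gt0_pi; rewrite mulr_gt0 ?pi_gt0 ?normr_gt0//=.
  by rewrite gtr_pMr ?pi_gt0.
by move=> /gt_eqF sn0 /eqP; rewrite sqrf_eq0 sn0.
Qed.

Lemma normc_hh_le1 (s : R) : Normc.normc (hh s) <= 1.
Proof.
rewrite (le_trans (@normc_cint_le _ _ _ _ _ _ _ _ 1 _ _))//.
- exact: measurable_floor_fiber.
- exact: lebesgue_floor_fiber_lty.
- exact: bmfun_eeM.
- by move=> x _; rewrite normc_ee.
- by rewrite -[leRHS]mulr1 ler_wpM2l ?mulr_ge0 ?pi_ge0// (fine_lebesgue_floor_fiber 0).
Qed.

Lemma hh_lip (s t : R) : Normc.normc (hh s - hh t) <= 4 * pi * `|s - t|.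
Proof.
have E : hh s - hh t = cint leb (floor_fiber 0) (fun x => ee (s * x) + -1 * ee (t * x)).
  have mF := measurable_floor_fiber 0; have fF := lebesgue_floor_fiber_lty 0.
  have bs := bmfun_eeM s; have bt := bmfun_eeM t.
  by rewrite (cintD (mu := leb) mF fF bs (bmfunZ (-1) bt))
             (cintZ (mu := leb) mF fF (-1) bt) mulNr mul1r.
rewrite E (le_trans (@normc_cint_le _ _ _ _ _ _ _ _ (4 * pi * `|s - t|) _ _))//.
- exact: measurable_floor_fiber.
- exact: lebesgue_floor_fiber_lty.
- by apply: bmfunD; [|apply: bmfunZ]; exact: bmfun_eeM.
- move=> x; rewrite floor_fiberE [X in X -> _]/= in_itv add0r => /andP[x0 x1].
  rewrite mulNr mul1r; apply: (le_trans (ee_lip _ _)).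
  rewrite -mulrBl normrM (ger0_norm x0).
  by rewrite ler_wpM2l ?mulr_ge0 ?pi_ge0// ler_piMr// ltW.
- by rewrite -[leRHS]mulr1 ler_wpM2l ?mulr_ge0 ?pi_ge0// (fine_lebesgue_floor_fiber 0).
Qed.

End exponential_integral.

(** * Unit cells of R^n and their Fourier transforms *)

Section cells.
Context {R : realType}.
Notation leb := (@lebesgue_measure R).

Lemma tnth_behead0 n (x : n.+1.-tuple R) (i : 'I_n) :
  tnth [tuple of behead x] i = tnth x (lift ord0 i).
Proof. by rewrite tnth_behead; congr (tnth x _); apply: val_inj; rewrite /= inordK ?ltnS//. Qed.

Lemma tnth_cons_pair0 n (p : R * n.-tuple R) : tnth (cons_pair p) ord0 = p.1.
Proof. by []. Qed.

Lemma tnth_cons_pairS n (p : R * n.-tuple R) (i : 'I_n) :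
  tnth (cons_pair p) (lift ord0 i) = tnth p.2 i.
Proof. by rewrite /cons_pair tnthS. Qed.

Lemma dot_cons_pair n (l : n.+1.-tuple R) (p : R * n.-tuple R) :
  dot l (cons_pair p) = tnth l ord0 * p.1 + dot [tuple of behead l] p.2.
Proof.
rewrite /dot big_ord_recl tnth_cons_pair0; congr (_ + _).
by apply: eq_bigr => i _; rewrite tnth_cons_pairS tnth_behead0.
Qed.

Lemma measurable_dot n (l : n.-tuple R) : measurable_fun setT (dot l).
Proof.
rewrite /dot; apply: measurable_sum => i.
by apply: measurable_funM; [exact: measurable_cst|exact: measurable_tnth].
Qed.

Lemma bmfun_character n (l : n.-tuple R) : bmfun (character l).
Proof. by apply: bmfun_ee; exact: measurable_dot. Qed.

Definition cell n (a : 'I_n -> int) : set (n.-tuple R) :=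
  [set x | forall i, Num.floor (tnth x i) = a i].

Lemma measurable_cell n (a : 'I_n -> int) : measurable (cell a).
Proof.
rewrite (_ : cell a = \big[setI/setT]_(i < n) ((fun x => tnth x i) @^-1` floor_fiber (a i))).
  apply: bigsetI_measurable => i _; rewrite -[X in measurable X]setTI.
  by apply: measurable_tnth => //; exact: measurable_floor_fiber.
rewrite -bigcap_seq; apply/seteqP; split=> x /= h i => [_|]; first exact: h.
by apply: h; rewrite /= mem_index_enum.
Qed.

Lemma preimage_cons_cell n (a : 'I_n.+1 -> int) :
  @cons_pair R n @^-1` cell a = floor_fiber (a ord0) `*` cell (fun i => a (lift ord0 i)).
Proof.
apply/seteqP; split=> p /=.
  by move=> h; split=> [|i]; [exact: (h ord0)|rewrite -h tnth_cons_pairS].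
move=> [h0 h] i; case: (unliftP ord0 i) => [j|] ->; last exact: h0.
by rewrite tnth_cons_pairS h.
Qed.

Lemma lebesgue_cell n (a : 'I_n -> int) : lebesgue_Rn R n (cell a) = 1%E.
Proof.
elim: n a => [|n ih] a /=.
  by rewrite diracE mem_set// => -[].
rewrite /lebesgue_cons /pushforward preimage_cons_cell.
rewrite product_measure1E; last 2 first.
- exact: measurable_floor_fiber.
- exact: measurable_cell.
- by rewrite ih mule1; exact: lebesgue_floor_fiber.
Qed.

Lemma lebesgue_cell_lty n (a : 'I_n -> int) : (lebesgue_Rn R n (cell a) < +oo)%E.
Proof. by rewrite lebesgue_cell ltry. Qed.

Lemma Rintegral_cell_cst n (a : 'I_n -> int) (r : R) :
  \int[lebesgue_Rn R n]_(x in cell a) r = r.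
Proof.
rewrite Rintegral_cst; last exact: measurable_cell.
by rewrite -[RHS]mulr1; congr (_ * _); rewrite [X in fine X]lebesgue_cell.
Qed.

Lemma cint_cons n (m : {sigma_finite_measure set (n.-tuple R) -> \bar R})
    (D : set (n.+1.-tuple R)) (f : n.+1.-tuple R -> R[i]) :
  measurable D -> (lebesgue_cons m D < +oo)%E -> bmfun f ->
  cint (lebesgue_cons m) D f =
  cint (leb \x m)%E (@cons_pair R n @^-1` D) (f \o @cons_pair R n).
Proof.
move=> mD fD [f1 f2 [M fM]].
have mp := @measurable_cons_pair R n.
have S (u : n.+1.-tuple R -> R) : measurable_fun setT u ->
    (forall x, `|u x| <= M) ->
    \int[lebesgue_cons m]_(x in D) u x =
    \int[(leb \x m)%E]_(x in @cons_pair R n @^-1` D) u (cons_pair x).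
  move=> mu_ uM; rewrite /Rintegral; congr fine.
  transitivity (\int[pushforward (leb \x m) (@cons_pair R n)]_(x in D) (u x)%:E)%E.
    by apply: eq_measure_integral.
  rewrite integral_pushforward//.
  - exact/measurable_EFinP.
  - apply: (@bounded_integrable _ _ _ _ _ _ M) => //.
    + by rewrite -[X in measurable X]setTI; exact: mp.
    + by apply: measurable_funTS; exact: measurableT_comp.
by apply: complex_eqP; rewrite !(Re_cint, Im_cint); apply: S => // x;
  apply: le_trans (fM x); [exact: normc_Re|exact: normc_Im].
Qed.

(** By Fubini the transform of a cube is the product of the transforms of its sides; the induction
    follows the recursion in [lebesgue_Rn]. *)
Lemma cint_cell n (a : 'I_n -> int) (l : n.-tuple R) :
  cint (lebesgue_Rn R n) (cell a) (character l) =
  ee (\sum_i tnth l i * (a i)%:~R) * \prod_i hh (tnth l i).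
Proof.
elim: n a l => [|n ih] a l.
  rewrite !big_ord0 ee0 mulr1.
  transitivity (cint (lebesgue_Rn R 0) (cell a) (fun=> 1)).
    by apply: eq_cint => x _; rewrite /character /dot big_ord0 mulr0 cos0 sin0.
  by apply: complex_eqP; rewrite ?Re_cint ?Im_cint; exact: Rintegral_cell_cst.
rewrite cint_cons; last 3 first.
- exact: measurable_cell.
- exact: lebesgue_cell_lty.
- exact: bmfun_character.
rewrite preimage_cons_cell.
under eq_cint => p _.
  rewrite /= -[character _ _]/(ee (dot l (cons_pair p))) dot_cons_pair eeD; over.
rewrite (@cint_setX _ _ _ _ _ leb (lebesgue_Rn R n) _ _ _ _ _ _
  (fun t => ee (tnth l ord0 * t)) (character [tuple of behead l])); last 6 first.
- exact: measurable_floor_fiber.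
- exact: measurable_cell.
- exact: lebesgue_floor_fiber_lty.
- exact: lebesgue_cell_lty.
- exact: bmfun_eeM.
- exact: bmfun_character.
rewrite cint_floor_fiber ih !big_ord_recl eeD.
rewrite (eq_bigr (fun i => tnth l (lift ord0 i) * (a (lift ord0 i))%:~R)).
  rewrite [X in _ * (_ * X)](eq_bigr (fun i => hh (tnth l (lift ord0 i)))).
    by rewrite mulrACA.
  by move=> i _; rewrite tnth_behead0.
by move=> i _; rewrite tnth_behead0.
Qed.

End cells.

(** * Unions of unit cells at integer points *)

Section cell_unions.
Context {R : realType} (n : nat).
Notation Rn := (n.-tuple R).
Notation mu := (lebesgue_Rn R n).

Definition tadd (l m : Rn) : Rn := [tuple tnth l i + tnth m i | i < n].
Definition topp (l : Rn) : Rn := [tuple - tnth l i | i < n].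
Definition tsub (l m : Rn) : Rn := tadd l (topp m).

Lemma tnth_tadd l m i : tnth (tadd l m) i = tnth l i + tnth m i.
Proof. by rewrite tnth_mktuple. Qed.

Lemma tnth_topp l i : tnth (topp l) i = - tnth l i.
Proof. by rewrite tnth_mktuple. Qed.

Lemma tnth_tsub l m i : tnth (tsub l m) i = tnth l i - tnth m i.
Proof. by rewrite tnth_tadd tnth_topp. Qed.

Lemma characterE (l x : Rn) : character l x = ee (dot l x).
Proof. by []. Qed.

Lemma characterD (l m x : Rn) :
  character (tadd l m) x = character l x * character m x.
Proof.
rewrite !characterE -eeD /dot -big_split; congr ee; apply: eq_bigr => i _.
by rewrite tnth_tadd mulrDl.
Qed.

Lemma characterN (l x : Rn) : character (topp l) x = (character l x)^*.
Proof.
rewrite !characterE -eeN /dot -sumrN; congr ee; apply: eq_bigr => i _.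
by rewrite tnth_topp mulNr.
Qed.

Lemma characterB (l m x : Rn) :
  character (tsub l m) x = character l x * (character m x)^*.
Proof. by rewrite characterD characterN. Qed.

Lemma normc_character (l x : Rn) : Normc.normc (character l x) = 1.
Proof. exact: normc_ee. Qed.

Definition hhprod (l : Rn) : R[i] := \prod_i hh (tnth l i).

Definition idot (l : Rn) (a : 'I_n -> int) : R := \sum_i tnth l i * (a i)%:~R.

Lemma hhprod0 (l : Rn) : (forall i, tnth l i = 0) -> hhprod l = 1.
Proof. by move=> l0; apply: big1 => i _; rewrite l0 hh0. Qed.

Lemma hhprod_int (l : Rn) (i : 'I_n) (z : int) :
  z != 0 -> tnth l i = z%:~R -> hhprod l = 0.
Proof. by move=> z0 lz; rewrite /hhprod (bigD1 i)//= lz hh_int// mul0r. Qed.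

Lemma hhprod_neq0 (l : Rn) : (forall i, `|tnth l i| < 1) -> hhprod l != 0.
Proof. by move=> l1; apply/prodf_neq0 => i _; exact: hh_neq0. Qed.

Lemma cint_cell_dot (a : 'I_n -> int) (l m : Rn) :
  cint mu (cell a) (fun x => character l x * (character m x)^*) =
  ee (idot (tsub l m) a) * hhprod (tsub l m).
Proof.
by rewrite -cint_cell; apply: eq_cint => x _; rewrite characterB.
Qed.

Section family.
Variables (I : finType) (a : I -> 'I_n -> int).
Hypothesis inja : injective a.

Definition cells : set Rn := \bigcup_i cell (a i).

Definition exp_sum (l : Rn) : R[i] := \sum_i ee (idot l (a i)).

Lemma trivIset_cells : trivIset setT (fun i => cell (R := R) (a i)).
Proof.
move=> i j _ _ [x [xi xj]]; apply: inja; apply/funext => k.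
by rewrite -xi -xj.
Qed.

Lemma cells_bigsetU : cells = \big[setU/set0]_i cell (a i).
Proof.
rewrite -bigcup_seq /cells (_ : [set` index_enum I] = setT)//.
by rewrite -subTset => i _ /=; rewrite mem_index_enum.
Qed.

Lemma measurable_cells : measurable cells.
Proof.
by rewrite cells_bigsetU; apply: bigsetU_measurable => i _; exact: measurable_cell.
Qed.

Lemma lebesgue_cells_lty : (mu cells < +oo)%E.
Proof.
have mD := measurable_cells.
rewrite -(mul1e (mu cells)) -integral_cst// cells_bigsetU ge0_integral_bigsetU//.
- rewrite lte_sum_pinfty// => i _; rewrite integral_cst ?mul1e.
    exact: lebesgue_cell_lty.
  exact: measurable_cell.
- by move=> i; exact: measurable_cell.
- exact: index_enum_uniq.
- exact: sub_trivIset (@subsetT _ _) trivIset_cells.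
Qed.

Lemma lebesgue_cells_neq0 (i : I) : mu cells <> 0%E.
Proof.
move=> mu0; have : (mu (cell (a i)) <= mu cells)%E.
  apply: le_measure; rewrite ?inE//.
  - exact: measurable_cell.
  - exact: measurable_cells.
  - by move=> x xi; exists i.
by rewrite mu0 lebesgue_cell leNgt lte01.
Qed.

Lemma bounded_cells : bounded_Rn cells.
Proof.
exists (\sum_(i : I) \sum_k (`|(a i k)%:~R| + 1)) => x [i _ xi] k.
rewrite (bigD1 i)//= (bigD1 k)//= -addrA.
have h : 0 <= \sum_(j < n | j != k) (`|(a i j)%:~R| + 1 : R) +
    \sum_(j | j != i) \sum_k (`|(a j k)%:~R| + 1 : R).
  by apply: addr_ge0; apply: sumr_ge0 => j _; [|apply: sumr_ge0 => ? _];
    rewrite addr_ge0.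
have /andP[] := floor_itv (tnth x k); rewrite xi intrD => x1 x2.
have : `|tnth x k| <= `|(a i k)%:~R| + 1.
  rewrite ler_norml; apply/andP; split.
    have := ler_norm (- (a i k)%:~R : R); rewrite normrN; lra.
  have := ler_norm ((a i k)%:~R : R); lra.
lra.
Qed.

Lemma cint_cells (f : Rn -> R[i]) : bmfun f ->
  cint mu cells f = \sum_i cint mu (cell (a i)) f.
Proof.
move=> bf; apply: cint_bigsetU => // i.
- exact: measurable_cell.
- exact: lebesgue_cell_lty.
- exact: trivIset_cells.
Qed.

(** The cells are integer translates of one cube, so the integral splits into a factor that sees
    only their positions and a factor that sees only the cube. Orthogonality means that one of the
    two vanishes; both halves of the theorem use this dichotomy. *)
Lemma L2_dot_character (l m : Rn) :
  L2_dot cells (character l) (character m) =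
  exp_sum (tsub l m) * hhprod (tsub l m).
Proof.
rewrite -[LHS]/(cint mu cells (fun x => character l x * (character m x)^*)).
rewrite cint_cells; last first.
  by apply: bmfunM; [|apply: bmfunJ]; exact: bmfun_character.
by rewrite /exp_sum mulr_suml; apply: eq_bigr => i _; rewrite cint_cell_dot.
Qed.

Lemma exp_sum0 (l : Rn) : (forall i, tnth l i = 0) -> exp_sum l = #|I|%:R.
Proof.
move=> l0; rewrite /exp_sum (eq_bigr (fun=> 1)) ?sumr_const// => i _.
by rewrite /idot big1 ?ee0// => k _; rewrite l0 mul0r.
Qed.

Lemma L2_dot_character_self (l : Rn) :
  L2_dot cells (character l) (character l) = #|I|%:R.
Proof.
have l0 i : tnth (tsub l l) i = 0 by rewrite tnth_tsub subrr.
by rewrite L2_dot_character exp_sum0// hhprod0// mulr1.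
Qed.

Lemma bmfun_in_L2 (f : Rn -> R[i]) : bmfun f -> in_L2 cells f.
Proof.
move=> bf; have [f1 f2 _] := bf; split; [exact: measurable_funTS..|].
apply: integral_sqr_normc_fin => //; first exact: measurable_cells.
exact: lebesgue_cells_lty.
Qed.

End family.
End cell_unions.

(** * Approximation in L2 by trigonometric polynomials *)

Section L2_closure.
Context d (T : measurableType d) (R : realType).
Variables (mu : {measure set T -> \bar R}) (D : set T).
Hypotheses (mD : measurable D) (fD : (mu D < +oo)%E).
Implicit Types f g : T -> R[i].

Definition cmeas f : Prop :=
  measurable_fun D (fun x => complex.Re (f x)) /\
  measurable_fun D (fun x => complex.Im (f x)).

Definition sqnorm f : \bar R :=
  (\int[mu]_(x in D) (Normc.normc (f x) ^+ 2)%R%:E)%E.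

Lemma bmfun_cmeas f : bmfun f -> cmeas f.
Proof. by move=> [f1 f2 _]; split; exact: measurable_funTS. Qed.

Lemma cmeasD f g : cmeas f -> cmeas g -> cmeas (fun x => f x + g x).
Proof.
move=> [f1 f2] [g1 g2]; split.
- by under eq_fun do rewrite cReD; exact: measurable_funD.
- by under eq_fun do rewrite cImD; exact: measurable_funD.
Qed.

Lemma cmeasM f g : cmeas f -> cmeas g -> cmeas (fun x => f x * g x).
Proof.
move=> [f1 f2] [g1 g2]; split.
- by under eq_fun do rewrite cReM; apply: measurable_funB; exact: measurable_funM.
- by under eq_fun do rewrite cImM; apply: measurable_funD; exact: measurable_funM.
Qed.

Lemma cmeas_cst c : cmeas (fun=> c).
Proof. by split; exact: measurable_cst. Qed.

Lemma cmeasB f g : cmeas f -> cmeas g -> cmeas (fun x => f x - g x).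
Proof.
move=> mf mg; apply: cmeasD => //.
rewrite (_ : (fun x => - g x) = (fun x => -1 * g x)).
  by apply: cmeasM => //; exact: cmeas_cst.
by apply/funext => x; rewrite mulNr mul1r.
Qed.

Lemma cmeas_sqr f : cmeas f ->
  measurable_fun D (fun x => ((Normc.normc (f x)) ^+ 2)%:E).
Proof.
move=> [f1 f2]; apply/measurable_EFinP; under eq_fun do rewrite sqr_normcE.
by apply: measurable_funD; apply: measurable_funX.
Qed.

Lemma sqnorm_ge0 f : (0 <= sqnorm f)%E.
Proof. by apply: integral_ge0 => x _; rewrite lee_fin sqr_ge0. Qed.

Lemma eq_sqnorm f g : (forall x, D x -> f x = g x) -> sqnorm f = sqnorm g.
Proof. by move=> fg; apply: eq_integral => x /set_mem Dx; rewrite fg. Qed.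

Lemma le_sqnorm f g : cmeas f -> cmeas g ->
  (forall x, D x -> Normc.normc (f x) <= Normc.normc (g x)) ->
  (sqnorm f <= sqnorm g)%E.
Proof.
move=> mf mg fg; apply: ge0_le_integral => //.
- by move=> x _; rewrite lee_fin sqr_ge0.
- exact: cmeas_sqr.
- exact: cmeas_sqr.
- by move=> x Dx; rewrite lee_fin ler_pXn2r ?nnegrE ?normc_ge0// fg.
Qed.

(** The pointwise bound |f + g|^2 <= 2 |f|^2 + 2 |g|^2 plays the part of the triangle inequality;
    its price is the factor 4 in [sqnormD_lt]. *)
Lemma sqnormD f g : cmeas f -> cmeas g ->
  (sqnorm (fun x => (f x + g x)%R) <= 2%:E * sqnorm f + 2%:E * sqnorm g)%E.
Proof.
move=> mf mg; rewrite /sqnorm -!ge0_integralZl_EFin//; last 4 first.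
- by move=> x _; rewrite lee_fin sqr_ge0.
- exact: cmeas_sqr.
- by move=> x _; rewrite lee_fin sqr_ge0.
- exact: cmeas_sqr.
have m2 h : cmeas h ->
    measurable_fun D (fun x => (2%:E * (Normc.normc (h x) ^+ 2)%:E)%E).
  by move=> mh; apply: measurable_funeM; exact: cmeas_sqr.
rewrite -ge0_integralD//; last 4 first.
- by move=> x _; rewrite mule_ge0// lee_fin sqr_ge0.
- exact: m2.
- by move=> x _; rewrite mule_ge0// lee_fin sqr_ge0.
- exact: m2.
apply: ge0_le_integral => //.
- by move=> x _; rewrite lee_fin sqr_ge0.
- by apply: cmeas_sqr; exact: cmeasD.
- by apply: emeasurable_funD; exact: m2.
- by move=> x _; rewrite -!EFinM -EFinD lee_fin sqr_normcD_le.
Qed.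

Lemma sqnormD_lt f g (e : R) : cmeas f -> cmeas g ->
  (sqnorm f < (e / 4)%:E)%E -> (sqnorm g < (e / 4)%:E)%E ->
  (sqnorm (fun x => (f x + g x)%R) < e%:E)%E.
Proof.
move=> mf mg fe ge; rewrite (le_lt_trans (sqnormD mf mg))//.
rewrite [ltRHS](_ : _ = 2%:E * (e / 4)%:E + 2%:E * (e / 4)%:E)%E.
  by rewrite lteD// lte_pmul2l.
by rewrite -!EFinM -EFinD; congr EFin; lra.
Qed.

Lemma sqnormM_le f g (M : R) : cmeas f -> cmeas g ->
  (forall x, D x -> Normc.normc (f x) <= M) ->
  (sqnorm (fun x => (f x * g x)%R) <= (M ^+ 2)%:E * sqnorm g)%E.
Proof.
move=> mf mg fM; rewrite /sqnorm -ge0_integralZl_EFin ?sqr_ge0//; last 2 first.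
- by move=> x _; rewrite lee_fin sqr_ge0.
- exact: cmeas_sqr.
apply: ge0_le_integral => //.
- by move=> x _; rewrite lee_fin sqr_ge0.
- by apply: cmeas_sqr; exact: cmeasM.
- by apply: measurable_funeM; exact: cmeas_sqr.
- move=> x Dx; rewrite -EFinM lee_fin Normc.normcM exprMn ler_wpM2r ?sqr_ge0//.
  by rewrite ler_pXn2r ?nnegrE ?normc_ge0 ?(le_trans (normc_ge0 _) (fM _ Dx))// fM.
Qed.

(** The [+ 1] keeps the denominator positive when M = 0. *)
Lemma sqnormM_lt f g (M e : R) : 0 < e -> cmeas f -> cmeas g ->
  (forall x, D x -> Normc.normc (f x) <= M) ->
  (sqnorm g < (e / (M ^+ 2 + 1))%:E)%E ->
  (sqnorm (fun x => (f x * g x)%R) < e%:E)%E.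
Proof.
move=> e0 mf mg fM ge; rewrite (le_lt_trans (sqnormM_le mf mg fM))//.
have M1 : 0 < M ^+ 2 + 1 by rewrite ltr_wpDl ?sqr_ge0.
apply: (@le_lt_trans _ _ ((M ^+ 2)%:E * (e / (M ^+ 2 + 1))%:E)%E).
  by rewrite lee_wpmul2l ?lee_fin ?sqr_ge0// ltW.
rewrite -EFinM lte_fin mulrCA gtr_pMr// ltr_pdivrMr// mul1r ltrDl//.
Qed.

Lemma sqnorm_dct (u : nat -> T -> R[i]) (G : T -> R) (e : R) : 0 < e ->
  (forall k, cmeas (u k)) -> mu.-integrable D (EFin \o G) ->
  (forall k x, D x -> Normc.normc (u k x) ^+ 2 <= G x) ->
  (forall x, D x -> (fun k => Normc.normc (u k x)) @ \oo --> (0 : R)) ->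
  exists k, (sqnorm (u k) < e%:E)%E.
Proof.
move=> e0 mu_ iG uG u0.
have ae1 : {ae mu, forall x, D x ->
    (fun k => (Normc.normc (u k x) ^+ 2)%:E) @ \oo --> (0 : \bar R)%E}.
  apply: aeW => x Dx; apply/fine_cvgP; split; first exact: nearW.
  by rewrite /= -(mulr0 (0 : R)); apply: cvgM; exact: u0.
have ae2 : {ae mu, forall x, forall k, D x ->
    (`|(Normc.normc (u k x) ^+ 2)%:E| <= (EFin \o G) x)%E}.
  by apply: aeW => x k Dx; rewrite gee0_abs ?lee_fin ?sqr_ge0//= uG.
have [_ _] := dominated_convergence mD (fun k => cmeas_sqr (mu_ k))
  (measurable_cst (0 : \bar R)%E) ae1 iG ae2.
rewrite integral0 => cv.
have /cv [k _ /(_ k (leqnn _))] : nbhs (0%E : \bar R) [set y | (y < e%:E)%E].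
  by apply: open_nbhs_nbhs; split; [exact: open_ereal_lt_ereal|rewrite /= lte_fin].
by exists k.
Qed.

End L2_closure.

(** * Closure of a space of bounded functions in L^2 *)

Section density.
Context d (T : measurableType d) (R : realType).
Variables (mu : {measure set T -> \bar R}) (D : set T).
Hypotheses (mD : measurable D) (fD : (mu D < +oo)%E).
Implicit Types f g : T -> R[i].

Record subspace (E : set (T -> R[i])) : Prop := {
  subspace_bmfun : forall f, E f -> bmfun f;
  subspaceD : forall f g, E f -> E g -> E (fun x => f x + g x);
  subspaceZ : forall c f, E f -> E (fun x => c * f x) }.

Variable E : set (T -> R[i]).
Hypothesis subE : subspace E.

Definition dense_at f : Prop := cmeas D f /\
  forall e : R, 0 < e ->
    exists2 g, E g & (sqnorm mu D (fun x => (f x - g x)%R) < e%:E)%E.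

Let cmeasE g : E g -> cmeas D g.
Proof. by move=> /(subspace_bmfun subE)/bmfun_cmeas. Qed.

Lemma dense_at_mem f : E f -> dense_at f.
Proof.
move=> Ef; split; first exact: cmeasE.
move=> e e0; exists f => //; rewrite (@eq_sqnorm _ _ _ mu D _ (fun=> 0)).
  rewrite /sqnorm; under eq_integral do rewrite normc_real normr0 expr0n.
  by rewrite integral0 lte_fin.
by move=> x _; rewrite subrr.
Qed.

Lemma eq_dense_at f g : (forall x, D x -> f x = g x) -> dense_at f -> dense_at g.
Proof.
move=> fg [[f1 f2] fE]; split.
  split; [move: f1|move: f2]; apply: eq_measurable_fun => x /set_mem Dx;
    by rewrite fg.
move=> e /fE [h Eh fh]; exists h => //.
by rewrite -(@eq_sqnorm _ _ _ mu D (fun x => f x - h x))// => x Dx; rewrite fg.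
Qed.

Lemma dense_atD f g : dense_at f -> dense_at g -> dense_at (fun x => f x + g x).
Proof.
move=> [mf fE] [mg gE]; split; first exact: cmeasD.
move=> e e0; have e4 : 0 < e / 4 by rewrite divr_gt0.
have [f' Ef' ff'] := fE _ e4; have [g' Eg' gg'] := gE _ e4.
exists (fun x => f' x + g' x); first exact: subspaceD.
rewrite (@eq_sqnorm _ _ _ mu D _ (fun x => (f x - f' x) + (g x - g' x))).
  by apply: sqnormD_lt => //; apply: cmeasB => //; exact: cmeasE.
by move=> x _; rewrite opprD addrACA.
Qed.

Lemma dense_atZ c f : dense_at f -> dense_at (fun x => c * f x).
Proof.
move=> [mf fE]; split; first by apply: cmeasM => //; exact: cmeas_cst.
move=> e e0; have c1 : 0 < Normc.normc c ^+ 2 + 1 by rewrite ltr_wpDl ?sqr_ge0.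
have [f' Ef' ff'] := fE _ (divr_gt0 e0 c1).
exists (fun x => c * f' x); first exact: subspaceZ.
rewrite (@eq_sqnorm _ _ _ mu D _ (fun x => c * (f x - f' x))).
  apply: (@sqnormM_lt _ _ _ _ _ mD _ _ (Normc.normc c)) => //.
  by apply: cmeasB => //; exact: cmeasE.
by move=> x _; rewrite mulrBr.
Qed.

Lemma dense_at0 : E !=set0 -> dense_at (fun=> 0).
Proof.
move=> [f Ef]; apply: (@eq_dense_at (fun x => 0 * f x)).
  by move=> x _; rewrite mul0r.
exact/dense_atZ/dense_at_mem.
Qed.

Lemma dense_at_sum (I : Type) (r : seq I) (P : pred I) (F : I -> T -> R[i]) :
  E !=set0 -> (forall i, P i -> dense_at (F i)) ->
  dense_at (fun x => \sum_(i <- r | P i) F i x).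
Proof.
move=> E0 dF; elim: r => [|i r ih].
  apply: eq_dense_at (dense_at0 E0) => x _; by rewrite big_nil.
have [Pi|Pi] := boolP (P i).
  apply: eq_dense_at (dense_atD (dF _ Pi) ih) => x _; by rewrite big_cons Pi.
by apply: eq_dense_at ih => x _; rewrite big_cons (negbTE Pi).
Qed.

Lemma dense_at_closed f :
  cmeas D f ->
  (forall e : R, 0 < e ->
    exists2 g, dense_at g & (sqnorm mu D (fun x => (f x - g x)%R) < e%:E)%E) ->
  dense_at f.
Proof.
move=> mf H; split=> // e e0; have e4 : 0 < e / 4 by rewrite divr_gt0.
have [g [mg gE] fg] := H _ e4; have [h Eh gh] := gE _ e4.
exists h => //.
rewrite (@eq_sqnorm _ _ _ mu D _ (fun x => (f x - g x) + (g x - h x))).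
  apply: sqnormD_lt => //; [exact: cmeasB|].
  by apply: cmeasB => //; exact: cmeasE.
by move=> x _; rewrite addrA subrK.
Qed.

Lemma dense_at_dct f (u : nat -> T -> R[i]) (G : T -> R) :
  cmeas D f -> (forall k, dense_at (u k)) -> mu.-integrable D (EFin \o G) ->
  (forall k x, D x -> Normc.normc (f x - u k x) ^+ 2 <= G x) ->
  (forall x, D x -> (fun k => Normc.normc (f x - u k x)) @ \oo --> (0 : R)) ->
  dense_at f.
Proof.
move=> mf du iG uG uf; apply: dense_at_closed => // e e0.
have [|k fk] := sqnorm_dct mD e0 _ iG uG uf.
  by move=> k; apply: cmeasB => //; have [] := du k.
by exists (u k).
Qed.

Lemma dense_at_bounded_lim f (u : nat -> T -> R[i]) (M : R) :
  cmeas D f -> (forall k, dense_at (u k)) ->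
  (forall x, D x -> Normc.normc (f x) <= M) ->
  (forall k x, D x -> Normc.normc (u k x) <= M) ->
  (forall x, D x -> (fun k => Normc.normc (f x - u k x)) @ \oo --> (0 : R)) ->
  dense_at f.
Proof.
move=> mf du fM uM; apply: (dense_at_dct (G := fun=> (2 * M) ^+ 2)) => //.
  by apply: (@bounded_integrable _ _ _ _ _ _ `|(2 * M) ^+ 2|).
move=> k x Dx; have M0 := le_trans (normc_ge0 _) (fM _ Dx).
rewrite ler_pXn2r ?nnegrE ?normc_ge0 ?mulr_ge0//.
rewrite (le_trans (le_normcD _ _))// normcN.
by have := lerD (fM _ Dx) (uM k _ Dx); rewrite mulr_natl mulr2n.
Qed.

(** Simple functions are combinations of indicators; nonnegative f follow by dominated convergence
    with dominating function f^2, real f through positive and negative parts, complex f through real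
    and imaginary parts. *)
Lemma dense_in_L2 : E !=set0 ->
  (forall A, measurable A -> dense_at (fun x => (\1_A x)%:C)) ->
  forall f, cmeas D f -> (sqnorm mu D f < +oo)%E -> dense_at f.
Proof.
move=> E0 dind.
have pos (f : T -> R) : measurable_fun D f -> (forall x, D x -> 0 <= f x) ->
    (\int[mu]_(x in D) ((f x) ^+ 2)%:E < +oo)%E -> dense_at (fun x => (f x)%:C).
  move=> mf f0 f2.
  have mEf : measurable_fun D (EFin \o f) by exact/measurable_EFinP.
  have f0' x : D x -> (0 <= (EFin \o f) x)%E by move=> Dx; rewrite lee_fin f0.
  pose g := nnsfun_approx mD mEf.
  have gf k x : D x -> 0 <= g k x <= f x.
    by move=> Dx; rewrite fun_ge0/= -lee_fin /g nnsfun_approxE; exact: le_approx.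
  have gcv x : D x -> (fun k => g k x) @ \oo --> f x.
    move=> Dx; have := @cvg_nnsfun_approx _ _ _ _ mD _ mEf f0' _ Dx.
    by move=> /fine_cvgP[].
  apply: (dense_at_dct (u := fun k x => (g k x)%:C) (G := fun x => f x ^+ 2)).
  - by split => //=; exact: measurable_cst.
  - move=> k; rewrite (_ : (fun x => _) = (fun x => \sum_(y <- finmap.enum_fset (fset_set (range (g k))))
        (y%:C * (\1_(g k @^-1` [set y]) x)%:C))); last first.
      apply/funext => x; rewrite fimfunE fsbig_finite//= rmorph_sum.
      by apply: eq_bigr => y _; rewrite /= rmorphM.
    apply: dense_at_sum => // y _; apply: dense_atZ; apply: dind.
    exact: measurable_sfunP.
  - apply/integrableP; split.
      by apply/measurable_EFinP; exact: measurable_funX.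
    by under eq_integral do rewrite /= ger0_norm ?sqr_ge0//.
  - move=> k x Dx; have /andP[g0 gfx] := gf k x Dx.
    rewrite -real_complexN -real_complexD normc_real ger0_norm ?subr_ge0//.
    by rewrite ler_pXn2r ?nnegrE ?subr_ge0 ?f0// lerBlDr lerDl.
  - move=> x Dx; under eq_fun do rewrite -real_complexN -real_complexD normc_real.
    have : (fun k => `|f x - g k x|) @ \oo --> `|f x - f x|.
      by apply: cvg_norm; apply: cvgB; [exact: cvg_cst|exact: gcv].
    by rewrite subrr normr0.
have sgn (f : T -> R) : measurable_fun D f ->
    (\int[mu]_(x in D) ((f x) ^+ 2)%:E < +oo)%E -> dense_at (fun x => (f x)%:C).
  move=> mf f2.
  have le2 (h : T -> R) : measurable_fun D h -> (forall x, `|h x| <= `|f x|) ->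
      (\int[mu]_(x in D) ((h x) ^+ 2)%:E < +oo)%E.
    move=> mh hf; apply: le_lt_trans f2; apply: ge0_le_integral => //.
    - by move=> x _; rewrite lee_fin sqr_ge0.
    - by apply/measurable_EFinP; exact: measurable_funX.
    - by apply/measurable_EFinP; exact: measurable_funX.
    - by move=> x _; rewrite lee_fin -real_normK ?num_real// -[leRHS]real_normK
        ?num_real// ler_pXn2r ?nnegrE.
  pose fp x := Num.max (f x) 0; pose fn x := Num.max (- f x) 0.
  have mfp : measurable_fun D fp by apply: measurable_maxr => //; exact: measurable_cst.
  have mfn : measurable_fun D fn.
    by apply: measurable_maxr; [exact: measurableT_comp|exact: measurable_cst].
  have dp : dense_at (fun x => (fp x)%:C).
    apply: pos => //; first by move=> x _; rewrite le_max lexx orbT.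
    apply: le2 => // x; rewrite /fp; have [h|] := boolP (0 <= f x); last rewrite -ltNge => h.
      by rewrite max_l.
    by rewrite max_r ?normr0// ltW.
  have dn : dense_at (fun x => (fn x)%:C).
    apply: pos => //; first by move=> x _; rewrite le_max lexx orbT.
    apply: le2 => // x; rewrite /fn; have [h|] := boolP (0 <= f x); last rewrite -ltNge => h.
      by rewrite max_r ?normr0// oppr_le0.
    by rewrite max_l ?normrN// oppr_ge0 ltW.
  apply: eq_dense_at (dense_atD dp (dense_atZ (-1) dn)) => x _.
  rewrite mulNr mul1r -real_complexN -real_complexD; congr (_%:C).
  rewrite /fp /fn; have [h|] := boolP (0 <= f x); last rewrite -ltNge => h.
    by rewrite max_l// max_r ?oppr_le0// subr0.
  by rewrite max_r ?(ltW h)// max_l ?oppr_ge0 ?(ltW h)// sub0r opprK.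
move=> f [f1 f2] ff.
have le2 (h : T -> R) : measurable_fun D h -> (forall x, `|h x| <= Normc.normc (f x)) ->
    (\int[mu]_(x in D) ((h x) ^+ 2)%:E < +oo)%E.
  move=> mh hf; apply: le_lt_trans ff; apply: ge0_le_integral => //.
  - by move=> x _; rewrite lee_fin sqr_ge0.
  - by apply/measurable_EFinP; exact: measurable_funX.
  - exact: cmeas_sqr.
  - by move=> x _; rewrite lee_fin -real_normK ?num_real// ler_pXn2r ?nnegrE ?normc_ge0.
have dr := sgn _ f1 (le2 _ f1 (fun x => normc_Re (f x))).
have di := sgn _ f2 (le2 _ f2 (fun x => normc_Im (f x))).
apply: eq_dense_at (dense_atD dr (dense_atZ (0 +i* 1) di)) => x _.
case: (f x) => a b; apply: complex_eqP; rewrite /=; ring.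
Qed.

End density.

(** * A step function as a limit of polynomials *)

Section smoothstep.
Context {R : realType}.

(* Iterating this polynomial separates t < 1/2 from t > 1/2 without leaving an algebra
   of functions. *)
Definition smoothstep (t : R) : R := 3 * t ^+ 2 - 2 * t ^+ 3.

Lemma smoothstep_bound (k : nat) (t : R) : 0 <= t -> t <= 1 ->
  0 <= iter k smoothstep t <= 1.
Proof.
move=> t0 t1; elim: k => [|k /andP[u0 u1]] /=; first by rewrite t0 t1.
move: (iter k smoothstep t) u0 u1 => u u0 u1; apply/andP; split.
- rewrite [X in 0 <= X](_ : _ = u ^+ 2 * (1 + 2 * (1 - u))); last by rewrite /smoothstep; ring.
  by rewrite mulr_ge0 ?sqr_ge0// addr_ge0// mulr_ge0// subr_ge0.
- rewrite -subr_ge0 [X in 0 <= X](_ : _ = (1 - u) ^+ 2 * (1 + 2 * u)); last first.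
    by rewrite /smoothstep; ring.
  by rewrite mulr_ge0 ?sqr_ge0// addr_ge0// mulr_ge0.
Qed.

Lemma smoothstepC (k : nat) (t : R) :
  iter k smoothstep (1 - t) = 1 - iter k smoothstep t.
Proof. by elim: k => [|k ih]//=; rewrite ih /smoothstep; ring. Qed.

Lemma smoothstep_half (k : nat) : iter k smoothstep (2^-1) = 2^-1 :> R.
Proof. by elim: k => [|k ih]//=; rewrite ih /smoothstep; field. Qed.

(** One step multiplies u by u (3 - 2 u), which is at most r = t (3 - 2 t) < 1 as long as u <= t; so
    the iterates stay below t and decay geometrically. *)
Lemma smoothstep_cvg0 (t : R) : 0 <= t -> t < 2^-1 ->
  (fun k => iter k smoothstep t) @ \oo --> (0 : R).
Proof.
move=> t0 t2; set r := t * (3 - 2 * t).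
have r0 : 0 <= r by rewrite mulr_ge0//; lra.
have r1 : r < 1.
  rewrite -subr_gt0 (_ : 1 - r = (1 - t) * (1 - 2 * t)); last by rewrite /r; ring.
  by apply: mulr_gt0; lra.
have H k : 0 <= iter k smoothstep t /\ iter k smoothstep t <= t /\
    iter k smoothstep t <= r ^+ k.
  elim: k => [|k [u0 [ut ur]]] /=; first by split=> //; split=> //; rewrite expr0; lra.
  move: (iter k smoothstep t) u0 ut ur => u u0 ut ur.
  have E : smoothstep u = u * (u * (3 - 2 * u)) by rewrite /smoothstep; ring.
  have ur' : u * (3 - 2 * u) <= r.
    rewrite -subr_ge0 (_ : _ - _ = (t - u) * (3 - 2 * (t + u))); last first.
      by rewrite /r; ring.
    by apply: mulr_ge0; lra.
  have u3 : 0 <= u * (3 - 2 * u) by apply: mulr_ge0; lra.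
  rewrite E; split; [by apply: mulr_ge0|split].
  - apply: le_trans ut; rewrite -[leRHS]mulr1; apply: ler_wpM2l => //; lra.
  - by rewrite exprSr; apply: ler_pM.
apply: (@squeeze_cvgr _ _ _ _ (fun=> 0) (fun k => r ^+ k)).
- by apply: nearW => k; have [-> [_ ->]] := H k.
- exact: cvg_cst.
- by apply: cvg_expr; rewrite ger0_norm.
Qed.

(** The iterates tend to 0, 1/2 or 1, and 2 u^2 - u sends these limits to 0, 0 and 1. This disposes
    of the fixed point 1/2 and yields the indicator of the strict inequality. *)
Lemma smoothstep_heaviside (t : R) : 0 <= t -> t <= 1 ->
  (fun k => 2 * iter k smoothstep t ^+ 2 - iter k smoothstep t) @ \oo -->
  ((if 2^-1 < t then 1 else 0) : R).
Proof.
move=> t0 t1.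
have F (u : nat -> R) (l : R) : u @ \oo --> l ->
    (fun k => 2 * u k ^+ 2 - u k) @ \oo --> 2 * l ^+ 2 - l.
  move=> ul; apply: cvgB => //; apply: cvgMr.
  by under eq_fun do rewrite expr2; rewrite expr2; apply: cvgM.
have [th|] := ltP (2^-1) t; last rewrite le_eqVlt => /predU1P[->|th].
- have c0 : (fun k => iter k smoothstep (1 - t)) @ \oo --> (0 : R).
    by apply: smoothstep_cvg0; lra.
  have c1 : (fun k => iter k smoothstep t) @ \oo --> (1 : R).
    have -> : (fun k => iter k smoothstep t) =
        (fun k => 1 - iter k smoothstep (1 - t)).
      by apply/funext => k; rewrite smoothstepC opprB addrC subrK.
    by rewrite -[X in _ --> X]subr0; apply: cvgB => //; exact: cvg_cst.
  have := F _ _ c1; rewrite expr1n mulr1.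
  by rewrite (_ : 2 - 1 = 1 :> R)//; lra.
- under eq_fun do rewrite smoothstep_half.
  have -> : 2 * 2^-1 ^+ 2 - 2^-1 = 0 :> R by field.
  exact: cvg_cst.
- have := F _ _ (smoothstep_cvg0 t0 th).
  by rewrite expr0n mulr0 subr0.
Qed.

End smoothstep.

(** * Sets whose indicator lies in the closure of an algebra *)

Section closure_algebra.
Context d (T : measurableType d) (R : realType).
Variables (mu : {measure set T -> \bar R}) (D : set T).
Hypotheses (mD : measurable D) (fD : (mu D < +oo)%E).
Variable E : set (T -> R[i]).
Hypothesis subE : subspace E.
Hypothesis E1 : E (fun=> 1).
Hypothesis EM : forall f g, E f -> E g -> E (fun x => f x * g x).
Implicit Types (f g : T -> R[i]) (A : set T).

(** Multiplication by a bounded function is continuous for the L^2 norm. Keeping boundedness along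
    with approximability is what makes the closure an algebra. *)
Definition bclosure f : Prop := bmfun f /\ dense_at mu D E f.

Lemma bclosure_mem f : E f -> bclosure f.
Proof. by move=> Ef; split; [exact: subspace_bmfun Ef|exact: dense_at_mem]. Qed.

Lemma eq_bclosure f g : (forall x, f x = g x) -> bclosure f -> bclosure g.
Proof. by move=> /funext ->. Qed.

Lemma bclosure_cst c : bclosure (fun=> c).
Proof.
apply: (@eq_bclosure (fun x => c * 1)) => [x|]; first by rewrite mulr1.
by apply: bclosure_mem; exact: subspaceZ.
Qed.

Lemma bclosureD f g : bclosure f -> bclosure g -> bclosure (fun x => f x + g x).
Proof.
by move=> [bf df] [bg dg]; split; [exact: bmfunD|exact: dense_atD].
Qed.

Lemma bclosureM f g : bclosure f -> bclosure g -> bclosure (fun x => f x * g x).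
Proof.
move=> [bf [mf fE]] [bg [mg gE]]; split; first exact: bmfunM.
split; first exact: cmeasM.
move=> e e0; have e4 : 0 < e / 4 by rewrite divr_gt0.
have [_ _ [M fM]] := bf.
have M1 : 0 < M ^+ 2 + 1 by rewrite ltr_wpDl ?sqr_ge0.
(* In f g - p q = f (g - q) + q (f - p), q is chosen before p: the precision required of p depends
   on the bound N of q, which the bound of g does not control. *)
have [q Eq gq] := gE _ (divr_gt0 e4 M1).
have bq := subspace_bmfun subE Eq; have [_ _ [N qN]] := bq.
have N1 : 0 < N ^+ 2 + 1 by rewrite ltr_wpDl ?sqr_ge0.
have [p Ep fp] := fE _ (divr_gt0 e4 N1).
have mq : cmeas D q by exact: bmfun_cmeas.
have mp : cmeas D p by apply: bmfun_cmeas; exact: (subspace_bmfun subE Ep).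
exists (fun x => p x * q x); first exact: EM.
rewrite (@eq_sqnorm _ _ _ mu D _ (fun x => f x * (g x - q x) + q x * (f x - p x))).
  apply: sqnormD_lt => //.
  - by apply: cmeasM => //; exact: cmeasB.
  - by apply: cmeasM => //; exact: cmeasB.
  - by apply: (@sqnormM_lt _ _ _ _ _ mD _ _ M) => //; exact: cmeasB.
  - by apply: (@sqnormM_lt _ _ _ _ _ mD _ _ N) => //; exact: cmeasB.
by move=> x _; ring.
Qed.

Lemma bclosureZ c f : bclosure f -> bclosure (fun x => c * f x).
Proof. by apply: bclosureM; exact: bclosure_cst. Qed.

Lemma bclosureB f g : bclosure f -> bclosure g -> bclosure (fun x => f x - g x).
Proof.
move=> bf bg; apply: (@eq_bclosure (fun x => f x + -1 * g x)) => [x|].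
  by rewrite mulNr mul1r.
by apply: bclosureD => //; exact: bclosureZ.
Qed.

Lemma bclosure_prod (I : Type) (r : seq I) (P : pred I) (F : I -> T -> R[i]) :
  (forall i, P i -> bclosure (F i)) -> bclosure (fun x => \prod_(i <- r | P i) F i x).
Proof.
move=> dF; elim: r => [|i r ih].
  by apply: eq_bclosure (bclosure_cst 1) => x; rewrite big_nil.
have [Pi|Pi] := boolP (P i).
  by apply: eq_bclosure (bclosureM (dF _ Pi) ih) => x; rewrite big_cons Pi.
by apply: eq_bclosure ih => x; rewrite big_cons (negbTE Pi).
Qed.

Lemma bclosure_sum (I : Type) (r : seq I) (P : pred I) (F : I -> T -> R[i]) :
  (forall i, P i -> bclosure (F i)) -> bclosure (fun x => \sum_(i <- r | P i) F i x).
Proof.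
move=> dF; elim: r => [|i r ih].
  by apply: eq_bclosure (bclosure_cst 0) => x; rewrite big_nil.
have [Pi|Pi] := boolP (P i).
  by apply: eq_bclosure (bclosureD (dF _ Pi) ih) => x; rewrite big_cons Pi.
by apply: eq_bclosure ih => x; rewrite big_cons (negbTE Pi).
Qed.

Lemma bclosure_lim f (u : nat -> T -> R[i]) (M : R) :
  bmfun f -> (forall k, bclosure (u k)) ->
  (forall k x, Normc.normc (u k x) <= M) ->
  (forall x, (fun k => Normc.normc (f x - u k x)) @ \oo --> (0 : R)) ->
  bclosure f.
Proof.
move=> bf bu uM uf; split => //; have [_ _ [N fN]] := bf.
apply: (@dense_at_bounded_lim _ _ _ _ _ mD fD _ subE _ u (Num.max M N)) => //.
- exact: bmfun_cmeas.
- by move=> k; have [] := bu k.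
- by move=> x _; rewrite le_max fN orbT.
- by move=> k x _; rewrite le_max uM.
Qed.

Definition closure_sets A : Prop := measurable A /\ bclosure (fun x => (\1_A x)%:C).

Lemma bmfun_indic A : measurable A -> bmfun (fun x => (\1_A x)%:C : R[i]).
Proof.
move=> mA; split; [exact: measurable_indic|exact: measurable_cst|].
by exists 1 => x; rewrite normc_real indicE normr_nat lern1 leq_b1.
Qed.

(** An algebra is stable under polynomials, so it contains 2 u^2 - u for every iterate u of
    [smoothstep] at t; these converge boundedly to the indicator. The constant 3 below is a crude
    bound of |2 u^2 - u| on [0, 1]. *)
Lemma bclosure_heaviside (t : T -> R) : (forall x, 0 <= t x <= 1) ->
  bclosure (fun x => (t x)%:C) -> closure_sets [set x | 2^-1 < t x].
Proof.
move=> t01 bt; have [[mt _ _] _] := bt; rewrite /= in mt.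
have mA : measurable [set x | 2^-1 < t x].
  rewrite (_ : [set _ | _] = t @^-1` `]2^-1, +oo[%classic).
    by rewrite -[X in measurable X]setTI; apply: mt.
  by apply/seteqP; split=> x /=; rewrite in_itv/= andbT.
split => //.
have bk k : bclosure (fun x => (iter k smoothstep (t x))%:C).
  elim: k => [//|k ih].
  apply: (@eq_bclosure (fun x => 3 * ((iter k smoothstep (t x))%:C * (iter k smoothstep (t x))%:C)
      - 2 * ((iter k smoothstep (t x))%:C * ((iter k smoothstep (t x))%:C * (iter k smoothstep (t x))%:C)))).
    move=> x; rewrite iterS /smoothstep real_complexD real_complexN !real_complexM.
    by rewrite !real_complex_nat.
  by apply: bclosureB; apply: bclosureZ; repeat apply: bclosureM.
apply: (@bclosure_lim _ (fun k x =>
    (2 * iter k smoothstep (t x) ^+ 2 - iter k smoothstep (t x))%:C) 3).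
- exact: bmfun_indic.
- move=> k; apply: (@eq_bclosure (fun x => 2 * ((iter k smoothstep (t x))%:C * (iter k smoothstep (t x))%:C)
      - (iter k smoothstep (t x))%:C)).
    by move=> x; rewrite expr2 real_complexD real_complexN !real_complexM !real_complex_nat.
  by apply: bclosureB => //; apply: bclosureZ; apply: bclosureM.
- move=> k x; rewrite normc_real; have /andP[t0 t1] := t01 x.
  have /andP[u0 u1] := smoothstep_bound k t0 t1.
  move: (iter _ _ _) u0 u1 => u u0 u1; have : u ^+ 2 <= 1 by rewrite expr_le1.
  by have := sqr_ge0 u; rewrite ler_norml => h1 h2; apply/andP; split; lra.
- move=> x; have /andP[t0 t1] := t01 x.
  under eq_fun do rewrite -real_complexN -real_complexD normc_real.
  set l : R := \1__ x.
  have -> : l = if 2^-1 < t x then 1 else 0.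
    by rewrite /l indicE; case: ifPn => h; [rewrite mem_set|rewrite memNset//; exact/negP].
  have : (fun k => `|(if 2^-1 < t x then 1 else 0) - (2 * iter k smoothstep (t x) ^+ 2 - iter k smoothstep (t x))|) @ \oo -->
     `|(if 2^-1 < t x then 1 else 0 : R) - (if 2^-1 < t x then 1 else 0 : R)|.
    by apply: cvg_norm; apply: cvgB; [exact: cvg_cst|exact: smoothstep_heaviside].
  by rewrite subrr normr0.
Qed.

Lemma closure_setsC A : closure_sets A -> closure_sets (~` A).
Proof.
move=> [mA bA]; split; first exact: measurableC.
apply: (@eq_bclosure (fun x => 1 - (\1_A x)%:C)).
  move=> x; rewrite indicC indicE -real_complexN -(real_complexD 1).
  by congr (_%:C); case: (x \in A); rewrite ?subrr ?subr0.
by apply: bclosureB => //; exact: bclosure_cst.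
Qed.

Lemma closure_setsI A B : closure_sets A -> closure_sets B -> closure_sets (A `&` B).
Proof.
move=> [mA bA] [mB bB]; split; first exact: measurableI.
apply: (@eq_bclosure (fun x => (\1_A x)%:C * (\1_B x)%:C)).
  by move=> x; rewrite indicI /= rmorphM.
exact: bclosureM.
Qed.

Lemma closure_sets0 : closure_sets set0.
Proof.
split => //; apply: eq_bclosure (bclosure_cst 0) => x.
by rewrite indic0.
Qed.

Lemma closure_setsU A B : closure_sets A -> closure_sets B -> closure_sets (A `|` B).
Proof.
move=> cA cB; rewrite -[X in closure_sets X]setCK setCU.
by apply: closure_setsC; apply: closure_setsI; exact: closure_setsC.
Qed.

(** At each point the indicators of the finite unions are eventually constant, and they are bounded
    by 1. *)
Lemma closure_sets_bigcup (F : nat -> set T) : (forall k, closure_sets (F k)) ->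
  closure_sets (\bigcup_k F k).
Proof.
move=> cF; have cU k : closure_sets (\big[setU/set0]_(i < k) F i).
  elim: k => [|k ih]; first by rewrite big_ord0; exact: closure_sets0.
  by rewrite big_ord_recr /=; exact: closure_setsU.
have mU : measurable (\bigcup_k F k).
  by apply: bigcup_measurable => k _; have [] := cF k.
split => //.
apply: (@bclosure_lim _ (fun k x => (\1_(\big[setU/set0]_(i < k) F i) x)%:C) 1).
- exact: bmfun_indic.
- by move=> k; have [] := cU k.
- by move=> k x; rewrite normc_real indicE normr_nat lern1 leq_b1.
- move=> x; have [[k _ Fkx]|nF] := pselect ((\bigcup_k F k) x).
  + apply: cvg_near_cst; exists k.+1 => // m /= km.
    rewrite !indicE !mem_set ?subrr.
    * by rewrite /= expr0n /= addr0 sqrtr0.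
    * by rewrite -bigcup_mkord; exists k.
    * by exists k.
  + apply: cvg_near_cst; apply: nearW => m.
    rewrite !indicE !memNset//.
      by rewrite subrr /= expr0n /= addr0 sqrtr0.
    by rewrite -bigcup_mkord => -[k _ Fk]; apply: nF; exists k.
Qed.

(** This reduces the approximation of measurable sets to that of generators. The map g lets it serve
    both for a single coordinate of [tfrac] and for [tfrac] itself. *)
Lemma sigma_algebra_closure_sets (T' : Type) (g : T -> T') :
  sigma_algebra setT [set B : set T' | closure_sets (g @^-1` B)].
Proof.
split => /=.
- by rewrite preimage_set0; exact: closure_sets0.
- by move=> A cA; rewrite setTD preimage_setC; exact: closure_setsC.
- by move=> F cF; rewrite preimage_bigcup; exact: closure_sets_bigcup.
Qed.

End closure_algebra.

(** * Trigonometric polynomials and functions of the fractional part *)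

Section trigonometric_span.
Context {R : realType} (n : nat).
Notation Rn := (n.-tuple R).
Notation mu := (lebesgue_Rn R n).
Implicit Types (L : set Rn) (f g : Rn -> R[i]).

(** The inductive form gives stability under sums and products by induction on the terms;
    [cspan_ordP] goes back to the indexed sums in the definition of a basis. *)
Inductive cspan L : set (Rn -> R[i]) :=
| cspan0 : cspan L (fun=> 0)
| cspan_cons c l g : L l -> cspan L g -> cspan L (fun x => c * character l x + g x).

Lemma eq_cspan L f g : (forall x, f x = g x) -> cspan L f -> cspan L g.
Proof. by move=> /funext ->. Qed.

Lemma cspan1 L l c : L l -> cspan L (fun x => c * character l x).
Proof.
move=> Ll; apply: eq_cspan (cspan_cons c Ll (cspan0 L)) => x; exact: addr0.
Qed.

Lemma cspanD L f g : cspan L f -> cspan L g -> cspan L (fun x => f x + g x).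
Proof.
move=> cf cg; elim: cf => [|c l h Ll _ ih].
  by apply: eq_cspan cg => x; rewrite add0r.
by apply: eq_cspan (cspan_cons c Ll ih) => x; rewrite addrA.
Qed.

Lemma cspanZ L c f : cspan L f -> cspan L (fun x => c * f x).
Proof.
elim=> [|c' l h Ll _ ih].
  by apply: eq_cspan (cspan0 L) => x; rewrite mulr0.
by apply: eq_cspan (cspan_cons (c * c') Ll ih) => x; rewrite mulrDr mulrA.
Qed.

Lemma cspan_bmfun L f : cspan L f -> bmfun f.
Proof.
elim=> [|c l h Ll _ ih]; first exact: bmfun_cst.
by apply: bmfunD => //; apply: bmfunZ; exact: bmfun_character.
Qed.

Lemma subspace_cspan L : subspace (cspan L).
Proof.
by split; [exact: cspan_bmfun|exact: cspanD|exact: cspanZ].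
Qed.

Lemma cspanM L1 L2 L3 f g : (forall l m, L1 l -> L2 m -> L3 (tadd l m)) ->
  cspan L1 f -> cspan L2 g -> cspan L3 (fun x => f x * g x).
Proof.
move=> L123 cf cg; elim: cf => [|c l h Ll _ ih].
  by apply: eq_cspan (cspan0 L3) => x; rewrite mul0r.
have : cspan L3 (fun x => c * character l x * g x).
  elim: cg => [|c' m k Lm _ ih'].
    by apply: eq_cspan (cspan0 L3) => x; rewrite mulr0.
  apply: eq_cspan (cspan_cons (c * c') (L123 _ _ Ll Lm) ih') => x.
  by rewrite characterD mulrDr mulrACA.
by move=> /cspanD/(_ ih); apply: eq_cspan => x; rewrite mulrDl.
Qed.

Lemma cspan_ordP L f : cspan L f ->
  exists (m : nat) (k : 'I_m -> Rn) (c : 'I_m -> R[i]),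
    (forall t, L (k t)) /\ forall x, f x = \sum_(t < m) c t * character (k t) x.
Proof.
elim=> [|c l g Ll _ [m [k [c' [Lk gE]]]]].
  exists 0, (fun t : 'I_0 => nseq_tuple n 0), (fun=> 0); split=> [[]//|x].
  by rewrite big_ord0.
exists m.+1, (fun t => if unlift ord0 t is Some t' then k t' else l),
  (fun t => if unlift ord0 t is Some t' then c' t' else c); split=> [t|x].
  by case: (unlift ord0 t).
rewrite big_ord_recl unlift_none gE; congr (_ + _).
by apply: eq_bigr => t _; rewrite liftK.
Qed.

Definition Zn : set Rn := [set l | forall i, exists z : int, tnth l i = z%:~R].

Lemma Zn_add l m : Zn l -> Zn m -> Zn (tadd l m).
Proof.
move=> Zl Zm i; have [y ly] := Zl i; have [z mz] := Zm i.
by exists (y + z); rewrite tnth_tadd ly mz intrD.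
Qed.

Lemma Zn_opp l : Zn l -> Zn (topp l).
Proof. by move=> Zl i; have [z lz] := Zl i; exists (- z); rewrite tnth_topp lz mulrNz. Qed.

Lemma cspan_Zn_mul f g : cspan Zn f -> cspan Zn g -> cspan Zn (fun x => f x * g x).
Proof. by apply: cspanM; exact: Zn_add. Qed.

(** Characters with integer frequencies see only fractional parts, so on a union of several cells
    they can approximate only functions of [tfrac]. Telling the cells apart is left to other
    frequencies. *)
Definition tfrac (x : Rn) : Rn := [tuple tnth x i - (Num.floor (tnth x i))%:~R | i < n].

Lemma tnth_tfrac x i : tnth (tfrac x) i = tnth x i - (Num.floor (tnth x i))%:~R.
Proof. by rewrite tnth_mktuple. Qed.

Lemma tfrac_bound x i : 0 <= tnth (tfrac x) i < 1.
Proof.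
rewrite tnth_tfrac; have /andP[h1] := floor_itv (tnth x i).
by rewrite intrD => h2; rewrite subr_ge0 h1 ltrBlDr addrC.
Qed.

Definition unit_vec (i : 'I_n) : Rn := [tuple (j == i)%:R | j < n].

Lemma dot_unit_vec i x : dot (unit_vec i) x = tnth x i.
Proof.
rewrite /dot (bigD1 i)//= tnth_mktuple eqxx mul1r big1 ?addr0// => j ji.
by rewrite tnth_mktuple (negbTE ji) mul0r.
Qed.

Lemma Zn_unit_vec i : Zn (unit_vec i).
Proof. by move=> j; exists (j == i : nat)%:Z; rewrite tnth_mktuple. Qed.

Section closure.
Variable D : set Rn.
Hypotheses (mD : measurable D) (fD : (mu D < +oo)%E).
Let closed A := closure_sets mu D (cspan Zn) A.

Let cst1 : cspan Zn (fun=> 1).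
Proof.
have Z0 : Zn (nseq_tuple n 0) by move=> i; exists 0; rewrite tnth_nseq.
apply: eq_cspan (cspan1 1 Z0) => x.
rewrite mul1r characterE /dot big1 ?ee0// => i _.
by rewrite tnth_nseq mul0r.
Qed.

Let mulZ := cspan_Zn_mul.

Let sub := subspace_cspan Zn.

(* For fractional part f of x_i, the trigonometric polynomial below exceeds 1/2
   iff sin(pi f) sin(pi (c - f)) > 0. *)
Let frac_arc i (c : R) : 0 < c -> c <= 1 ->
  closed [set x | 0 < tnth (tfrac x) i < c].
Proof.
move=> c0 c1.
pose t (x : Rn) := 2^-1 + (cos (2 * pi * tnth x i - pi * c) - cos (pi * c)) / 4.
rewrite (_ : [set _ | _] = [set x | 2^-1 < t x]).
  apply: bclosure_heaviside => //.
    move=> x; have := cos_le1 (2 * pi * tnth x i - pi * c).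
    have := cos_geN1 (2 * pi * tnth x i - pi * c).
    have := cos_le1 (pi * c); have := cos_geN1 (pi * c) => h1 h2 h3 h4.
    by apply/andP; split; rewrite /t; lra.
  apply: (@eq_bclosure _ _ _ _ _ _ (fun x => (2^-1 - cos (pi * c) / 4)%:C +
    ((8^-1)%:C * ee (- (c / 2)) * character (unit_vec i) x +
     (8^-1)%:C * ee (c / 2) * character (topp (unit_vec i)) x))).
    move=> x; rewrite characterN characterE dot_unit_vec eeN.
    have -> : ee (c / 2) = cos (pi * c) +i* sin (pi * c).
      by rewrite /ee (_ : 2 * pi * (c / 2) = pi * c)//; field.
    rewrite /t cosB.
    by apply: complex_eqP; rewrite ?(cReD, cImD, cReM, cImM, cReJ, cImJ) /=; field.
  apply: bclosureD => //; first exact: bclosure_cst.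
  by apply: bclosure_mem => //; apply: cspanD; apply: cspan1;
    [|apply: Zn_opp]; exact: Zn_unit_vec.
have tE x : t x = 2^-1 +
    (sin (pi * tnth (tfrac x) i) * sin (pi * (c - tnth (tfrac x) i))) / 2.
  set f := tnth (tfrac x) i; pose z := Num.floor (tnth x i).
  rewrite /t (_ : 2 * pi * tnth x i - pi * c =
    2 * pi * z%:~R + (pi * f - pi * (c - f))); last first.
    by rewrite /f tnth_tfrac -/z; ring.
  have [cz sz] := ee_int (R := R) z; rewrite cosD cz sz mul1r mul0r subr0.
  rewrite [in X in _ - X](_ : pi * c = pi * f + pi * (c - f)); last by ring.
  by rewrite cosB cosD; field.
apply/seteqP; split=> x /=; rewrite tE ltrDl pmulr_lgt0//.
all: have := tfrac_bound x i; move: (tnth (tfrac x) i) => f /andP[f0 f1].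
- move=> /andP[f0' fc]; apply: mulr_gt0; apply: sin_gt0_pi.
    by rewrite mulr_gt0 ?pi_gt0//= gtr_pMr ?pi_gt0.
  by rewrite mulr_gt0 ?subr_gt0 ?pi_gt0//= gtr_pMr ?pi_gt0//; lra.
- move: f0; rewrite le_eqVlt => /predU1P[<-|f0].
    by rewrite mulr0 sin0 mul0r ltxx.
  have s0 : 0 < sin (pi * f).
    by apply: sin_gt0_pi; rewrite mulr_gt0 ?pi_gt0//= gtr_pMr ?pi_gt0.
  rewrite pmulr_rgt0// => s1; rewrite f0/= ltNge; apply/negP => cf.
  have : 0 <= sin (pi * (f - c)).
    move: cf; rewrite le_eqVlt => /predU1P[->|cf]; first by rewrite subrr mulr0 sin0.
    apply/ltW/sin_gt0_pi; rewrite mulr_gt0 ?subr_gt0 ?pi_gt0//= gtr_pMr ?pi_gt0//; lra.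
  by rewrite -opprB mulrN sinN oppr_ge0 leNgt s1.
Qed.

Let frac_lt i (c : R) : closed [set x | tnth (tfrac x) i < c].
Proof.
have [c0|c0] := leP c 0.
  rewrite (_ : [set _ | _] = set0); first exact: closure_sets0.
  apply/seteqP; split=> // x /=; have /andP[f0 _] := tfrac_bound x i.
  by rewrite ltNge (le_trans c0).
have [c1|c1] := leP c 1; last first.
  rewrite (_ : [set _ | _] = ~` set0).
    by apply: closure_setsC => //; exact: closure_sets0.
  rewrite setC0; apply/seteqP; split=> [//|x _].
  have /andP[_ f1] := tfrac_bound x i; exact: lt_trans f1 c1.
(* The arc ]0, c[ lacks the point 0, which is the only fractional part outside ]0, 1[. *)
rewrite (_ : [set _ | _] = [set x | 0 < tnth (tfrac x) i < c] `|`
    ~` [set x | 0 < tnth (tfrac x) i < 1]).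
  apply: closure_setsU => //; first exact: frac_arc.
  by apply: closure_setsC => //; exact: frac_arc.
apply/seteqP; split=> x /=; have /andP[f0 f1] := tfrac_bound x i.
  move=> fc; have [f0'|f0'] := ltP 0 (tnth (tfrac x) i); first by left.
  by right; rewrite andFb.
case=> [/andP[]//|]; rewrite f1 andbT => /negP; rewrite -leNgt => /le_lt_trans; exact.
Qed.

(** Rays generate the Borel sets of R and coordinates generate the product sigma-algebra, so the
    sets of [frac_lt] suffice. *)
Lemma closure_sets_tfrac (B : set Rn) : measurable B -> closed (tfrac @^-1` B).
Proof.
have cB i (U : set R) : measurable U -> closed [set x | U (tnth (tfrac x) i)].
  move=> mU.
  have SA := sigma_algebra_closure_sets mD fD sub cst1 mulZ (fun x => tnth (tfrac x) i).
  move: mU; rewrite [X in X U -> _](RGenInftyO.measurableE R).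
  move=> /(smallest_sub SA); apply.
  by move=> _ [c ->]; rewrite /= set_itvE; exact: frac_lt.
have SA := sigma_algebra_closure_sets mD fD sub cst1 mulZ tfrac.
rewrite /measurable /= /g_sigma_preimage => /(smallest_sub SA); apply.
move=> A; rewrite -bigcup_seq => -[i _ [U mU <-]]; rewrite setTI /=.
exact: cB.
Qed.

Lemma measurable_tfrac : measurable_fun setT tfrac.
Proof.
by move=> _ B mB; rewrite setTI; have [] := closure_sets_tfrac mB.
Qed.

(** For s not an integer this function jumps where x_i is an integer, so it is not a trigonometric
    polynomial. It is the uniform limit of functions constant on k + 1 slices of equal width, and
    the indicators of the slices are already in the closure. *)
Let bclosure_ee_coord (s : R) i :
  bclosure mu D (cspan Zn) (fun x => ee (s * tnth (tfrac x) i)).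
Proof.
have mcoord : measurable_fun setT (fun x => tnth (tfrac x) i).
  exact: (measurableT_comp (measurable_tnth i) measurable_tfrac).
pose B (k : nat) (j : nat) : set Rn := [set y | Num.floor (k.+1%:R * tnth y i) = j].
have mB k j : measurable (B k j).
  rewrite (_ : B k j = (fun y => k.+1%:R * tnth y i) @^-1` floor_fiber j)//.
  rewrite -[X in measurable X]setTI.
  have mf : measurable_fun setT (fun y : Rn => k.+1%:R * tnth y i : R).
    by apply: measurable_funM; [exact: measurable_cst|exact: measurable_tnth].
  by apply: mf => //; exact: measurable_floor_fiber.
pose u (k : nat) (x : Rn) : R[i] := \sum_(j < k.+1)
  ee (s * (j%:R / k.+1%:R)) * (\1_(tfrac @^-1` B k j) x)%:C.
have uE k x : exists2 j : nat, u k x = ee (s * (j%:R / k.+1%:R)) &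
    `|tnth (tfrac x) i - j%:R / k.+1%:R| <= k.+1%:R^-1.
  have /andP[f0 f1] := tfrac_bound x i.
  set f := tnth (tfrac x) i in f0 f1 *; set N : R := k.+1%:R.
  have N0 : 0 < N by rewrite ltr0n.
  have /andP[h1] := floor_itv (N * f); rewrite intrD => h2.
  have z0 : 0 <= Num.floor (N * f) by rewrite floor_ge0 mulr_ge0// ltW.
  have [j zj] : exists j : nat, Num.floor (N * f) = j.
    by exists `|Num.floor (N * f)|%N; rewrite gez0_abs.
  rewrite zj in h1 h2.
  have jk : (j < k.+1)%N.
    rewrite -(ltr_nat R); apply: le_lt_trans h1 _.
    by rewrite gtr_pMr.
  exists j.
    rewrite /u (bigD1 (Ordinal jk))//= big1 ?addr0.
      by rewrite indicE mem_set// mulr1.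
    move=> j' jj'; rewrite indicE memNset ?mulr0// => Bj.
    case/eqP : jj'; apply: val_inj => /=.
    by move: Bj; rewrite /B /= -/f -/N zj => -[].
  rewrite -[f](mulKf (lt0r_neq0 N0)) mulrC -mulrBl normrM (ger0_norm (_ : 0 <= N^-1)).
    rewrite ler_piMl ?invr_ge0 ?(ltW N0)// ger0_norm ?subr_ge0//.
    by rewrite lerBlDl ltW.
  by rewrite invr_ge0 ltW.
apply: (bclosure_lim mD fD sub (u := u) (M := 1)).
- apply: bmfun_ee; apply: measurable_funM => //; exact: measurable_cst.
- move=> k; apply: bclosure_sum => // j _; apply: bclosureZ => //.
  by have [] := closure_sets_tfrac (mB k j).
- by move=> k x; have [j -> _] := uE k x; rewrite normc_ee.
- move=> x; apply: (@squeeze_cvgr _ _ _ _ (fun=> 0)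
    (fun k => 4 * pi * `|s| * k.+1%:R^-1)).
  + apply: nearW => k; rewrite normc_ge0/=; have [j -> fj] := uE k x.
    rewrite (le_trans (ee_lip _ _))// -mulrBr normrM mulrA ler_wpM2l//.
    by rewrite !mulr_ge0 ?pi_ge0.
  + exact: cvg_cst.
  + rewrite -[X in _ --> X](mulr0 (4 * pi * `|s|)); apply: cvgMr.
    exact: cvg_harmonic.
Qed.

Lemma bclosure_ee_tfrac l :
  bclosure mu D (cspan Zn) (fun x => ee (dot l (tfrac x))).
Proof.
apply: (@eq_bclosure _ _ _ _ _ _ (fun x => \prod_i ee (tnth l i * tnth (tfrac x) i))).
  by move=> x; rewrite /dot ee_sum.
by apply: bclosure_prod => // i _; exact: bclosure_ee_coord.
Qed.

(** A character has modulus 1, so multiplying by it preserves squared norms while it translates all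
    frequencies by l. *)
Lemma dense_at_characterM L l f : (forall m, Zn m -> L (tadd l m)) ->
  dense_at mu D (cspan Zn) f ->
  dense_at mu D (cspan L) (fun x => character l x * f x).
Proof.
move=> LZ [mf fZ]; have mc : cmeas D (character l).
  by apply: bmfun_cmeas; exact: bmfun_character.
split; first exact: cmeasM.
move=> e /fZ [g Zg fg]; exists (fun x => 1 * character l x * g x).
  apply: (@cspanM [set l] Zn) => //; first by move=> _ m -> /LZ.
  exact: cspan1.
have mg : cmeas D (fun x => f x - g x).
  by apply: cmeasB => //; apply: bmfun_cmeas; exact: cspan_bmfun Zg.
rewrite (@eq_sqnorm _ _ _ mu D _ (fun x => character l x * (f x - g x))).
  apply: le_lt_trans fg; apply: le_sqnorm => //; first exact: cmeasM.
  by move=> x _; rewrite Normc.normcM normc_character mul1r.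
by move=> x _; rewrite mul1r mulrBr.
Qed.

End closure.
End trigonometric_span.

(** * A tiling yields a spectrum of the product *)

Section root_sums.
Context {R : realType}.

Lemma ee_eq1 (t : R) : ee t = 1 -> exists z : int, t = z%:~R.
Proof.
move=> t1; exists (Num.floor t); apply/eqP; rewrite -subr_eq0; apply/negP => /negP f0.
have /andP[h1] := floor_itv t; rewrite intrD => h2.
set f := t - _ in f0; have f1 : `|f| < 1 by rewrite ger0_norm /f ?subr_ge0// ltrBlDr addrC.
have [c1 s1] : ee f = 1 by rewrite /f eeD t1 eeN ee_int conjc1 mulr1.
(* The closed form of [hh] would vanish at a nonzero f with [ee f = 1], but [hh] has no zero in ]-1,
   1[. *)
by have := hh_neq0 f1; rewrite hhE// c1 s1 subrr !mul0r eqxx.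
Qed.

Variable M : nat.
Hypothesis M0 : (0 < M)%N.

Let MR : (M%:R : R) != 0. Proof. by rewrite pnatr_eq0 -lt0n. Qed.

Lemma ee_modz (z : int) : ee (z%:~R / M%:R : R) = ee ((z %% M)%Z%:~R / M%:R).
Proof.
rewrite {1}(divz_eq z M) intrD intrM mulrDl addrC.
by rewrite -[M%:~R]/(M%:R) mulfK// eeDint.
Qed.

Lemma sum_ee_ord (z : int) :
  \sum_(r < M) ee (z%:~R * r%:R / M%:R : R) = if (M %| z)%Z then M%:R else 0.
Proof.
have E r : ee (z%:~R * r%:R / M%:R : R) = ee (z%:~R / M%:R) ^+ r.
  by rewrite -eeMn -[(_ / _) *+ r]mulr_natr mulrAC.
under eq_bigr do rewrite E.
have wM : ee (z%:~R / M%:R : R) ^+ M = 1.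
  by rewrite -eeMn -[(_ / _) *+ M]mulr_natr divfK// ee_int.
case: ifPn => Mz.
  have -> : ee (z%:~R / M%:R : R) = 1.
    by move/dvdzP : Mz => [q ->]; rewrite intrM -[M%:~R]/(M%:R) mulfK// ee_int.
  by under eq_bigr do rewrite expr1n; rewrite sumr_const card_ord.
have w1 : ee (z%:~R / M%:R : R) - 1 != 0.
  rewrite subr_eq0; apply/eqP => /ee_eq1 [y yE]; move/negP : Mz; apply.
  apply/dvdzP; exists y; apply/eqP; rewrite -(eqr_int R) intrM -yE.
  by rewrite -[M%:~R]/(M%:R) divfK.
by apply: (mulfI w1); rewrite -subrX1 wM subrr mulr0.
Qed.

(** Orthogonality of the characters of (Z/M)^n: the sum over the group is a product of geometric
    sums, one for each coordinate. *)
Lemma sum_ee_ffun n (d : 'I_n -> int) :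
  \sum_(p : {ffun 'I_n -> 'I_M}) ee (\sum_k (d k)%:~R * (p k)%:R / M%:R : R) =
  if [forall k, (M %| d k)%Z] then (M ^ n)%:R else 0.
Proof.
under eq_bigr do rewrite ee_sum.
rewrite -(bigA_distr_bigA (fun k (r : 'I_M) => ee ((d k)%:~R * r%:R / M%:R : R))).
under eq_bigr do rewrite sum_ee_ord.
case: ifPn => [/forallP Md|/forallPn[k Mk]].
  rewrite (eq_bigr (fun=> M%:R)) => [|k _]; last by rewrite Md.
  by rewrite prodr_const card_ord natrX.
by rewrite (bigD1 k)//= (negbTE Mk) mul0r.
Qed.

End root_sums.

(** * Finite Fourier analysis on the tiling of (Z/M)^n *)

Section product_cells.
Context {R : realType} (n M : nat) (I J : finType).
Variables (a : I -> 'I_n -> int) (b : J -> 'I_n -> int).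

Definition cat_cells (c : I * J) (k : 'I_(n + n)) : int :=
  match fintype.split k with inl k' => a c.1 k' | inr k' => b c.2 k' end.

Lemma cat_cells_lshift c k : cat_cells c (lshift n k) = a c.1 k.
Proof. by rewrite /cat_cells (unsplitK (inl k)). Qed.

Lemma cat_cells_rshift c k : cat_cells c (rshift n k) = b c.2 k.
Proof. by rewrite /cat_cells (unsplitK (inr k)). Qed.

Lemma prod_set_cells :
  prod_set (cells a) (cells b) = cells cat_cells :> set ((n + n).-tuple R).
Proof.
apply/seteqP; split=> z.
  move=> [x [i _ xi]] [y [j _ yj]] <-; exists (i, j) => // k.
  have [k' ->|k' ->] := split_ordP k.
    by rewrite tnth_lshift cat_cells_lshift.
  by rewrite tnth_rshift cat_cells_rshift.
move=> [[i j] _ zc]; exists [tuple tnth z (lshift n k) | k < n].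
  by exists i => // k; rewrite tnth_mktuple zc cat_cells_lshift.
exists [tuple tnth z (rshift n k) | k < n].
  by exists j => // k; rewrite tnth_mktuple zc cat_cells_rshift.
apply: eq_from_tnth => k; have [k' ->|k' ->] := split_ordP k.
  by rewrite tnth_lshift tnth_mktuple.
by rewrite tnth_rshift tnth_mktuple.
Qed.

Hypothesis M0 : (0 < M)%N.
Hypothesis tiling_inj : forall c c' : I * J,
  (forall k, (M %| (a c.1 k + b c.2 k) - (a c'.1 k + b c'.2 k))%Z) -> c = c'.
Hypothesis tiling_card : (#|I| * #|J| = M ^ n)%N.

Let MR : (M%:R : R) != 0. Proof. by rewrite pnatr_eq0 -lt0n. Qed.

Let s (c : I * J) k : int := a c.1 k + b c.2 k.

Let modz_lt (z : int) : (`|(z %% M)%Z| < M)%N.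
Proof.
have M0' : (M : int) != 0 by rewrite eqz_nat -lt0n.
by rewrite -ltz_nat gez0_abs ?modz_ge0// ltz_pmod.
Qed.

Let residue (c : I * J) : {ffun 'I_n -> 'I_M} := [ffun k => Ordinal (modz_lt (s c k))].

Let residueE c k : ((residue c k : nat)%:R : R) = ((s c k %% M)%Z)%:~R.
Proof.
have M0' : (M : int) != 0 by rewrite eqz_nat -lt0n.
by rewrite ffunE /= -[in RHS](gez0_abs (modz_ge0 _ M0')).
Qed.

Let residue_bij : bijective residue.
Proof.
apply: inj_card_bij.
  move=> c c' cc; apply: tiling_inj => k.
  rewrite -/(s c k) -/(s c' k) -eqz_mod_dvd; apply/eqP.
  by apply: (@intr_inj R); rewrite -!residueE cc.
by rewrite card_ffun !card_ord card_prod tiling_card.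
Qed.

Lemma inj_cat_cells : injective cat_cells.
Proof.
move=> c c' cc; apply: tiling_inj => k.
have := congr1 (@^~ (lshift n k)) cc; have := congr1 (@^~ (rshift n k)) cc.
by rewrite /= !cat_cells_lshift !cat_cells_rshift => -> ->; rewrite subrr dvdz0.
Qed.

(** The terms depend on [s c] modulo M only and [residue] is a bijection onto (Z/M)^n, so this is
    the sum of a nontrivial character over the whole group. *)
Lemma sum_ee_tiling (p : 'I_n -> int) : ~~ [forall k, (M %| p k)%Z] ->
  \sum_c ee (\sum_k (p k)%:~R * (s c k)%:~R / M%:R : R) = 0.
Proof.
move=> pM; rewrite -[RHS](_ : \sum_(g : {ffun 'I_n -> 'I_M})
    ee (\sum_k (p k)%:~R * (g k)%:R / M%:R : R) = 0); last first.
  by rewrite sum_ee_ffun// (negbTE pM).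
rewrite (reindex residue); last by apply: onW_bij; exact: residue_bij.
apply: eq_bigr => c _; rewrite !ee_sum; apply: eq_bigr => k _.
by rewrite residueE -!intrM ee_modz// [in RHS]ee_modz// modzMmr.
Qed.

(** At the corner of the cell (i, j) such a character equals e(p . (a i + b j) / M). Since both
    halves of the frequency agree modulo integers, only the class of a i + b j modulo M matters,
    which the tiling makes range over the whole group. *)
Definition tiling_spectrum : set ((n + n).-tuple R) := [set l |
  exists p z : 'I_n -> int, forall k,
    tnth l (lshift n k) = (p k)%:~R / M%:R /\
    tnth l (rshift n k) = (p k)%:~R / M%:R + (z k)%:~R].

(** If p and q differ modulo M, the exponential sum vanishes by the tiling. Otherwise the two
    frequencies differ by a nonzero integer vector, at which the transform of the cube vanishes. *)
Lemma tiling_spectrum_orthogonal l m : tiling_spectrum l -> tiling_spectrum m ->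
  l <> m -> L2_dot (cells cat_cells) (character l) (character m) = 0.
Proof.
move=> [p [z lE]] [q [w mE]] lm; rewrite L2_dot_character; last exact: inj_cat_cells.
set dl := tsub l m.
have dL k : tnth dl (lshift n k) = (p k - q k)%:~R / M%:R.
  by rewrite tnth_tsub (lE k).1 (mE k).1 intrB mulrBl.
have dR k : tnth dl (rshift n k) = (p k - q k)%:~R / M%:R + (z k - w k)%:~R.
  by rewrite tnth_tsub (lE k).2 (mE k).2 !intrB mulrBl opprD addrACA.
have [/forallP pM|pM] := boolP [forall k, (M %| p k - q k)%Z].
  have Z k : exists y : int, (p k - q k)%:~R / M%:R = y%:~R :> R.
    have /dvdzP[y ->] := pM k.
    by exists y; rewrite intrM -[M%:~R]/(M%:R) mulfK.
  have [k dk] : exists k, tnth dl k != 0.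
    apply: contrapT => H; apply: lm; apply: eq_from_tnth => k.
    apply: contrapT => /eqP lk; apply: H; exists k.
    by rewrite tnth_tsub subr_eq0.
  have [y ky] : exists y : int, tnth dl k = y%:~R.
    move: dk; have [k' ->|k' ->] := split_ordP k => _.
      by have [y ky] := Z k'; exists y; rewrite dL ky.
    by have [y ky] := Z k'; exists (y + (z k' - w k')); rewrite dR ky [in RHS]intrD.
  rewrite (@hhprod_int _ _ dl k y) ?mulr0//.
    by move: dk; rewrite ky intr_eq0.
rewrite /exp_sum -[X in X * _](_ : \sum_c ee (\sum_k (p k - q k)%:~R * (s c k)%:~R / M%:R : R) = _).
  by rewrite sum_ee_tiling// mul0r.
apply: eq_bigr => c _; rewrite /idot big_split_ord /= -big_split /= !ee_sum.
apply: eq_bigr => k _.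
rewrite dL dR cat_cells_lshift cat_cells_rshift.
rewrite -[LHS](eeDint _ ((z k - w k) * b c.2 k)) /s intrD intrM; congr ee; ring.
Qed.

Let S : set ((n + n).-tuple R) := cells cat_cells.
Let mS : measurable S. Proof. exact: measurable_cells. Qed.
Let fS : (lebesgue_Rn R (n + n) S < +oo)%E.
Proof. by apply: lebesgue_cells_lty; exact: inj_cat_cells. Qed.
Let mu := lebesgue_Rn R (n + n).

Lemma indicator_sum (c c' : I * J) :
  \sum_(p : {ffun 'I_n -> 'I_M}) ee (\sum_k (s c k - s c' k)%:~R * (p k)%:R / M%:R : R)
  = if c == c' then (M ^ n)%:R else 0.
Proof.
rewrite sum_ee_ffun//; have [->|cc] := eqVneq c c'.
  by case: ifPn => // /forallPn[k]; rewrite subrr dvdz0.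
case: ifPn => // /forallP cM; case/eqP : cc.
exact: tiling_inj.
Qed.

Let lp (p : {ffun 'I_n -> 'I_M}) : (n + n).-tuple R :=
  [tuple match fintype.split k with inl k' | inr k' => (p k' : nat)%:R / M%:R end | k < n + n].

Let lp_lshift p k : tnth (lp p) (lshift n k) = (p k : nat)%:R / M%:R.
Proof. by rewrite tnth_mktuple (unsplitK (inl k)). Qed.

Let lp_rshift p k : tnth (lp p) (rshift n k) = (p k : nat)%:R / M%:R.
Proof. by rewrite tnth_mktuple (unsplitK (inr k)). Qed.

Let lp_Zn p m : Zn m -> tiling_spectrum (tadd (lp p) m).
Proof.
move=> Zm; have [w mw] := choice Zm.
exists (fun k => (p k : nat)%:Z + M%:Z * w (lshift n k)).
exists (fun k => w (rshift n k) - w (lshift n k)) => k.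
have -> : ((p k : nat)%:Z + M%:Z * w (lshift n k))%:~R / M%:R =
    (p k : nat)%:R / M%:R + (w (lshift n k))%:~R :> R.
  by rewrite intrD intrM mulrDl [M%:~R * _]mulrC mulfK.
rewrite !tnth_tadd lp_lshift lp_rshift !mw; split => //.
by rewrite intrB addrA addrAC addrK.
Qed.

Let vcell c : (n + n).-tuple R := [tuple (cat_cells c k)%:~R | k < n + n].

Let tfrac_cell c x : cell (cat_cells c) x -> tadd (tfrac x) (vcell c) = x.
Proof.
move=> xc; apply: eq_from_tnth => k.
by rewrite tnth_tadd tnth_tfrac tnth_mktuple xc subrK.
Qed.

Let shifted (A : set ((n + n).-tuple R)) c := [set y | A (tadd y (vcell c))].

Let measurable_shifted A c : measurable A -> measurable (shifted A c).
Proof.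
move=> mA; rewrite (_ : shifted A c = (fun y => tadd y (vcell c)) @^-1` A)//.
rewrite -[X in measurable X]setTI.
have mt : measurable_fun setT (fun y => tadd y (vcell c)).
  apply/measurable_fun_tnthP => k; rewrite (_ : _ \o _ =
    (fun y => tnth y k + tnth (vcell c) k)); last first.
    by apply/funext => y; rewrite /= tnth_tadd.
  by apply: measurable_funD; [exact: measurable_tnth|exact: measurable_cst].
exact: mt.
Qed.

Let characters_on_cell (p : {ffun 'I_n -> 'I_M}) c x : cell (cat_cells c) x ->
  character (lp p) x * ee (dot (topp (lp p)) (tfrac x)) =
  ee (\sum_k (s c k)%:~R * (p k : nat)%:R / M%:R).
Proof.
move=> xc; rewrite characterE -eeD; congr ee.
transitivity (\sum_k tnth (lp p) k * (cat_cells c k)%:~R).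
  rewrite /dot -big_split; apply: eq_bigr => k _.
  by rewrite tnth_topp tnth_tfrac xc /=; ring.
rewrite big_split_ord /= -big_split; apply: eq_bigr => k _ /=.
by rewrite lp_lshift lp_rshift cat_cells_lshift cat_cells_rshift /s intrD; ring.
Qed.

(** On S the indicator of A is a sum over the cells c of the indicator of c times a function of the
    fractional part. Fourier inversion on (Z/M)^n expresses the indicator of c through the values
    e(p . s(c') / M) on the cells c', and each of these is the character of [lp p] corrected by a
    function of the fractional part. The latter functions are limits of integer frequencies, so all
    frequencies remain in [lp p] + Z^(2n), inside [tiling_spectrum]. *)
Lemma tiling_spectrum_dense (A : set ((n + n).-tuple R)) : measurable A ->
  dense_at mu S (cspan tiling_spectrum) (fun x => (\1_A x)%:C).
Proof.
move=> mA; have sub := subspace_cspan tiling_spectrum.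
have E0 : cspan tiling_spectrum !=set0 by exists (fun=> 0); exact: cspan0.
pose term c (p : {ffun 'I_n -> 'I_M}) x : R[i] := ((M ^ n)%:R^-1 * (ee (\sum_k (s c k)%:~R * (p k : nat)%:R / M%:R))^*) *
  (character (lp p) x * (ee (dot (topp (lp p)) (tfrac x)) *
    (\1_(@tfrac R (n + n) @^-1` shifted A c) x)%:C)).
apply: (@eq_dense_at _ _ _ _ _ _ (fun x => \sum_c \sum_p term c p x)); last first.
  apply: dense_at_sum => // c _; apply: dense_at_sum => // p _.
  apply: dense_atZ => //; apply: dense_at_characterM => //.
    by move=> m; exact: lp_Zn.
  have [_ cl] := closure_sets_tfrac mS fS (measurable_shifted c mA).
  have subZ := subspace_cspan (@Zn R (n + n)).
  have [] // := bclosureM mS subZ (@cspan_Zn_mul R (n + n)) (bclosure_ee_tfrac mS fS (topp (lp p))) cl.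
move=> x [c0 _ xc0].
have inner c : \sum_p term c p x =
    (if c == c0 then 1 else 0) * (\1_(@tfrac R (n + n) @^-1` shifted A c) x)%:C.
  rewrite (eq_bigr (fun p : {ffun 'I_n -> 'I_M} => ((M ^ n)%:R^-1 *
    (\1_(@tfrac R (n + n) @^-1` shifted A c) x)%:C) *
    ee (\sum_k (s c0 k - s c k)%:~R * (p k : nat)%:R / M%:R))).
    rewrite -mulr_sumr indicator_sum eq_sym.
    have Mn : (M ^ n)%:R != 0 :> R[i] by rewrite pnatr_eq0 -lt0n expn_gt0 M0.
    by case: eqVneq => _; rewrite ?mulr0 ?mul0r// mulrAC mulVf.
  move=> p _; rewrite /term [character _ _ * (_ * _)]mulrA (characters_on_cell p xc0).
  rewrite [X in _ = _ * ee X](_ : _ = \sum_k (s c0 k)%:~R * (p k : nat)%:R / M%:R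
    - \sum_k (s c k)%:~R * (p k : nat)%:R / M%:R).
    by rewrite eeD eeN; ring.
  by rewrite -sumrB; apply: eq_bigr => k _; rewrite intrB !mulrBl.
rewrite (eq_bigr _ (fun c _ => inner c)) (bigD1 c0)//= eqxx mul1r big1 ?addr0.
  congr (_%:C); rewrite !indicE; congr (_%:R); congr nat_of_bool.
  by apply/idP/idP; rewrite !inE /shifted /= tfrac_cell.
by move=> c /negbTE ->; rewrite mul0r.
Qed.

Lemma spectral_prod_cells :
  spectral (prod_set (cells a) (cells b) : set ((n + n).-tuple R)).
Proof.
rewrite prod_set_cells; split.
- exact: bounded_cells.
- exact: measurable_cells.
- have : (0 < #|{: I * J}|)%N by rewrite card_prod tiling_card expn_gt0 M0.
  by move=> /card_gt0P[c _]; exact: lebesgue_cells_neq0.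
exists tiling_spectrum; split.
- move=> l _; split.
    by apply: bmfun_in_L2; [exact: inj_cat_cells|exact: bmfun_character].
  rewrite L2_dot_character_self; last exact: inj_cat_cells.
  by apply/eqP; rewrite pnatr_eq0 card_prod tiling_card -lt0n expn_gt0 M0.
- by move=> l m; exact: tiling_spectrum_orthogonal.
- move=> f [f1 f2 f3] e e0.
  have E0 : cspan tiling_spectrum !=set0 by exists (fun=> 0); exact: cspan0.
  have [_ /(_ _ (exprn_gt0 2 e0))[g Lg fg]] := dense_in_L2 mS
    (subspace_cspan tiling_spectrum) E0 tiling_spectrum_dense (conj f1 f2) f3.
  have [m [k [c [Lk gE]]]] := cspan_ordP Lg.
  exists m, k, c; split => //.
  by move: fg; rewrite (@eq_sqnorm _ _ _ _ _ _ (fun x => f x - \sum_(t < m) c t * character (k t) x))// => x _; rewrite gE.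
Qed.

End product_cells.

(** * Density of spectra *)

Section bessel.
Context d (T : measurableType d) (R : realType).
Variables (mu : {measure set T -> \bar R}) (D : set T).
Hypotheses (mD : measurable D) (fD : (mu D < +oo)%E).
Implicit Types f g : T -> R[i].

Let ip f g : R[i] := cint mu D (fun x => f x * conjc (g x)).

Variables (X : eqType) (F : seq X) (e : X -> T -> R[i]) (kappa : R).
Hypothesis uF : uniq F.
Hypothesis be : forall x, bmfun (e x).
Hypothesis kappa0 : 0 < kappa.
Hypothesis orth_e : forall x y, x \in F -> y \in F ->
  ip (e x) (e y) = if x == y then kappa%:C else 0.

(** The square is completed in each coefficient. The last sum is zero at the Fourier coefficients,
    which yields [bessel], and always nonnegative, which yields [best_approximation]. *)
Lemma sqnorm_sub_orthogonal f (c : X -> R[i]) : bmfun f ->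
  sqnorm mu D (fun x => (f x - \sum_(y <- F) c y * e y x)%R) =
  (complex.Re (ip f f) - kappa^-1 * \sum_(y <- F) Normc.normc (ip f (e y)) ^+ 2 +
    kappa^-1 * \sum_(y <- F) Normc.normc (kappa%:C * c y - ip f (e y)) ^+ 2)%:E.
Proof.
move=> bf.
pose g x := \sum_(y <- F) c y * e y x.
have bg : bmfun g by apply: bmfun_sum => y _; exact: bmfunZ.
rewrite /sqnorm integral_sqr_normc//; last exact: bmfunB.
congr EFin.
have fg : ip f g = \sum_(y <- F) conjc (c y) * ip f (e y).
  rewrite /ip; under eq_cint => x _.
    rewrite /g conjc_sum mulr_sumr; under eq_bigr do rewrite conjcM mulrCA.
    over.
  rewrite cint_sum//; last by move=> y _; apply: bmfunZ; apply: bmfunM => //; exact: bmfunJ.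
  by apply: eq_bigr => y _; rewrite cintZ//; apply: bmfunM => //; exact: bmfunJ.
have gg : ip g g = \sum_(y <- F) kappa%:C * (c y * conjc (c y)).
  have -> : ip g g = \sum_(y <- F) c y * ip (e y) g.
    rewrite /ip; under eq_cint => x _.
      rewrite {1}/g mulr_suml; under eq_bigr do rewrite -mulrA.
      over.
    rewrite cint_sum//; last by move=> y _; apply: bmfunZ; apply: bmfunM => //; exact: bmfunJ.
    by apply: eq_bigr => y _; rewrite cintZ//; apply: bmfunM => //; exact: bmfunJ.
  rewrite !big_seq; apply: eq_bigr => y yF.
  have -> : ip (e y) g = \sum_(z <- F) conjc (c z) * ip (e y) (e z).
    rewrite /ip; under eq_cint => x _.
      rewrite /g conjc_sum mulr_sumr; under eq_bigr do rewrite conjcM mulrCA.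
      over.
    rewrite cint_sum//; last first.
      by move=> z _; apply: bmfunZ; apply: bmfunM => //; exact: bmfunJ.
    by apply: eq_bigr => z _; rewrite cintZ//; apply: bmfunM => //; exact: bmfunJ.
  rewrite (bigD1_seq y)//= orth_e// eqxx big_seq_cond big1 ?addr0.
    by ring.
  by move=> z /andP[zF zy]; rewrite orth_e// eq_sym (negbTE zy) mulr0.
have E : cint mu D (fun x => (f x - g x) * (f x - g x)^*) =
    ip f f - ip f g - conjc (ip f g) + ip g g.
  rewrite (@eq_cint _ _ _ _ _ _ (fun x => f x * conjc (f x) +
    (-1 * (f x * conjc (g x)) + (-1 * conjc (f x * conjc (g x)) + g x * conjc (g x))))); last first.
    by move=> x _; rewrite conjE !(conjcD, conjcN, conjcM) conjcK; ring.
  have bff : bmfun (fun x => f x * conjc (f x)) by apply: bmfunM => //; exact: bmfunJ.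
  have bfg : bmfun (fun x => f x * conjc (g x)) by apply: bmfunM => //; exact: bmfunJ.
  have bgg : bmfun (fun x => g x * conjc (g x)) by apply: bmfunM => //; exact: bmfunJ.
  have bfgJ : bmfun (fun x => conjc (f x * conjc (g x))) by exact: bmfunJ.
  have b1 := bmfunD (bmfunZ (-1) bfgJ) bgg.
  have b2 := bmfunD (bmfunZ (-1) bfg) b1.
  rewrite (cintD mD fD bff b2) (cintD mD fD (bmfunZ (-1) bfg) b1).
  rewrite (cintD mD fD (bmfunZ (-1) bfgJ) bgg) !(cintZ mD fD)// cintJ// /ip.
  ring.
rewrite E !(cReD, cReN) cReJ fg gg !cRe_sum !mulr_sumr -!addrA; congr (_ + _).
rewrite -!sumrN -!big_split /=; apply: eq_bigr => y _.
have key (p q : R[i]) : - complex.Re (conjc q * p) +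
    (- complex.Re (conjc q * p) + complex.Re (kappa%:C * (q * conjc q))) =
    - (kappa^-1 * Normc.normc p ^+ 2) +
    kappa^-1 * Normc.normc (kappa%:C * q - p) ^+ 2.
  rewrite !sqr_normcE.
  case: p q => [p1 p2] [q1 q2]; rewrite !(cReM, cImM, cReD, cImD, cReN, cImN) /=.
  by field; rewrite gt_eqF.
exact: key.
Qed.

Lemma bessel f : bmfun f ->
  \sum_(y <- F) Normc.normc (ip f (e y)) ^+ 2 <= kappa * complex.Re (ip f f).
Proof.
move=> bf; pose c y := kappa^-1%:C * ip f (e y).
have := sqnorm_ge0 mu D (fun x => (f x - \sum_(y <- F) c y * e y x)%R).
rewrite sqnorm_sub_orthogonal// lee_fin [X in _ + _ * X]big1 ?mulr0 ?addr0.
  by rewrite subr_ge0 -(ler_pM2l kappa0) mulrA divff ?gt_eqF// mul1r.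
move=> y _; rewrite /c mulrA -real_complexM divff ?gt_eqF// mul1r subrr.
by rewrite normc_real normr0 expr0n.
Qed.

Lemma best_approximation f (c : X -> R[i]) : bmfun f ->
  ((complex.Re (ip f f) - kappa^-1 * \sum_(y <- F) Normc.normc (ip f (e y)) ^+ 2)%:E <=
  sqnorm mu D (fun x => (f x - \sum_(y <- F) c y * e y x)%R))%E.
Proof.
move=> bf; rewrite sqnorm_sub_orthogonal// lee_fin lerDl.
apply: mulr_ge0; first by rewrite invr_ge0 ltW.
by apply: sumr_ge0 => y _; exact: sqr_ge0.
Qed.

End bessel.

Section span_coefficients.
Context {R : realType} (n : nat).

(** Terms with equal frequencies are merged, so that the coefficients are indexed by a
    duplicate-free list, as in [best_approximation]. *)
Lemma cspan_seqP (F : seq (n.-tuple R)) (g : n.-tuple R -> R[i]) : uniq F ->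
  cspan [set` F] g ->
  exists c : n.-tuple R -> R[i], forall x, g x = \sum_(l <- F) c l * character l x.
Proof.
move=> uF; elim=> [|c l h /= lF _ [c' hE]].
  by exists (fun=> 0) => x; rewrite big1// => l _; rewrite mul0r.
exists (fun m => (if m == l then c else 0) + c' m) => x.
rewrite hE; under [RHS]eq_bigr do rewrite mulrDl.
rewrite big_split /=; congr (_ + _).
rewrite (bigD1_seq l)//= eqxx big1 ?addr0// => m ml.
by rewrite (negbTE ml) mul0r.
Qed.

Lemma cspanS (L1 L2 : set (n.-tuple R)) g : L1 `<=` L2 -> cspan L1 g -> cspan L2 g.
Proof.
move=> L12; elim=> [|c l h Ll _ ih]; first exact: cspan0.
by apply: cspan_cons => //; exact: L12.
Qed.

Lemma cspan_ord (L : set (n.-tuple R)) m (k : 'I_m -> n.-tuple R) (c : 'I_m -> R[i]) :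
  (forall t, L (k t)) -> cspan L (fun x => \sum_(t < m) c t * character (k t) x).
Proof.
move=> Lk; elim: m k c Lk => [|m ih] k c Lk.
  by apply: eq_cspan (cspan0 L) => x; rewrite big_ord0.
apply: eq_cspan (cspan_cons (c ord0) (Lk ord0) (ih (k \o lift ord0) (c \o lift ord0) _)).
  by move=> x; rewrite big_ord_recl.
by move=> t; exact: Lk.
Qed.

End span_coefficients.

Section density_of_spectra.
Context {R : realType} (n : nat).
Notation Rn := (n.-tuple R).
Notation mu := (lebesgue_Rn R n).

Let cell0 : set Rn := cell (fun=> 0).
Let m0 : measurable cell0 := measurable_cell _.
Let f0 : (mu cell0 < +oo)%E := lebesgue_cell_lty _.

Lemma cint_cell0_dot (l m : Rn) :
  cint mu cell0 (fun x => character l x * conjc (character m x)) = hhprod (tsub l m).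
Proof.
rewrite -[LHS]/(cint mu cell0 (fun x => character l x * (character m x)^*)).
by rewrite cint_cell_dot /idot big1 ?ee0 ?mul1r// => i _; rewrite mulr0.
Qed.

Definition ztuple (z : {ffun 'I_n -> int}) : Rn := [tuple (z i)%:~R | i < n].

(** The characters of Z^n are orthonormal on the unit cube, and the terms are the squared
    coefficients of the character of u, which has norm 1 there. *)
Lemma bessel_integer_shifts (Z : seq {ffun 'I_n -> int}) (u : Rn) : uniq Z ->
  \sum_(z <- Z) Normc.normc (hhprod (tsub u (ztuple z))) ^+ 2 <= 1.
Proof.
move=> uZ.
have orth (z w : {ffun 'I_n -> int}) : z \in Z -> w \in Z ->
    cint mu cell0 (fun x => character (ztuple z) x * conjc (character (ztuple w) x)) =
    if z == w then (1 : R)%:C else 0.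
  move=> _ _; rewrite cint_cell0_dot.
  have [->|zw] := eqVneq z w.
    by rewrite hhprod0// => i; rewrite tnth_tsub subrr.
  have [i zwi] : exists i, z i != w i.
    apply: contrapT => H; case/eqP : zw; apply/ffunP => i.
    by apply: contrapT => /eqP zwi; apply: H; exists i.
  apply: (@hhprod_int _ _ _ i (z i - w i)); first by rewrite subr_eq0.
  by rewrite tnth_tsub !tnth_mktuple intrB.
have := @bessel _ _ _ mu cell0 m0 f0 _ Z (fun z => character (ztuple z)) 1 uZ
  (fun z => bmfun_character _) ltr01 orth (character u) (bmfun_character u).
have -> : cint mu cell0 (fun x => character u x * conjc (character u x)) = 1.
  by rewrite cint_cell0_dot hhprod0// => i; rewrite tnth_tsub subrr.
rewrite mul1r => H; apply: (le_trans _ H); rewrite le_eqVlt; apply/orP; left; apply/eqP.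
apply: eq_bigr => z _; congr (Normc.normc _ ^+ 2).
by rewrite -cint_cell0_dot.
Qed.

(** The factors are replaced one at a time; all of them have modulus at most 1. *)
Lemma hhprod_lip (l m : Rn) :
  Normc.normc (hhprod l - hhprod m) <= 4 * pi * \sum_i `|tnth l i - tnth m i|.
Proof.
rewrite /hhprod mulr_sumr.
have H (r : seq 'I_n) : Normc.normc (\prod_(i <- r) hh (tnth l i)) <= 1.
  rewrite normc_prod; elim: r => [|i r ih]; first by rewrite big_nil.
  rewrite big_cons -[leRHS]mulr1 ler_pM ?normc_ge0 ?normc_hh_le1//.
  by rewrite prodr_ge0// => j _; exact: normc_ge0.
elim: (index_enum _) => [|i r ih].
  by rewrite !big_nil subrr normc_real normr0.
rewrite !big_cons.
rewrite (_ : _ - _ = (hh (tnth l i) - hh (tnth m i)) * \prod_(j <- r) hh (tnth l j) +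
  hh (tnth m i) * (\prod_(j <- r) hh (tnth l j) - \prod_(j <- r) hh (tnth m j))); last by ring.
rewrite (le_trans (le_normcD _ _))// lerD// Normc.normcM.
  rewrite (le_trans _ (hh_lip _ _))// -[leRHS]mulr1 ler_wpM2l ?normc_ge0//.
rewrite (le_trans _ ih)// -[leRHS]mul1r ler_wpM2r ?normc_ge0// normc_hh_le1//.
Qed.

Lemma normc_hhprod_le1 (l : Rn) : Normc.normc (hhprod l) <= 1.
Proof.
rewrite normc_prod; elim/big_rec: _ => // i x _ x1.
rewrite -[leRHS]mul1r; apply: (@le_trans _ _ (Normc.normc (hh (tnth l i)) * 1)).
  by rewrite ler_wpM2l ?normc_ge0.
by rewrite mulr1 mul1r normc_hh_le1.
Qed.

Lemma sqr_hhprod_lip (l m : Rn) :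
  Normc.normc (hhprod l) ^+ 2 <= Normc.normc (hhprod m) ^+ 2 +
    8 * pi * \sum_i `|tnth l i - tnth m i|.
Proof.
have := hhprod_lip l m; have := normc_hhprod_le1 l; have := normc_hhprod_le1 m.
have : Normc.normc (hhprod l) <= Normc.normc (hhprod m) + Normc.normc (hhprod l - hhprod m).
  by have := le_normcD (hhprod m) (hhprod l - hhprod m); rewrite addrC subrK.
have := normc_ge0 (hhprod m); have := normc_ge0 (hhprod l).
have := normc_ge0 (hhprod l - hhprod m).
move: (Normc.normc (hhprod l)) (Normc.normc (hhprod m)) => x y.
move: (Normc.normc _) (\sum_i _) => z s z0 x0 y0 xyz y1 x1 zs.
have : x ^+ 2 <= y ^+ 2 + 2 * z by nra.
move=> /le_trans; apply; rewrite lerD2l.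
by have := ler_wpM2l (ler0n R 2) zs; rewrite !mulrA -natrM.
Qed.

End density_of_spectra.

(** * Counting points of a spectrum in a cube *)

Section spectrum_density.
Context {R : realType} (n : nat).
Notation Rn := (n.-tuple R).
Notation mu := (lebesgue_Rn R n).
Variables (I : finType) (a : I -> 'I_n -> int).
Hypothesis inja : injective a.
Variables (i0 : I).
Hypothesis ai0 : a i0 = fun=> 0.
Variable L : set Rn.
Hypothesis spL : orthogonal_basis_L2 (cells a) L (@character R n).

Let S : set Rn := cells a.
Let cell0 : set Rn := cell (fun=> 0).
Let mS : measurable S. Proof. exact: measurable_cells. Qed.
Let fS : (mu S < +oo)%E. Proof. exact: lebesgue_cells_lty. Qed.
Let K : R := #|I|%:R.
Let K0 : 0 < K. Proof. by rewrite ltr0n; apply/card_gt0P; exists i0. Qed.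

(** These test functions live on the single cell at the origin. They have norm 1 while characters
    have squared norm K on S, so completeness forces the squared coefficients |hhprod(l - m)|^2 to
    add up to K over m in L; this is where the number of cells enters. *)
Let fx (l x : Rn) : R[i] := character l x * (\1_cell0 x)%:C.

Let bm_fx l : bmfun (fx l).
Proof.
apply: bmfunM; first exact: bmfun_character.
by apply: bmfun_indic; exact: measurable_cell.
Qed.

Let cint_S_cell0 (h : Rn -> R[i]) : bmfun h ->
  cint mu S (fun x => h x * (\1_cell0 x)%:C) = cint mu cell0 h.
Proof.
move=> bh; rewrite cint_cells//; last first.
  by apply: bmfunM => //; apply: bmfun_indic; exact: measurable_cell.
rewrite (bigD1 i0)//= big1 ?addr0.
  rewrite ai0; apply: eq_cint => x x0.
  by rewrite indicE mem_set// mulr1.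
move=> i ii0; rewrite -(cint0 mu (measurable_cell (a i))); apply: eq_cint => x xi.
rewrite indicE memNset ?mulr0// => x0; case/eqP : ii0; apply: inja.
by apply/funext => k; rewrite ai0 -xi x0.
Qed.

Let ip_fx l m : cint mu S (fun x => fx l x * conjc (character m x)) = hhprod (tsub l m).
Proof.
rewrite -cint_cell0_dot -cint_S_cell0.
  by apply: eq_cint => x _; rewrite /fx mulrAC.
by apply: bmfunM; [|apply: bmfunJ]; exact: bmfun_character.
Qed.

Let ip_fx_self l : cint mu S (fun x => fx l x * conjc (fx l x)) = 1.
Proof.
rewrite -[RHS](hhprod0 (l := tsub l l)); last by move=> i; rewrite tnth_tsub subrr.
rewrite -cint_cell0_dot -cint_S_cell0.
  apply: eq_cint => x _; rewrite /fx indicE; case: (x \in cell0).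
    by rewrite !mulr1.
  by rewrite !mulr0 mul0r.
by apply: bmfunM; [|apply: bmfunJ]; exact: bmfun_character.
Qed.

Let orthL l m : L l -> L m ->
  cint mu S (fun x => character l x * conjc (character m x)) = if l == m then K%:C else 0.
Proof.
move=> Ll Lm; have [_ orth _] := spL.
have [->|/eqP lm] := eqVneq l m; last exact: orth.
transitivity (L2_dot S (character m) (character m)) => //.
by rewrite L2_dot_character_self// -real_complex_nat.
Qed.

Let projection_bound (F : seq Rn) (l : Rn) g : uniq F -> {in F, forall m, L m} ->
  cspan [set` F] g ->
  ((1 - K^-1 * \sum_(m <- F) Normc.normc (hhprod (tsub l m)) ^+ 2)%:E <=
    sqnorm mu S (fun x => (fx l x - g x)%R))%E.
Proof.
move=> uF FL /(cspan_seqP uF)[c gE].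
have orth (x y : Rn) : x \in F -> y \in F ->
    cint mu S (fun z => character x z * conjc (character y z)) = if x == y then K%:C else 0.
  by move=> xF yF; apply: orthL; exact: FL.
have := @best_approximation _ _ _ mu S mS fS _ F (@character R n) K uF
  (@bmfun_character R n) K0 orth (fx l) c (bm_fx l).
rewrite (@eq_sqnorm _ _ _ mu S _ (fun x => (fx l x - g x)%R)); last by move=> x _; rewrite gE.
rewrite (ip_fx_self l) [complex.Re 1]/=; apply: le_trans.
rewrite lee_fin lerD2l lerN2 ler_wpM2l ?invr_ge0 ?(ltW K0)//.
rewrite le_eqVlt; apply/orP; left; apply/eqP.
by apply: eq_bigr => m _; congr (Normc.normc _ ^+ 2); rewrite ip_fx.
Qed.

Let fx_close (N : nat) (l m : Rn) : (0 < N)%N ->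
  (forall i, `|tnth l i - tnth m i| <= N%:R^-1) ->
  (sqnorm mu S (fun x => (fx l x - fx m x)%R) <=
    ((4 * pi * n%:R / N%:R) ^+ 2 * fine (mu S))%:E)%E.
Proof.
move=> N0 lm.
have B x : Normc.normc (fx l x - fx m x) <= 4 * pi * n%:R / N%:R.
  have C0 : 0 <= 4 * pi * n%:R / N%:R :> R by rewrite !mulr_ge0 ?pi_ge0 ?invr_ge0.
  rewrite /fx indicE; have [/set_mem x0|_] := boolP (x \in cell0); last first.
    by rewrite !mulr0 subrr normc_real normr0.
  rewrite !mulr1 !characterE; apply: (le_trans (ee_lip _ _)).
  rewrite -!mulrA ler_wpM2l// ler_wpM2l ?pi_ge0// /dot -sumrB.
  rewrite (le_trans (ler_norm_sum _ _ _))//.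
  apply: (@le_trans _ _ (\sum_(i < n) N%:R^-1)).
    apply: ler_sum => i _; rewrite -mulrBl normrM -[leRHS]mulr1 ler_pM//.
    have := floor_itv (tnth x i); rewrite (x0 i) add0r => /andP[h1 h2].
    by rewrite ger0_norm// ltW.
  by rewrite sumr_const card_ord -[_ *+ n]mulr_natl.
rewrite /sqnorm; apply: (@le_trans _ _ (\int[mu]_(x in S) ((4 * pi * n%:R / N%:R) ^+ 2)%:E)%E).
  apply: ge0_le_integral => //.
  - by move=> x _; rewrite lee_fin sqr_ge0.
  - by apply: cmeas_sqr; apply: bmfun_cmeas; apply: bmfunB; exact: bm_fx.
  - move=> x _; rewrite lee_fin ler_pXn2r ?nnegrE ?normc_ge0//.
    exact: le_trans (normc_ge0 _) (B x).
by rewrite integral_cst// [leRHS]EFinM fineK// ge0_fin_numE.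
Qed.

(** Completeness yields a finite part of L for each single l. A finite net in the unit cube and the
    continuity of [fx] in l make one finite list work for all l, as the averaging with its rounding
    errors requires. *)
Let uniform_approximation (e : R) : 0 < e -> exists F : seq Rn,
  [/\ uniq F, {in F, forall m, L m} &
    forall l : Rn, (forall i, 0 <= tnth l i < 1) ->
      K * (1 - e) <= \sum_(m <- F) Normc.normc (hhprod (tsub l m)) ^+ 2].
Proof.
move=> e0; have [_ _ dense] := spL.
have e4 : 0 < e / 4 by rewrite divr_gt0.
have [N N0 Ne] : exists2 N : nat, (0 < N)%N &
    (4 * pi * n%:R / N%:R) ^+ 2 * fine (mu S) < e / 4.
  pose C : R := (4 * pi * n%:R) ^+ 2 * fine (mu S).
  have C0 : 0 <= C by rewrite mulr_ge0 ?sqr_ge0// fine_ge0.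
  have := archi_boundP (divr_ge0 C0 (ltW e4)); set N := Num.bound _ => CN.
  exists N.+1 => //; rewrite expr_div_n mulrAC -/C.
  rewrite ltr_pdivrMr ?exprn_gt0 ?ltr0n//.
  rewrite -ltr_pdivrMl// mulrC (lt_le_trans CN)//.
  rewrite -natrX ler_nat (leq_trans (leqnSn _))// expnS expn1 leq_pmull//.
have [eps eps0 epsE] : exists2 eps : R, 0 < eps & eps ^+ 2 = e / 4.
  by exists (Num.sqrt (e / 4)); rewrite ?sqrtr_gt0// sqr_sqrtr// ltW.
pose node (s : {ffun 'I_n -> 'I_N}) : Rn := [tuple (s i : nat)%:R / N%:R | i < n].
have nodeF s : exists F : seq Rn, {in F, forall m, L m} /\
    exists2 g, cspan [set` F] g & (sqnorm mu S (fun x => (fx (node s) x - g x)%R) < (e / 4)%:E)%E.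
  have [|m [k [c [Lk]]]] := dense (fx (node s)) _ eps eps0.
    exact: bmfun_in_L2.
  rewrite epsE => fg; exists (codom k); split.
    by move=> l /codomP[t ->].
  exists (fun x => \sum_(t < m) c t * character (k t) x) => //.
  by apply: cspan_ord => t /=; exact: codom_f.
have [F FP] := choice nodeF.
pose G := undup (flatten [seq F s | s <- enum {ffun 'I_n -> 'I_N}]).
have FG s : {subset F s <= G}.
  move=> l lF; rewrite mem_undup; apply/flattenP; exists (F s) => //.
  by apply: map_f; rewrite mem_enum.
have GL : {in G, forall m, L m}.
  move=> l; rewrite mem_undup => /flattenP[_ /mapP[s _ ->] lF].
  by have [FL _] := FP s; exact: FL.
exists G; split => //; first exact: undup_uniq.
move=> l l01.
have fl i : (`|Num.floor (N%:R * tnth l i)|%N < N)%N.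
  have /andP[l0 l1] := l01 i; have NR : 0 < N%:R :> R by rewrite ltr0n.
  have z0 : 0 <= Num.floor (N%:R * tnth l i) by rewrite floor_ge0 mulr_ge0// ltW.
  rewrite -ltz_nat gez0_abs// -(ltr_int R); apply: le_lt_trans (floor_le _) _.
  by rewrite -[ltRHS]mulr1 ltr_pM2l.
pose s : {ffun 'I_n -> 'I_N} := [ffun i => Ordinal (fl i)].
have ls i : `|tnth l i - tnth (node s) i| <= N%:R^-1.
  have /andP[l0 l1] := l01 i; have NR : 0 < N%:R :> R by rewrite ltr0n.
  rewrite tnth_mktuple ffunE /=.
  have z0 : 0 <= Num.floor (N%:R * tnth l i) by rewrite floor_ge0 mulr_ge0// ltW.
  have -> : (`|Num.floor (N%:R * tnth l i)|%N)%:R = (Num.floor (N%:R * tnth l i))%:~R :> R.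
    by rewrite -[in RHS](gez0_abs z0).
  have /andP[h1] := floor_itv (N%:R * tnth l i); rewrite intrD => h2.
  move: (Num.floor _) z0 h1 h2 => z z0 h1 h2.
  rewrite -[tnth l i in X in `|X|](mulKf (lt0r_neq0 NR)) mulrC -mulrBl normrM.
  rewrite (@ger0_norm _ (N%:R^-1)) ?invr_ge0 ?(ltW NR)//.
  rewrite ler_piMl ?invr_ge0 ?(ltW NR)// ger0_norm ?subr_ge0//.
  by rewrite lerBlDl ltW.
have [FL [g Fg fg]] := FP s.
have Gg : cspan [set` G] g by apply: cspanS Fg => m /= /FG.
have sq : (sqnorm mu S (fun x => (fx l x - g x)%R) < e%:E)%E.
  rewrite (@eq_sqnorm _ _ _ mu S _ (fun x => ((fx l x - fx (node s) x) + (fx (node s) x - g x))%R)).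
    apply: sqnormD_lt => //.
    - by apply: bmfun_cmeas; apply: bmfunB; exact: bm_fx.
    - by apply: bmfun_cmeas; apply: bmfunB; [exact: bm_fx|exact: cspan_bmfun Fg].
    - by apply: le_lt_trans (fx_close N0 ls) _; rewrite lte_fin.
  by move=> x _; rewrite addrA subrK.
have := le_lt_trans (projection_bound l (undup_uniq _) GL Gg) sq.
rewrite lte_fin => H; rewrite -ler_pdivlMl//; move: H.
by move: (_ * \sum_(_ <- _) _) => q; lra.
Qed.

(** With z = floor(T t), the map y |-> (y + z) mod T permutes the grid, and floor(t + y/T) is the
    quotient of y + z by T. A shift by a grid point thus turns into a shift by an integer that
    depends on y. *)
Let grid_sum (T : nat) (t : R) (G : R -> R) : (0 < T)%N ->
  \sum_(x < T) G ((x%:R - (Num.floor (T%:R * t))%:~R) / T%:R) =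
  \sum_(y < T) G (y%:R / T%:R - (Num.floor (t + y%:R / T%:R))%:~R).
Proof.
move=> T0; have TR : 0 < T%:R :> R by rewrite ltr0n.
have T0' : (T : int) != 0 by rewrite eqz_nat -lt0n.
pose z := Num.floor (T%:R * t).
have sP (y : 'I_T) : (`|((y%:Z + z) %% T)%Z|%N < T)%N.
  by rewrite -ltz_nat gez0_abs ?modz_ge0// ltz_pmod.
pose sg (y : 'I_T) : 'I_T := Ordinal (sP y).
have sgE y : ((sg y : nat)%:Z = ((y : nat)%:Z + z) %% T)%Z.
  by rewrite /= gez0_abs ?modz_ge0.
have inj_sg : injective sg.
  move=> y y' yy; apply: val_inj => /=; apply/eqP.
  have : (((y : nat)%:Z + z) %% T)%Z = (((y' : nat)%:Z + z) %% T)%Z by rewrite -!sgE yy.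
  move/eqP; rewrite eqz_modDr !modz_small ?eqz_nat//.
  - by rewrite ltz_nat ltn_ord.
  - by rewrite ltz_nat ltn_ord.
rewrite (reindex_inj inj_sg); apply: eq_bigr => y _; congr G.
have fl : Num.floor (t + (y : nat)%:R / T%:R) = ((y%:Z + z) %/ T)%Z.
  apply/eqP; rewrite floor_eq; apply/andP.
  have E : t + (y : nat)%:R / T%:R = (T%:R * t + (y : nat)%:R) / T%:R.
    by rewrite mulrDl mulrAC divff ?gt_eqF// mul1r.
  have /andP[h1 h2] := floor_itv (T%:R * t); rewrite -/z in h1 h2.
  have q1 := divz_eq (y%:Z + z) T.
  have q2 := modz_ge0 (y%:Z + z) T0'.
  have q3 : ((y%:Z + z) %% T)%Z < T by rewrite ltz_pmod.
  rewrite E ler_pdivlMr// ltr_pdivrMr//; split.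
    apply: (@le_trans _ _ (y%:Z + z)%:~R).
      by rewrite -[T%:R]/((T : int)%:~R) -intrM ler_int; lia.
    by rewrite intrD addrC lerD2r.
  apply: (@lt_le_trans _ _ (y%:Z + z + 1)%:~R).
    have -> : (y%:Z + z + 1)%:~R = (y : nat)%:R + (z + 1)%:~R :> R.
      by rewrite -addrA [LHS]intrD.
    by rewrite addrC ltrD2l.
  by rewrite -[T%:R]/((T : int)%:~R) -intrM ler_int; lia.
rewrite fl.
have -> : (sg y : nat)%:R = (y%:Z + z)%:~R - ((y%:Z + z) %/ T)%Z%:~R * T%:R :> R.
  rewrite {1}(divz_eq (y%:Z + z) T) -sgE intrD intrM -[(T : int)%:~R]/(T%:R).
  by rewrite addrC addKr.
by rewrite intrD addrAC addrK mulrBl mulfK ?gt_eqF.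
Qed.

(* The functions of [uniform_approximation] are averaged over a grid of mesh 1/T. After
   rounding m to the grid, the sum over the grid becomes a sum over the same grid of the
   values at integer shifts, to which Bessel's inequality on a single cell applies. *)
Lemma spectrum_density : exists (u : Rn) (z : {ffun 'I_n -> int}) (F : seq Rn),
  [/\ uniq F, {in F, forall m, L m},
    {in F, forall m, forall i, Num.floor (tnth m i + tnth u i) = z i} &
    (#|I| <= size F)%N].
Proof.
apply: contrapT => none.
have few (u : Rn) (z : {ffun 'I_n -> int}) (F : seq Rn) : uniq F ->
    {in F, forall m, L m} ->
    {in F, forall m, forall i, Num.floor (tnth m i + tnth u i) = z i} ->
    (size F)%:R <= K - 1.
  move=> uF FL Fz; rewrite lerBrDr natr1 ler_nat ltnNge; apply/negP => big.
  by apply: none; exists u, z, F.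
(* Error budget: 1/4 is lost here and less than 1/2 in rounding to the grid, so the averages exceed
   K - 3/4, against the bound K - 1 of [up]. *)
have e0 : 0 < (4 * K)^-1 by rewrite invr_gt0 mulr_gt0.
have [F [uF FL FK]] := uniform_approximation e0.
pose C : R := 8 * pi * n%:R.
have C0 : 0 <= C by rewrite !mulr_ge0 ?pi_ge0.
have := archi_boundP (mulr_ge0 (mulr_ge0 (ler0n R 2) (ler0n R (size F))) C0).
set T' := Num.bound _ => FT'.
pose T := T'.+1; have FT : 2 * (size F)%:R * C < T%:R.
  by apply: lt_le_trans FT' _; rewrite ler_nat leqnSn.
have T0 : (0 < T)%N by []; have TR : 0 < T%:R :> R by rewrite ltr0n.
pose node (x : {ffun 'I_n -> 'I_T}) : Rn := [tuple (x i : nat)%:R / T%:R | i < n].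
have node01 x i : 0 <= tnth (node x) i < 1.
  rewrite tnth_mktuple divr_ge0//= ltr_pdivrMr// mul1r ltr_nat; exact: ltn_ord.
pose rd (m : Rn) : Rn := [tuple (Num.floor (T%:R * tnth m i))%:~R / T%:R | i < n].
pose phi (l : Rn) : R := Normc.normc (hhprod l) ^+ 2.
have phi_rd x m : phi (tsub (node x) m) <= phi (tsub (node x) (rd m)) + C / T%:R.
  rewrite (le_trans (sqr_hhprod_lip _ (tsub (node x) (rd m))))// lerD2l.
  rewrite /C -!mulrA ler_wpM2l// ler_wpM2l ?pi_ge0//.
  apply: (@le_trans _ _ (\sum_(i < n) T%:R^-1)); last first.
    by rewrite sumr_const card_ord -[_ *+ n]mulr_natl.
  apply: ler_sum => i _; rewrite !tnth_tsub opprB addrACA [X in `|X|]addrC.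
  rewrite addrA subrK (tnth_mktuple _ i).
  have /andP[h1] := floor_itv (T%:R * tnth m i); rewrite intrD => h2.
  move: (Num.floor _) h1 h2 => z h1 h2.
  rewrite addrC -[tnth m i](mulKf (lt0r_neq0 TR)) [T%:R^-1 * _]mulrC -mulrBl normrM.
  rewrite (@ger0_norm _ (T%:R^-1)) ?invr_ge0 ?(ltW TR)//.
  rewrite ler_piMl ?invr_ge0 ?(ltW TR)// distrC ger0_norm ?subr_ge0//.
  by rewrite lerBlDl ltW.
have low : (T ^ n)%:R * (K - 4^-1) <=
    \sum_(x : {ffun 'I_n -> 'I_T}) \sum_(m <- F) phi (tsub (node x) (rd m)) +
    (T ^ n)%:R * ((size F)%:R * (C / T%:R)).
  have -> : (T ^ n)%:R * (K - 4^-1) = \sum_(x : {ffun 'I_n -> 'I_T}) (K - 4^-1).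
    by rewrite sumr_const card_ffun !card_ord -[RHS]mulr_natl.
  have -> : (T ^ n)%:R * ((size F)%:R * (C / T%:R)) =
      \sum_(x : {ffun 'I_n -> 'I_T}) ((size F)%:R * (C / T%:R)).
    by rewrite sumr_const card_ffun !card_ord -[RHS]mulr_natl.
  rewrite -big_split; apply: ler_sum => x _ /=.
  have -> : K - 4^-1 = K * (1 - (4 * K)^-1) by field; rewrite gt_eqF.
  rewrite (le_trans (FK (node x) (node01 x)))//.
  rewrite -sum1_size natr_sum mulr_suml -big_split /=; apply: ler_sum => m _.
  by rewrite mul1r; exact: phi_rd.
pose zeta (y : {ffun 'I_n -> 'I_T}) (m : Rn) : {ffun 'I_n -> int} :=
  [ffun i => Num.floor (tnth m i + tnth (node y) i)].
have swap m : \sum_(x : {ffun 'I_n -> 'I_T}) phi (tsub (node x) (rd m)) =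
    \sum_(y : {ffun 'I_n -> 'I_T}) phi (tsub (node y) (ztuple (zeta y m))).
  pose G (s : R) := Normc.normc (hh s) ^+ 2.
  have phiE l : phi l = \prod_i G (tnth l i) by rewrite /phi normc_prod prodrXl.
  transitivity (\prod_(i < n) \sum_(x < T) G ((x%:R - (Num.floor (T%:R * tnth m i))%:~R) / T%:R)).
    rewrite bigA_distr_bigA; apply: eq_bigr => x _; rewrite phiE; apply: eq_bigr => i _.
    by rewrite tnth_tsub !tnth_mktuple mulrBl.
  transitivity (\prod_(i < n) \sum_(y < T) G (y%:R / T%:R - (Num.floor (tnth m i + y%:R / T%:R))%:~R)).
    by apply: eq_bigr => i _; exact: grid_sum.
  rewrite bigA_distr_bigA; apply: eq_bigr => y _; rewrite phiE; apply: eq_bigr => i _.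
  by rewrite tnth_tsub !tnth_mktuple ffunE tnth_mktuple.
(* The points m of F are grouped by the integer cube containing m + [node y]. Each cube holds at
   most K - 1 of them, and by Bessel the weights of the cubes sum to at most 1. *)
have up (y : {ffun 'I_n -> 'I_T}) :
    \sum_(m <- F) phi (tsub (node y) (ztuple (zeta y m))) <= K - 1.
  pose Z := undup [seq zeta y m | m <- F].
  pose psi z := phi (tsub (node y) (ztuple z)).
  have uZ : uniq Z by exact: undup_uniq.
  have -> : \sum_(m <- F) phi (tsub (node y) (ztuple (zeta y m))) =
      \sum_(m <- F) \sum_(z <- Z) (if zeta y m == z then psi z else 0).
    rewrite !big_seq; apply: eq_bigr => m mF.
    have mZ : zeta y m \in Z by rewrite mem_undup map_f.
    rewrite (bigD1_seq (zeta y m))//= eqxx big1 ?addr0// => z.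
    by rewrite eq_sym => /negbTE ->.
  rewrite exchange_big /=.
  apply: (@le_trans _ _ (\sum_(z <- Z) (K - 1) * psi z)).
    apply: ler_sum => z _; rewrite -big_mkcond -big_filter /=.
    set Fz := [seq m <- F | zeta y m == z].
    have -> : \sum_(m <- Fz) psi z = (size Fz)%:R * psi z.
      by rewrite -sum1_size natr_sum mulr_suml; under [RHS]eq_bigr do rewrite mul1r.
    rewrite ler_wpM2r ?sqr_ge0//; apply: (few (node y) z Fz).
    - exact: filter_uniq.
    - by move=> m; rewrite mem_filter => /andP[_ /FL].
    - by move=> m; rewrite mem_filter => /andP[/eqP <- _] i; rewrite ffunE.
  rewrite -mulr_sumr -[leRHS]mulr1 ler_wpM2l//.
    by rewrite subr_ge0 -[1]/(1%:R) ler_nat; apply/card_gt0P; exists i0.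
  exact: bessel_integer_shifts.
move: low; rewrite exchange_big /=; under eq_bigr do rewrite swap.
rewrite exchange_big /=.
have Tn0 : 0 < (T ^ n)%:R :> R by rewrite ltr0n expn_gt0.
have : \sum_(y : {ffun 'I_n -> 'I_T}) \sum_(m <- F) phi (tsub (node y) (ztuple (zeta y m)))
    <= (T ^ n)%:R * (K - 1).
  apply: (@le_trans _ _ (\sum_(y : {ffun 'I_n -> 'I_T}) (K - 1))).
    by apply: ler_sum => y _; exact: up.
  by rewrite sumr_const card_ffun !card_ord -[leLHS]mulr_natl.
move=> h1 h2; have := le_trans h2 (lerD h1 (lexx _)).
rewrite -mulrDr ler_pM2l//.
have : (size F)%:R * (C / T%:R) < 2^-1.
  rewrite mulrA ltr_pdivrMr//; move: FT; rewrite -mulrA.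
  by move: (_ * C) => q; lra.
by lra.
Qed.

End spectrum_density.

(** * The tile and its exponential sum *)

Section periodic_sums.
Variables (V : nmodType) (n : nat).
Implicit Types (G : ('I_n -> int) -> V) (t : 'I_n -> int).

Definition periodic N (T : Type) (G : ('I_n -> int) -> T) : Prop :=
  forall z z', (forall k, (N %| z k - z' k)%Z) -> G z = G z'.

Lemma sum_shift (N : nat) G t : (0 < N)%N -> periodic N G ->
  \sum_(x : {ffun 'I_n -> 'I_N}) G (fun k => (x k : nat)%:Z + t k) =
  \sum_(x : {ffun 'I_n -> 'I_N}) G (fun k => (x k : nat)%:Z).
Proof.
move=> N0 pG; have N0' : (N : int) != 0 by rewrite eqz_nat -lt0n.
have sP (x : {ffun 'I_n -> 'I_N}) k : (`|(((x k : nat)%:Z + t k) %% N)%Z|%N < N)%N.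
  by rewrite -ltz_nat gez0_abs ?modz_ge0// ltz_pmod.
pose sg (x : {ffun 'I_n -> 'I_N}) : {ffun 'I_n -> 'I_N} := [ffun k => Ordinal (sP x k)].
have sgE x k : (sg x k : nat)%:Z = (((x k : nat)%:Z + t k) %% N)%Z.
  by rewrite ffunE /= gez0_abs ?modz_ge0.
have inj_sg : injective sg.
  move=> x y xy; apply/ffunP => k; apply: val_inj => /=; apply/eqP.
  have : (((x k : nat)%:Z + t k) %% N)%Z = (((y k : nat)%:Z + t k) %% N)%Z.
    by rewrite -!sgE xy.
  by move/eqP; rewrite eqz_modDr !modz_small ?eqz_nat// ltz_nat ltn_ord.
rewrite [RHS](reindex_inj inj_sg); apply: eq_bigr => x _; apply: pG => k.
by rewrite sgE -eqz_mod_dvd modz_mod.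
Qed.

Lemma sum_split (N K : nat) G : (0 < N)%N ->
  \sum_(w : {ffun 'I_n -> 'I_(N * K)}) G (fun k => (w k : nat)%:Z) =
  \sum_(x : {ffun 'I_n -> 'I_N}) \sum_(y : {ffun 'I_n -> 'I_K})
    G (fun k => (x k : nat)%:Z + N%:Z * (y k : nat)%:Z).
Proof.
move=> N0.
have lt (x : 'I_N) (y : 'I_K) : (x + N * y < N * K)%N.
  have xN := ltn_ord x; have yK := ltn_ord y.
  by apply: (@leq_trans (N * y.+1)); rewrite ?leq_mul2l ?yK ?orbT// mulnS ltn_add2r.
pose f (p : {ffun 'I_n -> 'I_N} * {ffun 'I_n -> 'I_K}) : {ffun 'I_n -> 'I_(N * K)} :=
  [ffun k => Ordinal (lt (p.1 k) (p.2 k))].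
have injf : injective f.
  move=> [x y] [x' y'] /ffunP xy.
  have E k : (x k + N * y k = x' k + N * y' k)%N.
    by have := congr1 val (xy k); rewrite !ffunE.
  have xx k : x k = x' k :> nat.
    have md a b : (a < N -> (a + N * b) %% N = a)%N.
      by move=> aN; rewrite addnC mulnC modnMDl modn_small.
    by have := congr1 (fun m => m %% N)%N (E k); rewrite !md.
  congr pair; apply/ffunP => k; apply: val_inj => /=; first exact: xx.
  by have := E k; rewrite xx => /addnI/eqP; rewrite eqn_pmul2l// => /eqP.
have bijf : bijective f.
  apply: inj_card_bij => //.
  by rewrite card_prod !card_ffun !card_ord expnMn.
rewrite pair_big /= (reindex f); last exact: onW_bij.
apply: eq_bigr => -[x y] _; congr G; apply/funext => k.
by rewrite ffunE /= PoszD PoszM.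
Qed.

End periodic_sums.

Section dirichlet_kernel.
Context {R : realType}.

(** For t nonzero, the geometric sum of ratio e(t) can vanish only if e(K t) = 1, and 0 < |K t| < 1
    excludes this. *)
Lemma dirichlet_neq0 (K : nat) (t : R) : (0 < K)%N -> `|t| < K%:R^-1 ->
  \sum_(y < K) ee (t * (y : nat)%:R) != 0.
Proof.
move=> K0 tK; have KR : 0 < K%:R :> R by rewrite ltr0n.
have [->|t0] := eqVneq t 0.
  under eq_bigr do rewrite mul0r ee0.
  by rewrite sumr_const card_ord pnatr_eq0 -lt0n.
have tK1 : `|K%:R * t| < 1.
  by rewrite normrM (ger0_norm (ltW KR)) mulrC -ltr_pdivlMr// mul1r.
have small (s : R) : s != 0 -> `|s| < 1 -> ee s != 1.
  move=> s0 s1; apply/eqP => /ee_eq1 [z sz]; move: s0 s1; rewrite sz.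
  rewrite intr_eq0 -intr_norm -[1]/(1%:~R) ltr_int.
  by case: z {sz} => [[|z]|z].
under eq_bigr do rewrite mulr_natr eeMn.
apply/eqP => S0.
have /eqP := subrX1 (ee t) K; rewrite S0 mulr0 subr_eq0 -eeMn -mulr_natl.
apply/negP/small => //; rewrite mulf_neq0//; exact: lt0r_neq0.
Qed.

End dirichlet_kernel.

Section tables.

(* L is [ltable]. Up to sign, [dtable] lists the differences of two distinct elements
   of L. The six vectors of [btable] are obtained by the Chinese remainder theorem from
   residues modulo 8, modulo 3, and a first coordinate divisible by 11. For each row j,
   d_j maps their residues modulo 8 to three pairs {c, c + 4}, and v_j is constant modulo 3
   on each pair and separates the pairs. *)
Definition dtable : seq (seq int) :=
  [:: [:: 1; 0; 0]; [:: 0; 1; 0]; [:: 0; 0; 1]; [:: 1; -1; 0]; [:: 1; 0; -1];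
      [:: 0; 1; -1]; [:: -1; 1; 1]; [:: -1; 2; 0]; [:: -1; 0; 2]]%Z.

Definition vtable : seq (seq int) :=
  [:: [:: 1; 0; 0]; [:: 0; 0; 1]; [:: 0; 1; 2]; [:: 1; 1; 2]; [:: 1; 0; 2];
      [:: 1; 0; 0]; [:: 0; 1; 0]; [:: 0; 1; 2]; [:: 0; 0; 1]]%Z.

Definition btable : seq (seq int) :=
  [:: [:: 0; 0; 0]; [:: 132; 18; 22]; [:: 154; 4; 3]; [:: 22; 17; 20];
      [:: 110; 13; 2]; [:: 242; 14; 7]]%Z.

Definition ltable : seq (seq int) :=
  [:: [:: 0; 0; 0]; [:: 1; 0; 0]; [:: 0; 1; 0]; [:: 0; 0; 1]; [:: 1; 0; -1];
      [:: 1; -1; 0]]%Z.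

(** The default value matters: there are nine rows but eleven classes modulo 11, and the classes 9
    and 10 reuse row 0. Eleven is the least integer from nine on that is coprime to 8 and 3. *)
Definition dvec (j : nat) : seq int := nth [:: 1; 0; 0]%Z dtable j.
Definition vvec (j : nat) : seq int := nth [:: 1; 0; 0]%Z vtable j.
Definition bvec (i : nat) : seq int := nth [::] btable i.
Definition lvec (i : nat) : seq int := nth [::] ltable i.

Definition period : nat := 264.

Definition coords (c : seq int) (k : 'I_3) : int := nth 0 c k.

Definition tdot (c : seq int) (z : 'I_3 -> int) : int := \sum_k coords c k * z k.

Definition cls (z : 'I_3 -> int) : nat := `|(z ord0 %% 11)%Z|%N.

(* The class modulo 11 of the first coordinate selects a row j. The conditions on d_j
   and v_j then select one vector out of the six of [btable], which makes the tiling. *)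
Definition inP (z : 'I_3 -> int) : bool :=
  ((tdot (dvec (cls z)) z %% 8)%Z < 4) && ((tdot (vvec (cls z)) z %% 3)%Z == 0).

Definition sdot (c b : seq int) : int := c`_0 * b`_0 + c`_1 * b`_1 + c`_2 * b`_2.

Lemma tdotE c z : tdot c z = c`_0 * z ord0 + c`_1 * z (inord 1) + c`_2 * z (inord 2).
Proof.
rewrite /tdot /coords !big_ord_recl big_ord0 addr0 addrA /=.
by congr (_ + _ * z _ + _ * z _); apply: val_inj; rewrite /= inordK.
Qed.

Lemma tdot_coords c b : tdot c (coords b) = sdot c b.
Proof. by rewrite tdotE /coords /= !inordK. Qed.

Lemma tdotD c z z' : tdot c (fun k => z k + z' k) = tdot c z + tdot c z'.
Proof. by rewrite /tdot -big_split; apply: eq_bigr => k _; rewrite mulrDr. Qed.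

Lemma tdotB c z z' : tdot c (fun k => z k - z' k) = tdot c z - tdot c z'.
Proof. by rewrite /tdot -sumrB; apply: eq_bigr => k _; rewrite mulrBr. Qed.

Lemma tdotZ c a z : tdot c (fun k => a * z k) = a * tdot c z.
Proof. by rewrite /tdot mulr_sumr; apply: eq_bigr => k _; rewrite mulrCA. Qed.

Lemma tdot_mod (m : int) c z z' : (forall k, (m %| z k - z' k)%Z) ->
  (tdot c z = tdot c z' %[mod m])%Z.
Proof.
move=> zz; apply/eqP; rewrite eqz_mod_dvd -tdotB.
by apply: rpred_sum => k _; apply: dvdz_mull; exact: zz.
Qed.

Lemma cls_mod z z' : (11 %| z ord0 - z' ord0)%Z -> cls z = cls z'.
Proof. by move=> zz; rewrite /cls; congr absz; apply/eqP; rewrite eqz_mod_dvd. Qed.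

Lemma cls_lt z : (cls z < 11)%N.
Proof. by rewrite -ltz_nat /cls gez0_abs ?modz_ge0// ltz_pmod. Qed.

Lemma inP_periodic : periodic period inP.
Proof.
move=> z z' zz; have dv (m : int) : (m %| period%:Z)%Z -> forall k, (m %| z k - z' k)%Z.
  by move=> mp k; apply: dvdz_trans mp (zz k).
rewrite /inP (cls_mod (dv 11 isT ord0)).
by rewrite (tdot_mod _ (dv 8 isT)) (tdot_mod _ (dv 3 isT)).
Qed.

Let fiber_cond j (c w : int) i : bool :=
  (((c - sdot (dvec j) (bvec i)) %% 8)%Z < 4) &&
  (((w - sdot (vvec j) (bvec i)) %% 3)%Z == 0).

Let fiber_check : all (fun j => all (fun c => all (fun w =>
    has (fun i => fiber_cond j (Posz c) (Posz w) i &&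
      all (fun i' => fiber_cond j (Posz c) (Posz w) i' ==> (i' == i)) (iota 0 6))
    (iota 0 6)) (iota 0 3)) (iota 0 8)) (iota 0 11).
Proof. by vm_compute. Qed.

(** The first coordinates in [btable] are divisible by 11, so the shifts preserve the class and its
    row j. Only d_j . z modulo 8 and v_j . z modulo 3 then matter, which reduces the tiling to the
    finite [fiber_check]. *)
Lemma inP_shiftE z (i : 'I_6) : inP (fun k => z k - coords (bvec i) k) =
  fiber_cond (cls z) `|(tdot (dvec (cls z)) z %% 8)%Z|%N `|(tdot (vvec (cls z)) z %% 3)%Z|%N i.
Proof.
have b0 : all (fun b : seq int => (11 %| b`_0)%Z) btable by vm_compute.
have -> : inP (fun k => z k - coords (bvec i) k) =
    fiber_cond (cls z) (tdot (dvec (cls z)) z) (tdot (vvec (cls z)) z) i.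
  rewrite /inP (cls_mod (z' := z)); last first.
    rewrite /= addrAC subrr add0r rpredN /coords /=.
    by apply: (allP b0); apply: mem_nth; exact: ltn_ord.
  by rewrite !tdotB !tdot_coords.
have md (x y m : int) : m != 0 -> ((`|(x %% m)%Z|%N%:Z - y) %% m = (x - y) %% m)%Z.
  by move=> m0; rewrite (gez0_abs (modz_ge0 x m0)); exact: modzDml.
by rewrite /fiber_cond (md _ _ 8 isT) (md _ _ 3 isT).
Qed.

Lemma absz_modz_lt (x : int) (m : nat) : (0 < m)%N -> (`|(x %% m)%Z| < m)%N.
Proof.
move=> m0; have m0' : (m : int) != 0 by rewrite eqz_nat -lt0n.
by rewrite -ltz_nat (gez0_abs (modz_ge0 x m0')) ltz_pmod.
Qed.

Lemma inP_tile z : exists i : 'I_6, inP (fun k => z k - coords (bvec i) k) /\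
  forall i' : 'I_6, inP (fun k => z k - coords (bvec i') k) -> i' = i.
Proof.
set c := `|(tdot (dvec (cls z)) z %% 8)%Z|%N; set w := `|(tdot (vvec (cls z)) z %% 3)%Z|%N.
have c8 : (c < 8)%N by exact: absz_modz_lt.
have w3 : (w < 3)%N by exact: absz_modz_lt.
have M m k : (m < k)%N -> m \in iota 0 k by rewrite mem_iota.
have /hasP[i + /andP[iP /allP iU]] :=
  allP (allP (allP fiber_check _ (M _ _ (cls_lt z))) _ (M _ _ c8)) _ (M _ _ w3).
rewrite mem_iota /= => i6; exists (Ordinal i6); split; first by rewrite inP_shiftE.
move=> i'; rewrite inP_shiftE => i'P; apply: val_inj => /=; apply/eqP.
by have /implyP := iU i' (M _ _ (ltn_ord i')); apply.
Qed.

End tables.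

(** * Nonvanishing of the exponential sum near the differences of L *)

Section nonvanishing.
Context {R : realType}.

(* Positive for c = 0, 1, 2, 3 modulo 8, and changing sign under c |-> c + 4. *)
Let sgn (c : int) : R := complex.Im (ee (c%:~R / 8 + 16^-1)).

Let sgnE c : sgn c = sin (pi * (c%:~R / 4 + 8^-1)).
Proof. by rewrite /sgn /ee /=; congr sin; field. Qed.

Let sgn_mod8 c : sgn c = sgn (c %% 8)%Z.
Proof.
rewrite /sgn {1}(divz_eq c 8) intrD intrM mulrDl mulfK ?pnatr_eq0// -addrA addrC.
by rewrite eeDint.
Qed.

Let sgn_shift4 c c' : (c' %% 8)%Z = 4 -> sgn (c + c') = - sgn c.
Proof.
move=> c4; have -> : sgn (c + c') = sgn (c + 4).
  by rewrite sgn_mod8 -modzDmr c4 -sgn_mod8.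
by rewrite !sgnE -sinDpi; congr sin; rewrite intrD; field.
Qed.

Let sgn_ge0 c : (c %% 8)%Z < 4 -> 0 < sgn c.
Proof.
rewrite sgn_mod8; have := modz_ge0 c (isT : (8 : int) != 0).
move: (c %% 8)%Z => r r0 r4; rewrite sgnE.
have r0' : 0 <= r%:~R :> R by rewrite ler0z.
have r3 : r%:~R <= 3 :> R by rewrite -[3]/((3 : int)%:~R) ler_int; lia.
apply: sin_gt0_pi; apply/andP; split.
  by rewrite mulr_gt0 ?pi_gt0//; lra.
by rewrite -[ltRHS]mulr1 ltr_pM2l ?pi_gt0//; lra.
Qed.

(* If d differs from d_j, some t has d_j . t = 0 and d . t = 4 modulo 8, and the shift of z
   by 33 t, which is invisible modulo 3 and modulo 11, makes the sum of [piece d j] equal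
   to its opposite. *)
Let shift_check : all (fun d : seq int => all (fun j =>
    (d == dvec j) || has (fun t : nat * nat * nat =>
    let t' : seq int := [:: Posz t.1.1; Posz t.1.2; Posz t.2] in
    ((sdot (dvec j) t' %% 8)%Z == 0) && ((sdot d t' %% 8)%Z == 4))
  [seq (x, y) | x <- [seq (x, y) | x <- iota 0 8, y <- iota 0 8], y <- iota 0 8]) (iota 0 11))
  dtable.
Proof. by vm_compute. Qed.

(** The contribution of class j to the imaginary part of the exponential sum at d / 8, rotated by
    e(1/16). *)
Let piece d j (z : 'I_3 -> int) : R :=
  if inP z && (cls z == j) then sgn (tdot d z) else 0.

Let piece_ge0 d j z : d = [:: 0; 0; 0] \/ d = dvec j -> 0 <= piece d j z.
Proof.
rewrite /piece => dE; case: ifP => [/andP[Pz /eqP zj]|_]; last exact: lexx.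
apply: ltW; apply: sgn_ge0.
case: dE => ->; last by move: Pz; rewrite /inP zj => /andP[].
have -> : tdot [:: 0; 0; 0] z = 0 by rewrite tdotE !mul0r !addr0.
by rewrite mod0z.
Qed.

Let sum_piece0 d j : d \in dtable -> (j < 11)%N -> d <> dvec j ->
  \sum_(x : {ffun 'I_3 -> 'I_period}) piece d j (fun k => (x k : nat)%:Z) = 0.
Proof.
move=> dT j11 dj.
have := allP (allP shift_check _ dT) j; rewrite mem_iota j11 => /(_ isT).
case/orP => [/eqP/dj[]|/hasP[[[t1 t2] t3] _ /=]].
set t := [:: Posz t1; Posz t2; Posz t3] => /andP[/eqP tj /eqP td].
pose s (k : 'I_3) : int := 33 * coords t k.
have per : periodic period (piece d j).
  move=> z z' zz.
  have dv (m : int) : (m %| period%:Z)%Z -> forall k, (m %| z k - z' k)%Z.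
    by move=> mp k; apply: dvdz_trans mp (zz k).
  rewrite /piece (inP_periodic zz) (cls_mod (dv 11 isT ord0)).
  by rewrite sgn_mod8 (tdot_mod _ (dv 8 isT)) -sgn_mod8.
set Sm := \sum_x _.
have : Sm = - Sm.
  rewrite -sumrN; apply: etrans (esym (sum_shift s (isT : 0 < period)%N per)) _.
  apply: eq_bigr => x _.
  set z := fun k => (x k : nat)%:Z; rewrite /piece.
  have cz : cls (fun k => z k + s k) = cls z.
    apply: cls_mod; rewrite /s addrAC subrr add0r.
    by apply: dvdz_mulr.
  have Pz : cls z = j -> inP (fun k => z k + s k) = inP z.
    move=> zj; rewrite /inP cz zj !tdotD !tdotZ !tdot_coords.
    have -> : ((tdot (dvec j) z + 33 * sdot (dvec j) t) %% 8 = tdot (dvec j) z %% 8)%Z.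
      by rewrite -modzDmr -modzMmr tj mulr0 mod0z addr0.
    have -> : ((tdot (vvec j) z + 33 * sdot (vvec j) t) %% 3 = tdot (vvec j) z %% 3)%Z.
      have -> : 33 * sdot (vvec j) t = (11 * sdot (vvec j) t) * 3 by rewrite mulrAC.
      by rewrite addrC; exact: modzMDl.
    exact: erefl.
  rewrite -/(cls (fun k => z k + s k)) cz.
  have [zj|] := eqVneq (cls z) j; last by rewrite !andbF oppr0.
  rewrite (Pz zj); case: ifP => _; last by rewrite oppr0.
  rewrite tdotD tdotZ tdot_coords; apply: sgn_shift4.
  by rewrite -modzMmr td.
by lra.
Qed.

(* The multiple of 24 in the first coordinate is j modulo 11, as 24 * 6 = 1 modulo 11. *)
Let base_point (j : nat) : {ffun 'I_3 -> 'I_period} :=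
  [ffun k => if k == ord0 then inord (24 * ((6 * j) %% 11)) else inord 0].

Let base_check : all (fun j => (24 * ((6 * j) %% 11)) %% 11 == j)%N (iota 0 11).
Proof. by vm_compute. Qed.

Let base_lt j : (24 * ((6 * j) %% 11) < period)%N.
Proof.
have := @ltn_pmod (6 * j) 11 isT; move: (6 * j %% 11)%N => r r11.
by apply: (@leq_ltn_trans (24 * 10)); [rewrite leq_mul2l; exact: r11 | exact: isT].
Qed.

(** All coordinates of the point are multiples of 24, so every linear form vanishes there modulo 8
    and modulo 3. *)
Let piece_base d j : (j < 11)%N ->
  piece d j (fun k => (base_point j k : nat)%:Z) = sgn 0.
Proof.
move=> j11; set z := fun k => _.
have lt := base_lt j.
have z0 : z ord0 = (24 * ((6 * j) %% 11))%N by rewrite /z ffunE eqxx inordK.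
have zk k : k != ord0 -> z k = 0.
  by move=> k0; rewrite /z ffunE (negbTE k0) inordK.
have tz c : tdot c z = 24 * (c`_0 * ((6 * j) %% 11)%N).
  rewrite tdotE z0 !zk ?mulr0 ?addr0; last 2 first.
  - by apply/eqP => /(congr1 val); rewrite /= inordK.
  - by apply/eqP => /(congr1 val); rewrite /= inordK.
  by rewrite PoszM mulrCA.
have cz : cls z = j.
  rewrite /cls z0 modz_nat absz_nat.
  by apply/eqP; apply: (allP base_check); rewrite mem_iota.
have m8 a : (24 * a %% 8)%Z = 0.
  by rewrite -[24 : int]/(8 * 3 : int) -mulrA modzMr.
have m3 a : (24 * a %% 3)%Z = 0.
  by rewrite -[24 : int]/(3 * 8 : int) -mulrA modzMr.
have Pz : inP z by rewrite /inP (tz (dvec _)) (tz (vvec _)) m8 m3 eqxx.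
by rewrite /piece Pz cz eqxx (tz d) sgn_mod8 m8.
Qed.

Definition dvectors : seq (seq int) := [:: 0; 0; 0] :: dtable.

(** A class whose row is d, or any class if d = 0, has nonnegative terms only, among them [sgn 0] at
    its base point. Every other class sums to 0. *)
Lemma Im_sum_inP_ge (d : seq int) : d \in dvectors ->
  sgn 0 <= \sum_(x : {ffun 'I_3 -> 'I_period} | inP (fun k => (x k : nat)%:Z))
    sgn (tdot d (fun k => (x k : nat)%:Z)).
Proof.
move=> dT.
have -> : \sum_(x : {ffun 'I_3 -> 'I_period} | inP (fun k => (x k : nat)%:Z))
    sgn (tdot d (fun k => (x k : nat)%:Z)) =
  \sum_(j < 11) \sum_(x : {ffun 'I_3 -> 'I_period}) piece d j (fun k => (x k : nat)%:Z).
  rewrite exchange_big /= big_mkcond; apply: eq_bigr => x _.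
  set z := fun k => (x k : nat)%:Z.
  rewrite (bigD1 (Ordinal (cls_lt z))); last exact: isT.
  rewrite big1 => [|j /eqP jx].
    by apply: etrans (esym (addr0 _)); rewrite /piece eqxx andbT.
  rewrite /piece; case: ifP => [/andP[_ /eqP xj]|_]; last exact: erefl.
  by case: jx; apply: val_inj; rewrite /= xj.
have nonneg (j : 'I_11) :
    0 <= \sum_(x : {ffun 'I_3 -> 'I_period}) piece d j (fun k => (x k : nat)%:Z).
  have [->|dj] := eqVneq d (dvec j).
    by apply: sumr_ge0 => x _; apply: piece_ge0; right.
  move: dT; rewrite inE => /predU1P[->|dT].
    by apply: sumr_ge0 => x _; apply: piece_ge0; left.
  by rewrite (sum_piece0 dT (ltn_ord j)); [exact: lexx | exact/eqP].
have [j0 dj0] : exists j0 : 'I_11, d = [:: 0; 0; 0] \/ d = dvec j0.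
  move: dT; rewrite inE => /predU1P[->|dT]; first by exists ord0; left.
  have h : (index d dtable < 11)%N.
    apply: (@ltn_trans (size dtable)); last exact: isT.
    by rewrite index_mem.
  by exists (Ordinal h); right; rewrite /dvec (nth_index _ dT).
rewrite (bigD1 j0 isT) -[leLHS]addr0; apply: lerD; last first.
  by apply: sumr_ge0 => j _; exact: nonneg.
rewrite (bigD1 (base_point j0) isT) (piece_base d (ltn_ord j0)) -[leLHS]addr0.
apply: lerD; first exact: lexx.
by apply: sumr_ge0 => x _; exact: piece_ge0.
Qed.

Let W (d : seq int) (eps : 'I_3 -> R) : R[i] :=
  \sum_(x : {ffun 'I_3 -> 'I_period} | inP (fun k => (x k : nat)%:Z))
    ee (\sum_k ((coords d k)%:~R / 8 + eps k) * (x k : nat)%:R).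

Let sgn0_gt0 : 0 < sgn 0. Proof. by apply: sgn_ge0; rewrite mod0z. Qed.

Let W0_ge d : d \in dvectors -> sgn 0 <= Normc.normc (W d (fun=> 0)).
Proof.
move=> dT; apply: le_trans (Im_sum_inP_ge dT) _.
rewrite [leRHS](_ : _ = Normc.normc (ee 16^-1 * W d (fun=> 0))); last first.
  by rewrite Normc.normcM normc_ee mul1r.
apply: le_trans (normc_Im _); apply: le_trans (ler_norm _).
rewrite /W mulr_sumr cIm_sum le_eqVlt; apply/orP; left; apply/eqP.
apply: eq_bigr => x _; rewrite /sgn -eeD; congr (complex.Im (ee _)).
rewrite addrC; congr (_ + _).
rewrite /tdot rmorph_sum mulr_suml; apply: eq_bigr => k _.
by rewrite addr0 rmorphM /= mulrAC.
Qed.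

Let W_lip d (eps : 'I_3 -> R) (e : R) : (forall k, `|eps k| <= e) ->
  Normc.normc (W d eps - W d (fun=> 0)) <=
    (period ^ 3)%:R * (4 * pi * (3 * (period%:R * e))).
Proof.
move=> epse; rewrite /W -sumrB; apply: le_trans (normc_sum _ _ _) _.
set C := _ * (3 * _).
have e0 : 0 <= e by exact: le_trans (normr_ge0 _) (epse ord0).
have C0 : 0 <= C by rewrite !mulr_ge0 ?pi_ge0 ?ler0n.
apply: (@le_trans _ _ (\sum_(x : {ffun 'I_3 -> 'I_period}) C)).
  rewrite big_mkcond; apply: ler_sum => x _; case: ifP => _; last exact: C0.
  apply: le_trans (ee_lip _ _) _; apply: ler_wpM2l; first by rewrite mulr_ge0 ?pi_ge0.
  rewrite -sumrB; apply: le_trans (ler_norm_sum _ _ _) _.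
  apply: (@le_trans _ _ (\sum_(k < 3) period%:R * e)).
    apply: ler_sum => k _; rewrite -mulrBl addr0 addrAC subrr add0r mulrC normrM.
    apply: ler_pM; [exact: normr_ge0|exact: normr_ge0| |exact: epse].
    by rewrite (ger0_norm (ler0n _ _)) ler_nat; apply: ltnW; exact: ltn_ord.
  by rewrite sumr_const card_ord -[_ *+ 3]mulr_natl.
by rewrite sumr_const card_ffun !card_ord -[leLHS]mulr_natl.
Qed.

(* The finite sum over [0, period * K)^3 factors as a sum over one period, which is
   close to its nonzero value at eps = 0, times Dirichlet kernels. *)
Lemma exp_sum_inP_neq0 : exists2 K : nat, (0 < K)%N &
  forall (d : seq int) (eps : 'I_3 -> R), d \in dvectors ->
    (forall k, `|eps k| < (period * K)%:R^-1) ->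
    \sum_(w : {ffun 'I_3 -> 'I_(period * K)} | inP (fun k => (w k : nat)%:Z))
      ee (\sum_k ((coords d k)%:~R / 8 + eps k) * (w k : nat)%:R) != 0.
Proof.
(* For perturbations of size 1 / (period * K) the bound of [W_lip] is B / K. K is chosen to push it
   below [sgn 0], the lower bound for W at eps = 0. *)
pose B : R := (period ^ 3)%:R * (4 * pi * 3).
have B0 : 0 <= B by rewrite !mulr_ge0 ?pi_ge0 ?ler0n.
have BK := archi_boundP (divr_ge0 B0 (ltW sgn0_gt0)).
move: (Num.bound _) BK => K' BK.
pose K := K'.+1; have K0 : (0 < K)%N by [].
have KR : 0 < K%:R :> R by rewrite ltr0n.
have pR : 0 < period%:R :> R by rewrite ltr0n.
have pR0 := lt0r_neq0 pR; have KR0 := lt0r_neq0 KR.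
have BK' : B / K%:R < sgn 0.
  rewrite (ltr_pdivrMr _ _ KR) mulrC -(ltr_pdivrMr _ _ sgn0_gt0).
  by apply: lt_trans BK _; rewrite ltr_nat.
exists K; first exact: K0.
move=> d eps dT epsK.
have epsK' k : `|eps k| < (period%:R * K%:R)^-1 by rewrite -natrM.
pose G (z : 'I_3 -> int) : R[i] := if inP z then
  ee (\sum_k ((coords d k)%:~R / 8 + eps k) * (z k)%:~R) else 0.
have -> : \sum_(w : {ffun 'I_3 -> 'I_(period * K)} | inP (fun k => (w k : nat)%:Z))
    ee (\sum_k ((coords d k)%:~R / 8 + eps k) * (w k : nat)%:R) =
    \sum_(w : {ffun 'I_3 -> 'I_(period * K)}) G (fun k => (w k : nat)%:Z).
  exact: big_mkcond.
rewrite (sum_split _ _ (isT : 0 < period)%N).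
have -> : \sum_(x : {ffun 'I_3 -> 'I_period}) \sum_(y : {ffun 'I_3 -> 'I_K})
      G (fun k => (x k : nat)%:Z + period%:Z * (y k : nat)%:Z) =
    W d eps * \prod_(k < 3) \sum_(y < K) ee (period%:R * eps k * (y : nat)%:R).
  rewrite /W [X in _ = X * _]big_mkcond mulr_suml; apply: eq_bigr => x _.
  have Px (y : {ffun 'I_3 -> 'I_K}) :
      inP (fun k => (x k : nat)%:Z + period%:Z * (y k : nat)%:Z) = inP (fun k => (x k : nat)%:Z).
    by apply: inP_periodic => k; rewrite addrAC subrr add0r; apply: dvdz_mulr.
  rewrite /G; case: ifPn => xP; last first.
    rewrite mul0r; apply: big1 => y _; rewrite Px (negbTE xP); exact: erefl.
  under eq_bigr do rewrite Px xP.
  rewrite bigA_distr_bigA mulr_sumr; apply: eq_bigr => y _.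
  rewrite -ee_sum -eeD.
  (* As period = 8 * 33, a step by whole periods changes the phase of d / 8 by an integer; only eps
     feels it. *)
  rewrite -[RHS](eeDint _ (\sum_k coords d k * (33 * (y k : nat)%:Z))); congr ee.
  rewrite rmorph_sum -!big_split; apply: eq_bigr => k _ /=.
  rewrite intrD !intrM -[(period%:Z)%:~R]/((8 * 33)%:R : R) natrM.
  rewrite -[(Posz _)%:~R]/((x k : nat)%:R : R) -[(Posz _)%:~R]/((y k : nat)%:R : R).
  rewrite -[33%:~R]/(33%:R : R).
  by field.
apply: mulf_neq0; last first.
  apply/prodf_neq0 => k _; apply: dirichlet_neq0; first exact: K0.
  by rewrite normrM (ger0_norm (ltW pR)) -(ltr_pdivlMl _ _ pR) -invfM.
apply/eqP => W0.
have := W0_ge dT; rewrite leNgt => /negP; apply.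
rewrite -normcN -[- W d _]add0r -W0.
have le_eps k : `|eps k| <= (period%:R * K%:R)^-1 by exact: ltW.
apply: le_lt_trans (W_lip d le_eps) _; apply: le_lt_trans BK'.
by rewrite invfM (mulVKf pR0) /B !mulrA.
Qed.

End nonvanishing.

(** * The tile in a cube of side M and its complement *)

Section tile.
Variable M : nat.
Hypothesis M0 : (0 < M)%N.
Hypothesis periodM : (period %| M)%N.

Definition tile : finType := {w : {ffun 'I_3 -> 'I_M} | inP (fun k => (w k : nat)%:Z)}.

Definition tile_pt (w : tile) (k : 'I_3) : int := (val w k : nat)%:Z.

Definition cotile_pt (i : 'I_6) : 'I_3 -> int := coords (bvec i).

Lemma inP_tile_pt w : inP (tile_pt w).
Proof. exact: (valP w). Qed.

(** Supplies the cell at the origin on which [spectrum_density] builds its test functions. *)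
Lemma tile_pt0 : exists w, tile_pt w = fun=> 0.
Proof.
have P0 : inP (fun k => (([ffun=> Ordinal M0] : {ffun 'I_3 -> 'I_M}) k : nat)%:Z).
  have -> : (fun k => (([ffun=> Ordinal M0] : {ffun 'I_3 -> 'I_M}) k : nat)%:Z) = fun=> 0.
    by apply/funext => k; rewrite ffunE.
  by rewrite /inP !tdotE !mulr0 !addr0 !mod0z.
exists (Sub [ffun=> Ordinal M0] P0); apply/funext => k.
by rewrite /tile_pt SubK ffunE.
Qed.

Lemma tile_pt_inj_mod w w' : (forall k, (M %| tile_pt w k - tile_pt w' k)%Z) -> w = w'.
Proof.
move=> ww; apply: val_inj; apply/ffunP => k; apply: val_inj.
have := ww k; rewrite -eqz_mod_dvd /tile_pt !modz_nat eqz_nat.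
by rewrite !modn_small ?ltn_ord// => /eqP.
Qed.

Lemma tile_pt_inj : injective tile_pt.
Proof. by move=> w w' ww; apply: tile_pt_inj_mod => k; rewrite ww subrr dvdz0. Qed.

(** Since [inP] is also periodic modulo M, both indices select the translate of one and the same
    point, and uniqueness in [inP_tile] identifies them. *)
Lemma tiling_inj (c c' : tile * 'I_6) :
  (forall k, (M %| (tile_pt c.1 k + cotile_pt c.2 k) -
                   (tile_pt c'.1 k + cotile_pt c'.2 k))%Z) -> c = c'.
Proof.
case: c c' => [w i] [w' i'] /= cc.
pose z k := tile_pt w k + cotile_pt i k.
have [i'' [_ i''U]] := inP_tile z.
have iE : i = i''.
  apply: i''U; rewrite (_ : (fun k => _) = tile_pt w); first exact: inP_tile_pt.
  by apply/funext => k; rewrite /z addrK.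
have i'E : i' = i''.
  apply: i''U.
  suff -> : inP (fun k => z k - coords (bvec i') k) = inP (tile_pt w') by exact: inP_tile_pt.
  apply: inP_periodic => k.
  rewrite -addrA -opprD [coords _ k + _]addrC.
  by apply: dvdz_trans (cc k); exact: periodM.
have ii : i = i' by rewrite iE i'E.
rewrite ii; congr pair; apply: tile_pt_inj_mod => k.
by have := cc k; rewrite ii opprD addrACA subrr addr0.
Qed.

Let residue (z : 'I_3 -> int) : {ffun 'I_3 -> 'I_M} :=
  [ffun k => Ordinal (absz_modz_lt (z k) M0)].

Let residueE z k : (residue z k : nat)%:Z = (z k %% M)%Z.
Proof.
have M0' : (M : int) != 0 by rewrite eqz_nat -lt0n.
by rewrite ffunE /= (gez0_abs (modz_ge0 _ M0')).
Qed.

(** The sums biject onto (Z/M)^3: a residue v is reached by reducing modulo M the difference v - b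
    that lies in [inP]. *)
Lemma tiling_card : (#|tile| * #|'I_6| = M ^ 3)%N.
Proof.
pose f (c : tile * 'I_6) := residue (fun k => tile_pt c.1 k + cotile_pt c.2 k).
have injf : injective f.
  move=> c c' cc; apply: tiling_inj => k; rewrite -eqz_mod_dvd.
  rewrite -(residueE (fun k => tile_pt c.1 k + cotile_pt c.2 k)).
  by rewrite -(residueE (fun k => tile_pt c'.1 k + cotile_pt c'.2 k)) -/(f c) cc.
have surjf v : v \in codom f.
  have [i [iP _]] := inP_tile (fun k => (v k : nat)%:Z).
  pose y k : int := (v k : nat)%:Z - coords (bvec i) k.
  have wP : inP (fun k => (residue y k : nat)%:Z).
    suff -> : inP (fun k => (residue y k : nat)%:Z) = inP y by exact: iP.
    apply: inP_periodic => k; rewrite residueE.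
    by apply: (@dvdz_trans M); [exact: periodM | rewrite -eqz_mod_dvd modz_mod].
  apply/codomP; exists (exist _ (residue y) wP, i); apply/ffunP => k.
  apply: val_inj; apply/eqP; rewrite -eqz_nat residueE /= /tile_pt /= residueE.
  by rewrite modzDml /y /cotile_pt subrK modz_small// ltz_nat ltn_ord.
have := card_codom injf; rewrite card_prod => <-.
rewrite (eq_card (B := predT)) => [|v]; last by rewrite surjf.
by rewrite card_ffun !card_ord.
Qed.

End tile.

(** * The tile has no spectrum *)

Section tile_not_spectral.
Context {R : realType}.
Variable K : nat.
Hypothesis K0 : (0 < K)%N.
Hypothesis exp_sum_neq0 : forall (d : seq int) (eps : 'I_3 -> R), d \in dvectors ->
  (forall k, `|eps k| < (period * K)%:R^-1) ->
  \sum_(w : {ffun 'I_3 -> 'I_(period * K)} | inP (fun k => (w k : nat)%:Z))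
    ee (\sum_k ((coords d k)%:~R / 8 + eps k) * (w k : nat)%:R) != 0.

Let M := (period * K)%N.
Let Q := (33 * K)%N.
Let M0 : (0 < M)%N. Proof. by rewrite muln_gt0. Qed.
Let Q0 : (0 < Q)%N. Proof. by rewrite muln_gt0. Qed.
Let MQ : M = (8 * Q)%N. Proof. exact: (esym (mulnA 8 33 K)). Qed.

Notation a := (@tile_pt M).

Lemma exp_sum_tile_neq0 (d : seq int) (l : 3.-tuple R) (z : 'I_3 -> int) (eps : 'I_3 -> R) :
  d \in dvectors -> (forall k, `|eps k| < M%:R^-1) ->
  (forall k, tnth l k = (coords d k)%:~R / 8 + (z k)%:~R + eps k) -> exp_sum a l != 0.
Proof.
move=> dT epsM lE; suff <- : \sum_(w : {ffun 'I_3 -> 'I_M} | inP (fun k => (w k : nat)%:Z))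
    ee (\sum_k ((coords d k)%:~R / 8 + eps k) * (w k : nat)%:R) = exp_sum a l.
  exact: exp_sum_neq0.
pose P (w : {ffun 'I_3 -> 'I_M}) := inP (fun k => (w k : nat)%:Z).
apply: etrans (big_sub P _) _; apply: eq_bigr => w _.
rewrite -[LHS](eeDint _ (\sum_k z k * (val w k : nat)%:Z)); congr ee.
rewrite rmorph_sum -big_split; apply: eq_bigr => k _ /=.
by rewrite lE intrM; ring.
Qed.

Let ldiff (i i' : nat) : seq int :=
  [:: (lvec i)`_0 - (lvec i')`_0; (lvec i)`_1 - (lvec i')`_1; (lvec i)`_2 - (lvec i')`_2].

Let ldiff_check : all (fun i => all (fun i' =>
    ((ldiff i i' \in dvectors) || (ldiff i' i \in dvectors)) &&
    ((i == i') || has (fun k => ~~ (8 %| (ldiff i i')`_k)%Z) (iota 0 3)))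
  (iota 0 6)) (iota 0 6).
Proof. by vm_compute. Qed.

Let coords_ldiff i i' k : coords (ldiff i i') k = coords (lvec i) k - coords (lvec i') k.
Proof. by case: k => -[|[|[|]]]. Qed.

Lemma tile_not_spectral (L : set (3.-tuple R)) :
  ~ orthogonal_basis_L2 (cells a) L (@character R 3).
Proof.
move=> spL.
have [i0 i0E] := tile_pt0 M0.
have [u [z [F [uF FL Fz IF]]]] := spectrum_density (@tile_pt_inj M) i0E spL.
pose m (j : 'I_(size F)) := tnth (in_tuple F) j.
have mF j : m j \in F by exact: mem_tnth.
have minj : injective m by exact/tuple_uniqP.
(* The points are moved into [0, 1[^3 by a common translation, which leaves their differences
   unchanged. *)
pose y j k := tnth (m j) k + tnth u k - (z k)%:~R.
have y01 j k : 0 <= y j k < 1.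
  have := floor_itv (tnth (m j) k + tnth u k); rewrite (Fz _ (mF j)) intrD => yz.
  by rewrite /y subr_ge0 ltrBlDl.
have MR : 0 < M%:R :> R by rewrite ltr0n.
pose f j k := Num.floor (M%:R * y j k).
have f0 j k : 0 <= f j k by rewrite floor_ge0 mulr_ge0 ?ler0n//; case/andP: (y01 j k).
pose g j k := `|f j k|%N.
have gf j k : (g j k)%:R = (f j k)%:~R :> R by rewrite /g natr_absz (ger0_norm (f0 j k)).
have gy j k : (g j k)%:R <= M%:R * y j k < (g j k)%:R + 1.
  by have := floor_itv (M%:R * y j k); rewrite -/(f j k) intrD gf.
have gM j k : (g j k < 8 * Q)%N.
  rewrite -MQ -(ltr_nat R); have /andP[gy1 _] := gy j k; apply: le_lt_trans gy1 _.
  by rewrite -[ltRHS]mulr1 (ltr_pM2l MR); case/andP: (y01 j k).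
(* Since M = 8 Q, writing floor(M y) = Q q + r splits the position into a cell q of the grid of mesh
   1/8 and a place r inside it, in steps of 1/M. *)
pose r j : {ffun 'I_3 -> 'I_Q} := [ffun k => Ordinal (ltn_pmod (g j k) Q0)].
pose q j k := (g j k %/ Q)%N.
have close j j' k : r j = r j' ->
    `|tnth (m j) k - tnth (m j') k - ((q j k)%:R - (q j' k)%:R) / 8| < M%:R^-1.
  move=> rr; rewrite -(ltr_pM2l MR) (divff (lt0r_neq0 MR)) -{1}(gtr0_norm MR) -normrM.
  have := congr1 (fun r' : {ffun 'I_3 -> 'I_Q} => (r' k : nat)) rr; rewrite !ffunE /= => rk.
  have gE : (g j k)%:R - (g j' k)%:R = Q%:R * ((q j k)%:R - (q j' k)%:R) :> R.
    rewrite (divn_eq (g j k) Q) (divn_eq (g j' k) Q) rk -!/(q _ _) !natrD !natrM; ring.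
  have -> : M%:R * (tnth (m j) k - tnth (m j') k - ((q j k)%:R - (q j' k)%:R) / 8) =
      (M%:R * y j k - (g j k)%:R) - (M%:R * y j' k - (g j' k)%:R) :> R.
    transitivity (M%:R * y j k - M%:R * y j' k - ((g j k)%:R - (g j' k)%:R)); last by ring.
    rewrite gE.
    rewrite (_ : M%:R = 8 * Q%:R); last by rewrite MQ natrM.
    by rewrite /y; field.
  have := gy j k; have := gy j' k; move: (g j k) (g j' k) (M%:R * y j k) (M%:R * y j' k).
  by move=> g1 g2 y1 y2 /andP[? ?] /andP[? ?]; rewrite ltr_norml; apply/andP; split; lra.
(* Such a congruence would bring the difference of two points within 1/M of (l - l') / 8 modulo Z^3,
   where the exponential sum is nonzero. The transform of the cube is nonzero too, as both points
   lie in one unit cube, so the characters would not be orthogonal. *)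
have nocong j j' (i i' : nat) : j != j' -> r j = r j' -> ldiff i i' \in dvectors ->
    (forall k, (8 %| ((q j k)%:Z - (q j' k)%:Z) - coords (ldiff i i') k)%Z) -> False.
  move=> jj rr dT dq; have [_ /(_ (m j) (m j')) orth _] := spL.
  have mm : m j <> m j' by move=> /minj /eqP; rewrite (negbTE jj).
  have := orth (FL _ (mF j)) (FL _ (mF j')) mm.
  rewrite (L2_dot_character (@tile_pt_inj M)); apply/eqP; apply: mulf_neq0.
    apply: (exp_sum_tile_neq0 (z := fun k =>
        (((q j k)%:Z - (q j' k)%:Z) - coords (ldiff i i') k) %/ 8)%Z) dT (close j j' ^~ rr) _.
    move=> k; rewrite tnth_tsub; have /divzK dE := dq k.
    have {dE}/(congr1 (fun x : int => x%:~R : R)) := dE.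
    rewrite intrM !intrB; move: (_ %/ _)%Z => n nE.
    rewrite -[(q j k)%:R]/((Posz (q j k))%:~R) -[(q j' k)%:R]/((Posz (q j' k))%:~R).
    have -> : (Posz (q j k))%:~R = n%:~R * 8 + (coords (ldiff i i') k)%:~R + (Posz (q j' k))%:~R :> R.
      by rewrite nE; ring.
    by field.
  apply: hhprod_neq0 => k; rewrite tnth_tsub.
  have -> : tnth (m j) k - tnth (m j') k = y j k - y j' k by rewrite /y; ring.
  have := y01 j k; have := y01 j' k; move: (y j k) (y j' k) => y1 y2.
  by move=> /andP[? ?] /andP[? ?]; rewrite ltr_norml; apply/andP; split; lra.
(* Injectivity of this map on a class says that the translates of L by the q j are disjoint in
   (Z/8)^3. *)
pose psi (c : 'I_(size F) * 'I_6) : {ffun 'I_3 -> 'I_8} :=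
  [ffun k => Ordinal (absz_modz_lt ((q c.1 k)%:Z + coords (lvec c.2) k) (isT : 0 < 8)%N)].
have psiE c c' : psi c = psi c' -> forall k,
    (8 %| ((q c.1 k)%:Z - (q c'.1 k)%:Z) - coords (ldiff c'.2 c.2) k)%Z.
  move=> cc k; have := congr1 (fun v : {ffun 'I_3 -> 'I_8} => (v k : nat)%:Z) cc.
  rewrite !ffunE /= !gez0_abs ?modz_ge0//; move/eqP; rewrite eqz_mod_dvd coords_ldiff.
  by congr (_ %| _)%Z; ring.
have psi_inj (s : {ffun 'I_3 -> 'I_Q}) :
    {in finset.setX [set j | r j == s]%SET [set: 'I_6]%SET &, injective psi}.
  move=> [j i] [j' i']; rewrite !inE /= !andbT => /eqP js /eqP j's cc.
  have rr : r j = r j' by rewrite js j's.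
  have I6 (x : 'I_6) : (x : nat) \in iota 0 6 by rewrite mem_iota /= ltn_ord.
  (* [dvectors] contains each difference up to sign only; for the opposite sign the two points
     exchange roles. *)
  have /andP[/orP dT _] := allP (allP ldiff_check _ (I6 i)) _ (I6 i').
  have [jj|jj] := eqVneq j j'; last first.
    case: dT => dT; last by case: (nocong j j' i' i jj rr dT (psiE _ _ cc)).
    have jj' : j' != j by rewrite eq_sym.
    by case: (nocong j' j i i' jj' (esym rr) dT (psiE _ _ (esym cc))).
  subst j'; congr pair; apply: val_inj; apply/eqP.
  have /andP[_ /orP[//|/hasP[k]]] := allP (allP ldiff_check _ (I6 i')) _ (I6 i).
    by rewrite eq_sym.
  rewrite mem_iota /= => k3 /negP[].
  by have := psiE _ _ cc (Ordinal k3); rewrite /= subrr sub0r rpredN.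
have small (s : {ffun 'I_3 -> 'I_Q}) : (#|[set j | r j == s]%SET| <= 85)%N.
  have := leq_card_in psi _ (psi_inj s); rewrite cardsX cardsT card_ffun !card_ord => le512.
  by rewrite leqNgt; apply/negP => lt85; have := leq_mul lt85 (leqnn 6); lia.
have FM : (size F <= 85 * Q ^ 3)%N.
  rewrite -{1}(card_ord (size F)) -sum1_card (partition_big r predT)//=.
  apply: (@leq_trans (\sum_(s : {ffun 'I_3 -> 'I_Q}) 85)%N).
    apply: leq_sum => s _; apply: leq_trans (small s).
    by rewrite -sum1_card; apply: eq_leq; apply: eq_bigl => j; rewrite inE.
  by rewrite sum_nat_const card_ffun !card_ord mulnC.
have := tiling_card M0 (dvdn_mulr K (dvdnn period)).
have M3 : (M ^ 3 = 512 * Q ^ 3)%N by rewrite MQ expnMn.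
rewrite card_ord -/M M3 => card_tile.
have := leq_mul (leq_trans IF FM) (leqnn 6); rewrite card_tile mulnAC.
by rewrite leq_pmul2r ?expn_gt0 ?Q0.
Qed.

End tile_not_spectral.

Theorem theorem2 (R : realType) :
  exists (A : set (3.-tuple R)) (B : set (3.-tuple R)),
    [/\ bounded_Rn A, measurable A, bounded_Rn B & measurable B] /\
    ~ spectral A /\ spectral (prod_set A B : set (6.-tuple R)).
Proof.
have [K K0 sum_neq0] := @exp_sum_inP_neq0 R.
have M0 : (0 < period * K)%N by rewrite muln_gt0 K0.
have pM : (period %| period * K)%N by exact: dvdn_mulr.
exists (cells (@tile_pt (period * K))), (cells cotile_pt); split.
  by split; [exact: bounded_cells|exact: measurable_cells|exact: bounded_cells|
    exact: measurable_cells].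
split; first by case=> _ _ _ [L]; exact: tile_not_spectral.
exact: (spectral_prod_cells M0 (tiling_inj pM) (tiling_card M0 pM)).
Qed.
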